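(* Let $f$ be a transcendental self-map of $\mathbb{C}^*$. Then the escaping set $I(f)$ is either connected or has infinitely many components. Similarly, for each $e\in\{0,\infty\}^{\mathbb{N}_0}$, the little escaping set $I_e(f)$ is either connected or has infinitely many components.
   Context: $\mathbb{C}^*=\mathbb{C}\setminus\{0\}$, $\widehat{\mathbb{C}}=\mathbb{C}\cup\{\infty\}$, $\mathbb{N}_0=\mathbb{N}\cup\{0\}$. A transcendental self-map of $\mathbb{C}^*$ is a holomorphic map $f:\mathbb{C}^*\to\mathbb{C}^*$ for which both $0$ and $\infty$ are essential singularities. $f^n$ denotes the $n$-th iterate. The escaping set is $I(f)=\{z\in\mathbb{C}^*:\omega(z,f)\subseteq\{0,\infty\}\}$, where $\omega(z,f)=\bigcap_{n\in\mathbb{N}}\overline{\{f^k(z):k\ge n\}}$ with closure taken in $\widehat{\mathbb{C}}$. For $e=(e_n)_{n\in\mathbb{N}_0}\in\{0,\infty\}^{\mathbb{N}_0}$, the little escaping set with essential itinerary $e$ is $$I_e(f)=\{z\in I(f):\text{there exist }\ell,k\ge 0\text{ such that }|f^{n+\ell}(z)|>1\Leftrightarrow e_{n+k}=\infty\text{ for all }n\ge 0\}.$$ ''Component'' means connected component. *)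

(* Defs.v *)
From HB Require Import structures.
From mathcomp Require Import all_boot all_order all_algebra.
From mathcomp Require Import all_classical all_reals all_analysis.
From mathcomp Require Import complex.

Set Implicit Arguments.
Unset Strict Implicit.
Unset Printing Implicit Defensive.

Import Order.TTheory GRing.Theory Num.Theory.
Import numFieldNormedType.Exports.

Local Open Scope classical_set_scope.
Local Open Scope ring_scope.

(* [R[i]] packaged as a [numClosedFieldType]: this is what gives it the topology
   of its modulus and makes it a normed module over itself, so that [derivable]
   on it is complex differentiability. *)
Definition Cplx (R : realType) : numClosedFieldType := R[i].

Definition Csphere (R : realType) : topologicalType :=
  one_point_compactification (Cplx R).

Definition Cinf {R : realType} : Csphere R := None.

Definition to_sphere {R : realType} (z : Cplx R) : Csphere R := Some z.

Section transcendental_self_maps.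
Context {R : realType}.
Local Notation C := (Cplx R).
Local Notation Chat := (Csphere R).

Definition Cstar : set C := [set z | z != 0].

(* Only meant for open sets [U]. *)
Definition holomorphic_on (U : set C) (g : C -> C) : Prop :=
  forall z, U z -> derivable g z 1.

Definition removable_singularity (g : C -> C) (a : C) : Prop :=
  exists h : C -> C,
    (\forall z \near a, derivable h z 1) /\ (\forall z \near a^', h z = g z).

Definition pole (g : C -> C) (a : C) : Prop :=
  to_sphere (g z) @[z --> a^'] --> (Cinf : Chat).

(* For [g] holomorphic on a punctured neighbourhood of [a]. *)
Definition essential_singularity (g : C -> C) (a : C) : Prop :=
  ~ removable_singularity g a /\ ~ pole g a.

Definition essential_singularity_infty (g : C -> C) : Prop :=
  essential_singularity (fun z => g z^-1) 0.

(* A self-map of [Cstar] is represented by a total function on [C]; its value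
   at [0] is irrelevant, as orbits of points of [Cstar] never reach [0]. *)
Definition transcendental_self_map (f : C -> C) : Prop :=
  [/\ forall z, Cstar z -> Cstar (f z),
      holomorphic_on Cstar f,
      essential_singularity f 0 &
      essential_singularity_infty f].

Definition omega_limit (f : C -> C) (z : C) : set Chat :=
  \bigcap_(n in [set n | (0 < n)%N])
    closure [set to_sphere (iter k f z) | k in [set k | (n <= k)%N]].

Definition zero_infty : set Chat := [set to_sphere 0; Cinf].

Definition escaping_set (f : C -> C) : set C :=
  [set z | Cstar z /\ omega_limit f z `<=` zero_infty].

Definition little_escaping_set (f : C -> C) (e : nat -> Chat) : set C :=
  [set z | escaping_set f z /\
    exists l k : nat, forall n : nat,
      1 < `|iter (n + l) f z| <-> e (n + k)%N = Cinf].

Definition components (A : set C) : set (set C) := connected_component A @` A.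

End transcendental_self_maps.

(* Main.v *)
(* Let E be I(f) or I_e(f). It is completely invariant in the punctured plane and
   stable under replacing an orbit by one whose moduli stay within a bounded ratio.
   Suppose that E has finitely many, but at least two, components. By Picard's
   theorem every point has preimages near 0 and near infinity, so f permutes the
   components and each of them meets every circle around 0. Near a point of E all
   iterates omit a whole component, so by Bloch's theorem their logarithms have
   bounded oscillation: E is open. Components being relatively open, no circle lies
   in E, so the complement J of E, which is closed and backward invariant, meets
   every circle. By the growth of f near its singularities and Schottky's theorem, f
   maps an annulus of fixed logarithmic width around |z| = exp x, |x| large, onto a
   set containing such an annulus around |z| = exp x' whenever |x'| <= |x| + 1.
   Hence points of J can be pulled back along annuli to an orbit in J with any
   prescribed itinerary, escaping to {0, infinity}; such a point lies in E, a
   contradiction. *)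
Require Import Defs.
From mathcomp Require Import all_boot all_order all_algebra.
From mathcomp Require Import all_classical all_reals all_analysis.
From mathcomp Require Import complex ring lra.
Import numFieldNormedType.Exports.
Import Order.TTheory GRing.Theory Num.Theory.

Set Implicit Arguments.
Unset Strict Implicit.
Unset Printing Implicit Defensive.

Local Open Scope classical_set_scope.
Local Open Scope ring_scope.

(** Bloch's theorem serves twice. A logarithm of an iterate omits, at every real part, a point and
    its translates by multiples of 2 pi i, hence a net of radius 2 pi; its oscillation is then at
    most 64 (2 pi), uniformly in the iterate, which is what keeps the ratio of moduli along two
    orbits bounded. Applied to an inverse cosh of a normalised logarithm, the same theorem gives
    Schottky's. Integration takes place only along sides of rectangles, where Goursat's bisection
    yields a primitive. In the coordinate t = log (z - c) this primitive gives a mean value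
    inequality on circles, hence the maximum principle; the latter, applied to difference quotients,
    gives Cauchy estimates, removable singularities and the differentiability of derivatives. Annuli
    are lifted by z = exp t to vertical strips, where discs are available. Their width 96 pi arises
    thus: arguments are taken in [-pi, pi], so a disc of radius 3 pi about one lift of a point of a
    circle contains lifts of all the others, and Schottky's theorem needs a disc 32 times larger. *)

(** * Real coordinates and the real-valued modulus *)

Section ComplexPlane.
Context {R : realType}.
Local Notation C := (Cplx R).
Implicit Types (z w : C) (x y r : R).

(** The norm of [Cplx R] takes its values in [Cplx R], which is only partially ordered; all
    estimates are made with this modulus in [R]. *)
Definition cabs z : R := complex.Re `|z|.
Definition cx x y : C := Complex x y.
Definition cRe z : R := complex.Re z.
Definition cIm z : R := complex.Im z.
Definition rc x : C := cx x 0.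
Definition ci : C := cx 0 1.

Lemma cxE z : z = cx (cRe z) (cIm z).
Proof. by case: z. Qed.

Lemma cabsE z : `|z| = rc (cabs z).
Proof. by rewrite /cabs /rc /cx normc_def. Qed.

Lemma cabs_sqrt z : cabs z = Num.sqrt (cRe z ^+ 2 + cIm z ^+ 2).
Proof. by rewrite /cabs normc_def. Qed.

Lemma rcM x y : rc (x * y) = rc x * rc y.
Proof. exact: (rmorphM (real_complex R)). Qed.
Lemma rcD x y : rc (x + y) = rc x + rc y.
Proof. exact: (rmorphD (real_complex R)). Qed.
Lemma rcB x y : rc (x - y) = rc x - rc y.
Proof. exact: (rmorphB (real_complex R)). Qed.
Lemma rc0 : rc 0 = 0. Proof. by []. Qed.
Lemma rc1 : rc 1 = 1. Proof. by []. Qed.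
Lemma rcI : injective rc. Proof. by move=> x y []. Qed.
Lemma rcV x : rc x^-1 = (rc x)^-1.
Proof. exact: (fmorphV (real_complex R)). Qed.
Lemma rcX x n : rc (x ^+ n) = rc x ^+ n.
Proof. exact: (rmorphXn (real_complex R)). Qed.
Lemma rc_nat n : rc n%:R = n%:R.
Proof. exact: (rmorph_nat (real_complex R)). Qed.

Lemma cReD z w : cRe (z + w) = cRe z + cRe w.
Proof. by case: z; case: w. Qed.
Lemma cImD z w : cIm (z + w) = cIm z + cIm w.
Proof. by case: z; case: w. Qed.
Lemma cReN z : cRe (- z) = - cRe z.
Proof. by case: z. Qed.
Lemma cImN z : cIm (- z) = - cIm z.
Proof. by case: z. Qed.
Lemma cReM z w : cRe (z * w) = cRe z * cRe w - cIm z * cIm w.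
Proof. by case: z; case: w. Qed.
Lemma cImM z w : cIm (z * w) = cRe z * cIm w + cIm z * cRe w.
Proof. by case: z => a b; case: w => c d; rewrite /cIm /=; ring. Qed.
Lemma cRe0 : cRe 0 = 0. Proof. by []. Qed.
Lemma cIm0 : cIm 0 = 0. Proof. by []. Qed.
Lemma cRe1 : cRe 1 = 1. Proof. by []. Qed.
Lemma cIm1 : cIm 1 = 0. Proof. by []. Qed.
Lemma cRe_rc x : cRe (rc x) = x. Proof. by []. Qed.
Lemma cIm_rc x : cIm (rc x) = 0. Proof. by []. Qed.
Lemma cRe_cx x y : cRe (cx x y) = x. Proof. by []. Qed.
Lemma cIm_cx x y : cIm (cx x y) = y. Proof. by []. Qed.
Lemma cRe_ci : cRe ci = 0. Proof. by []. Qed.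
Lemma cIm_ci : cIm ci = 1. Proof. by []. Qed.
Definition cReImE := (cReD, cImD, cReN, cImN, cReM, cImM, cRe_rc, cIm_rc,
  cRe_cx, cIm_cx, cRe0, cIm0, cRe1, cIm1, cRe_ci, cIm_ci).

Lemma c_ext z w : cRe z = cRe w -> cIm z = cIm w -> z = w.
Proof. by case: z => a b; case: w => c d; rewrite /cRe /cIm /= => -> ->. Qed.

Lemma cxD x y : cx x y = rc x + ci * rc y.
Proof. by apply: c_ext; rewrite !cReImE; ring. Qed.

Lemma cabsM z w : cabs (z * w) = cabs z * cabs w.
Proof. by apply: rcI; rewrite rcM -!cabsE normrM. Qed.
Lemma cabsN z : cabs (- z) = cabs z.
Proof. by apply: rcI; rewrite -!cabsE normrN. Qed.
Lemma cabsB z w : cabs (z - w) = cabs (w - z).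
Proof. by rewrite -cabsN opprB. Qed.
Lemma cabsV z : cabs z^-1 = (cabs z)^-1.
Proof. by apply: rcI; rewrite rcV -!cabsE normfV. Qed.
Lemma cabsX z n : cabs (z ^+ n) = cabs z ^+ n.
Proof. by apply: rcI; rewrite rcX -!cabsE normrX. Qed.
Lemma cabs_ge0 z : 0 <= cabs z.
Proof. by rewrite cabs_sqrt sqrtr_ge0. Qed.
Lemma cabs_le_rc z x : (`|z| <= rc x) = (cabs z <= x).
Proof. by rewrite cabsE lecR. Qed.
Lemma cabs_lt_rc z x : (`|z| < rc x) = (cabs z < x).
Proof. by rewrite cabsE ltcR. Qed.
Lemma cabsD z w : cabs (z + w) <= cabs z + cabs w.
Proof. by rewrite -cabs_le_rc rcD -!cabsE ler_normD. Qed.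
Lemma cabs0 : cabs 0 = 0.
Proof. by rewrite /cabs normr0. Qed.
Lemma cabs1 : cabs 1 = 1.
Proof. by rewrite /cabs normr1. Qed.
Lemma cabs_eq0 z : (cabs z == 0) = (z == 0).
Proof. by rewrite -(normr_eq0 z) cabsE -(inj_eq rcI). Qed.
Lemma cabs_gt0 z : (0 < cabs z) = (z != 0).
Proof. by rewrite lt_neqAle cabs_ge0 andbT eq_sym cabs_eq0. Qed.
Lemma cabs_rc x : cabs (rc x) = `|x|.
Proof. by rewrite cabs_sqrt !cReImE expr0n addr0 sqrtr_sqr. Qed.
Lemma cabs_ci : cabs ci = 1.
Proof. by rewrite cabs_sqrt !cReImE expr0n add0r expr1n sqrtr1. Qed.
Lemma cabs_sqr z : cabs z ^+ 2 = cRe z ^+ 2 + cIm z ^+ 2.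
Proof. by rewrite cabs_sqrt sqr_sqrtr // addr_ge0 ?sqr_ge0. Qed.
Lemma abs_Re_le z : `|cRe z| <= cabs z.
Proof. by rewrite -sqrtr_sqr cabs_sqrt ler_sqrt ?addr_ge0 ?sqr_ge0 // lerDl sqr_ge0. Qed.
Lemma abs_Im_le z : `|cIm z| <= cabs z.
Proof. by rewrite -sqrtr_sqr cabs_sqrt ler_sqrt ?addr_ge0 ?sqr_ge0 // lerDr sqr_ge0. Qed.
Lemma cabs_le_ReIm z : cabs z <= `|cRe z| + `|cIm z|.
Proof.
rewrite {1}(cxE z) cxD; apply: le_trans (cabsD _ _) _.
by rewrite cabsM cabs_ci mul1r !cabs_rc.
Qed.
Lemma cabs_triangle z w : `|cabs z - cabs w| <= cabs (z - w).
Proof.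
rewrite ler_norml; have := cabsD (z - w) w; have := cabsD (w - z) z.
by rewrite !subrK (cabsB w z) => *; apply/andP; split; lra.
Qed.

Lemma nbhs_cabsP z (P : set C) :
  nbhs z P <-> exists2 r : R, 0 < r & forall w, cabs (w - z) < r -> P w.
Proof.
split=> [/nbhs_ballP [e /= e0 eP]|[r r0 rP]].
  exists (cRe e); first by move: e0; rewrite ltcE => /andP[].
  move=> w wz; apply: eP; rewrite -ball_normE /= -opprB normrN.
  (* In the order of [Cplx R] a positive number has zero imaginary part. *)
  have -> : e = rc (cRe e).
    by apply: c_ext => //; move: e0; rewrite ltcE => /andP[/eqP].
  by rewrite cabs_lt_rc.
apply/nbhs_ballP; exists (rc r); first by rewrite /= (ltcR 0).
by move=> w; rewrite -ball_normE /= -opprB normrN cabs_lt_rc => /rP.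
Qed.

Definition ccont (f : C -> C) z := forall e : R, 0 < e ->
  exists2 d : R, 0 < d & forall w, cabs (w - z) < d -> cabs (f w - f z) < e.

Lemma ccontP (f : C -> C) z : ccont f z <-> f w @[w --> z] --> f z.
Proof.
split=> [H|fz e e0].
  move=> A /nbhs_cabsP [e e0 eA]; apply/nbhs_cabsP.
  by have [d d0 dH] := H _ e0; exists d => // w /dH; exact: eA.
have /fz : nbhs (f z) [set w | cabs (w - f z) < e] by apply/nbhs_cabsP; exists e.
by move/nbhs_cabsP.
Qed.

End ComplexPlane.

(** * Complex differentiability *)

(** Stated over any [numFieldType] so that it serves both the complex derivative and the derivative
    of real functions. *)
Lemma is_derive_epsP (K : numFieldType) (f : K -> K) (z l : K) :
  is_derive z 1 f l <->
  forall e : K, 0 < e ->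
    \forall w \near z, `|f w - f z - (w - z) * l| <= e * `|w - z|.
Proof.
split=> [[df dfl] e e0|H].
  have : h^-1 *: (f (h *: 1 + z) - f z) @[h --> 0^'] --> l.
    by rewrite -dfl; exact: df.
  move=> /cvgrPdist_le /(_ e e0).
  rewrite !near_withinE /= near_simpl => /nbhs_ballP[d /= d0 dH].
  apply/nbhs_ballP; exists d => // w; rewrite /= -ball_normE /= => wz.
  have [->|wz0] := eqVneq w z; first by rewrite !subrr mul0r subrr !normr0 mulr0.
  have wz1 : w - z != 0 by rewrite subr_eq0.
  have := dH (w - z); rewrite -ball_normE /= sub0r normrN -normrN opprB.
  move=> /(_ wz wz1); rewrite /GRing.scale /= mulr1 subrK => H1.
  have -> : f w - f z - (w - z) * l = - ((w - z) * (l - (w - z)^-1 * (f w - f z))).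
    by rewrite mulrBr mulrA divff // mul1r opprB.
  by rewrite normrN normrM mulrC [`|z - w|]distrC ler_wpM2r.
have key : h^-1 *: (f (h *: 1 + z) - f z) @[h --> 0^'] --> l.
  apply/cvgrPdist_le => e e0; rewrite !near_withinE /= near_simpl.
  have /nbhs_ballP[d /= d0 dH] := H e e0.
  apply/nbhs_ballP; exists d => // h; rewrite /= -ball_normE /= sub0r normrN => hd h0.
  have := dH (h + z); rewrite -ball_normE /= opprD addrCA subrr addr0 normrN addrK.
  move=> /(_ hd) H1; rewrite /GRing.scale /= mulr1.
  rewrite -(ler_pM2r (x := `|h|)) ?normr_gt0 // -normrM.
  have -> : (l - h^-1 * (f (h + z) - f z)) * h = - (f (h + z) - f z - h * l) by field.
  by rewrite normrN.
split; first by apply/cvg_ex; exists l.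
by apply/cvg_lim.
Qed.

Section ComplexDerivative.
Context {R : realType}.
Local Notation C := (Cplx R).
Implicit Types (z w l : C) (x y r : R) (f g : C -> C).

(* Caratheodory's form of differentiability: the chain and product rules become
   algebraic identities between slope functions. *)
Definition cdiff f z l := exists s : C -> C,
  [/\ forall w, f w = f z + (w - z) * s w, s z = l & ccont s z].

Definition slope f z l w : C := if w == z then l else (f w - f z) / (w - z).

Lemma slopeE f z l w : f w = f z + (w - z) * slope f z l w.
Proof.
rewrite /slope; case: eqVneq => [->|wz]; first by rewrite subrr mul0r addr0.
by rewrite mulrC divfK ?subr_eq0 // addrC subrK.
Qed.

Lemma slope_at f z l : slope f z l z = l.
Proof. by rewrite /slope eqxx. Qed.

Lemma cdiff_slope f z l : cdiff f z l <-> ccont (slope f z l) z.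
Proof.
split=> [[s [sE sz sc]]|sc]; last first.
  by exists (slope f z l); split=> //; [exact: slopeE|exact: slope_at].
suff -> : slope f z l = s by [].
apply/funext => w; rewrite /slope; case: eqVneq => [->//|wz].
by rewrite sE addrAC subrr add0r mulrAC divff ?mul1r // subr_eq0.
Qed.

Lemma cdiff_epsP f z l : cdiff f z l <->
  forall e : R, 0 < e -> exists2 d : R, 0 < d & forall w, cabs (w - z) < d ->
    cabs (f w - f z - (w - z) * l) <= e * cabs (w - z).
Proof.
split=> [[s [sE sz sc]] e e0|H].
  have [d d0 dH] := sc _ e0.
  exists d => // w /dH sw.
  have -> : f w - f z - (w - z) * l = (w - z) * (s w - l) by rewrite (sE w); ring.
  rewrite cabsM mulrC.
  by rewrite ler_wpM2r ?cabs_ge0 // -sz ltW.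
apply/cdiff_slope => e e0.
have e20 : 0 < e / 2 by rewrite divr_gt0.
have [d d0 dH] := H _ e20; exists d => // w wd; rewrite slope_at.
have [->|wz] := eqVneq w z; first by rewrite slope_at subrr cabs0.
have := dH _ wd.
have -> : f w - f z - (w - z) * l = (w - z) * (slope f z l w - l).
  by rewrite (slopeE f z l w); ring.
rewrite cabsM mulrC.
by rewrite ler_pM2r ?cabs_gt0 ?subr_eq0 // => /le_lt_trans; apply; lra.
Qed.

Lemma cdiff_is_derive f z l : cdiff f z l <-> is_derive z 1 f l.
Proof.
rewrite cdiff_epsP is_derive_epsP; split=> H e e0.
  have eE : e = rc (cRe e).
    by apply: c_ext => //; move: e0; rewrite ltcE => /andP[/eqP].
  have e1 : 0 < cRe e by move: e0; rewrite ltcE => /andP[].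
  have [d d0 dH] := H _ e1.
  apply/nbhs_cabsP; exists d => // w /dH; rewrite eE !cabsE -rcM lecR.
  by rewrite cRe_rc.
have : \forall w \near z, `|f w - f z - (w - z) * l| <= rc e * `|w - z|.
  by apply: H; rewrite (ltcR 0).
move=> /nbhs_cabsP[d d0 dH]; exists d => // w /dH.
by rewrite !cabsE -rcM lecR.
Qed.

Lemma derivable_cdiff f z : derivable f z 1 <-> exists l, cdiff f z l.
Proof.
split=> [df|[l /cdiff_is_derive[]//]].
by exists ('D_1 f z); apply/cdiff_is_derive; split.
Qed.

Lemma ccont_cst z w : ccont (fun=> w) z.
Proof. by move=> e e0; exists 1 => // v _; rewrite subrr cabs0. Qed.
Lemma ccont_id z : ccont id z.
Proof. by move=> e e0; exists e. Qed.
Lemma ccontD f g z : ccont f z -> ccont g z -> ccont (fun w => f w + g w) z.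
Proof. by move=> /ccontP fc /ccontP gc; apply/ccontP; exact: (cvgD fc gc). Qed.
Lemma ccontN f z : ccont f z -> ccont (fun w => - f w) z.
Proof. by move=> /ccontP fc; apply/ccontP; exact: (cvgN fc). Qed.
Lemma ccontB f g z : ccont f z -> ccont g z -> ccont (fun w => f w - g w) z.
Proof. by move=> fc /ccontN; exact: ccontD. Qed.
Lemma ccontM f g z : ccont f z -> ccont g z -> ccont (fun w => f w * g w) z.
Proof. by move=> /ccontP fc /ccontP gc; apply/ccontP; exact: (cvgM fc gc). Qed.
Lemma ccontV f z : f z != 0 -> ccont f z -> ccont (fun w => (f w)^-1) z.
Proof. by move=> fz /ccontP fc; apply/ccontP; exact: (cvgV fz fc). Qed.
Lemma ccont_comp f g z : ccont f z -> ccont g (f z) -> ccont (fun w => g (f w)) z.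
Proof.
move=> fc gc e e0; have [d d0 dH] := gc e e0; have [d' d'0 d'H] := fc d d0.
by exists d' => // w /d'H /dH.
Qed.
Lemma ccontX f n z : ccont f z -> ccont (fun w => f w ^+ n) z.
Proof.
move=> fc; elim: n => [|n IH]; first exact: ccont_cst.
have -> : (fun w => f w ^+ n.+1) = (fun w => f w * f w ^+ n).
  by apply/funext => w; rewrite exprS.
exact: ccontM.
Qed.
Lemma cdiff_cont f z l : cdiff f z l -> ccont f z.
Proof.
move=> [s [sE _ sc]].
have -> : f = (fun w => f z + (w - z) * s w) by apply/funext.
exact: (ccontD (ccont_cst z (f z)) (ccontM (ccontB (ccont_id z) (ccont_cst z z)) sc)).
Qed.

Lemma cdiff_near f g z l : (\forall w \near z, f w = g w) -> cdiff f z l -> cdiff g z l.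
Proof.
move=> fg /cdiff_epsP H; apply/cdiff_epsP => e e0.
have [d d0 dH] := H e e0; have /nbhs_cabsP[d' d'0 d'H] := fg.
exists (Num.min d d'); first by rewrite lt_min d0.
move=> w; rewrite lt_min => /andP[wd wd'].
by rewrite -!d'H //; [exact: dH|rewrite subrr cabs0].
Qed.

Lemma cdiff_eq f g z l m : f =1 g -> l = m -> cdiff f z l -> cdiff g z m.
Proof. by move=> /funext -> ->. Qed.

Lemma cdiff_uniq f z l l' : cdiff f z l -> cdiff f z l' -> l = l'.
Proof. by move=> /cdiff_is_derive [_ <-] /cdiff_is_derive [_ <-]. Qed.

Lemma cdiff_cst z w : cdiff (fun=> w) z 0.
Proof. by exists (fun=> 0); split=> [v||]; rewrite ?mulr0 ?addr0 //; exact: ccont_cst. Qed.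

Lemma cdiff_id z : cdiff id z 1.
Proof.
by exists (fun=> 1); split=> [v||]; rewrite ?mulr1 ?(addrC z) ?subrK //; exact: ccont_cst.
Qed.

Lemma cdiffD f g z l m : cdiff f z l -> cdiff g z m -> cdiff (fun w => f w + g w) z (l + m).
Proof.
move=> [s [sE <- sc]] [t [tE <- tc]]; exists (fun w => s w + t w); split => //.
  by move=> w; rewrite [f w]sE [g w]tE; ring.
exact: ccontD.
Qed.

Lemma cdiffM f g z l m : cdiff f z l -> cdiff g z m ->
  cdiff (fun w => f w * g w) z (l * g z + f z * m).
Proof.
move=> df dg; have gc := cdiff_cont dg.
move: df dg => [s [sE <- sc]] [t [tE <- tc]].
exists (fun w => s w * g w + f z * t w); split => //.
  by move=> w; rewrite [f w]sE [g w]tE; ring.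
exact: (ccontD (ccontM sc gc) (ccontM (ccont_cst z (f z)) tc)).
Qed.

Lemma cdiffZ f z l a : cdiff f z l -> cdiff (fun w => a * f w) z (a * l).
Proof.
by move=> df; have := cdiffM (cdiff_cst z a) df; rewrite mul0r add0r.
Qed.

Lemma cdiffN f z l : cdiff f z l -> cdiff (fun w => - f w) z (- l).
Proof.
by move=> /(cdiffZ (- 1)); apply: cdiff_eq => [w|]; rewrite mulN1r.
Qed.

Lemma cdiffB f g z l m : cdiff f z l -> cdiff g z m -> cdiff (fun w => f w - g w) z (l - m).
Proof. by move=> df /cdiffN; exact: cdiffD. Qed.

Lemma cdiff_comp f g z l m : cdiff f z l -> cdiff g (f z) m ->
  cdiff (fun w => g (f w)) z (m * l).
Proof.
move=> df; have fc := cdiff_cont df.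
move: df => [s [sE <- sc]] [t [tE <- tc]].
exists (fun w => t (f w) * s w); split => //.
  by move=> w; rewrite [g (f w)]tE {1}[f w]sE; ring.
exact: (ccontM (ccont_comp fc tc) sc).
Qed.

Lemma cdiffX n z : cdiff (fun w => w ^+ n) z (n%:R * z ^+ n.-1).
Proof.
elim: n => [|n IH].
  by apply: cdiff_eq (cdiff_cst z 1) => [w|]; rewrite ?expr0 ?mul0r.
apply: cdiff_eq (cdiffM (cdiff_id z) IH) => [w|]; first by rewrite exprS.
rewrite mul1r /=; case: n {IH} => [|n]; first by rewrite mul0r mulr0 addr0 mul1r.
by rewrite /= mulrCA -exprS -[in RHS]natr1 mulrDl mul1r addrC.
Qed.

Lemma cdiffV f z l : f z != 0 -> cdiff f z l -> cdiff (fun w => (f w)^-1) z (- l / f z ^+ 2).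
Proof.
move=> fz df; have fc := cdiff_cont df.
move: df => [s [sE <- sc]].
have fz0 : 0 < cabs (f z) by rewrite cabs_gt0.
have [d d0 dH] := fc _ fz0.
have nz w : cabs (w - z) < d -> f w != 0.
  move=> /dH; apply: contraTneq => ->; by rewrite sub0r cabsN ltxx.
(* The slope identity has to hold at every [w], including zeros of [f] away from [z]; there the
   inverse is redefined by the value that the identity dictates, which changes nothing near [z]. *)
have H : cdiff (fun w => if f w == 0 then (f z)^-1 + (w - z) * (- s w / (f z * f w))  else (f w)^-1) z
    (- s z / f z ^+ 2).
  exists (fun w => - s w / (f z * f w)); split => //.
  - move=> w; rewrite (negbTE fz); case: eqVneq => // fw.
    have: (w - z) * s w = f w - f z by rewrite (sE w) addrAC subrr add0r.
    move=> e; transitivity ((f z)^-1 - ((w - z) * s w) / (f z * f w)).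
      by rewrite e; field; rewrite fz fw.
    by rewrite mulrA mulrN mulNr.
  - apply: ccontM (ccontN sc) _; apply: ccontV; first exact: mulf_neq0.
    exact: (ccontM (ccont_cst z (f z)) fc).
apply: cdiff_near H; by apply/nbhs_cabsP; exists d => // w /nz /negbTE ->.
Qed.

Lemma cdiff_div f g z l m : g z != 0 -> cdiff f z l -> cdiff g z m ->
  cdiff (fun w => f w / g w) z ((l * g z - f z * m) / g z ^+ 2).
Proof.
move=> gz df dg; by apply: cdiff_eq (cdiffM df (cdiffV gz dg)) => //; field.
Qed.

End ComplexDerivative.

(** * Compactness in the plane *)

Section Compactness.
Context {R : realType}.
Local Notation C := (Cplx R).
Implicit Types (z w l : C) (x y r e d M : R).

Lemma compact_rectangle (a b c d : R) :
  compact [set z : C | a <= cRe z <= b /\ c <= cIm z <= d].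
Proof.
have -> : [set z : C | a <= cRe z <= b /\ c <= cIm z <= d] =
    (fun p : R * R => cx p.1 p.2) @` (`[a, b] `*` `[c, d]).
  apply/seteqP; split=> [z [zab zcd]|z [[x y] [/= xab ycd] <-]].
    by exists (cRe z, cIm z) => /=; rewrite ?in_itv ?zab -?cxE.
  by move: xab ycd; rewrite !in_itv.
apply: continuous_compact; last by apply: compact_setX; exact: segment_compact.
apply: continuous_subspaceT => -[x y] A /nbhs_cabsP[e e0 eA].
have e2 : 0 < e / 2 by rewrite divr_gt0.
exists (ball x (e / 2), ball y (e / 2)); first by split; exact: nbhsx_ballx.
case=> u v /= []; rewrite -!ball_normE /= => xu yv; apply: eA.
apply: le_lt_trans (cabs_le_ReIm _) _; rewrite !cReImE.
by rewrite distrC [`|v - y|]distrC; lra.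
Qed.

Lemma compact_bounded (K : set C) M : (forall z, K z -> cabs z <= M) ->
  (forall z, (forall e, 0 < e -> exists2 w, K w & cabs (w - z) < e) -> K z) ->
  compact K.
Proof.
move=> KM Kc; apply: (@subclosed_compact _ _ [set z : C | - M <= cRe z <= M /\ - M <= cIm z <= M]).
- move=> z zK; apply: Kc => e e0.
  have [|w [Kw wz]] := zK [set w | cabs (w - z) < e]; last by exists w.
  by apply/nbhs_cabsP; exists e.
- exact: compact_rectangle.
- move=> z /KM zM; rewrite /= -!ler_norml; split; apply: le_trans zM.
    exact: abs_Re_le.
  exact: abs_Im_le.
Qed.

Lemma compact_disc z r : compact [set w | cabs (w - z) <= r].
Proof.
apply: (@compact_bounded _ (r + cabs z)) => [w /= wr|w H /=].
  by have := cabsD (w - z) z; rewrite subrK; lra.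
rewrite leNgt; apply/negP => rw.
have [|v /= vr vw] := H (cabs (w - z) - r); first by rewrite subr_gt0.
by have := cabsD (w - v) (v - z); rewrite addrA subrK (cabsB w v); lra.
Qed.

Lemma cabs_attains_max (F : C -> C) (K : set C) : K !=set0 -> compact K ->
  (forall z, K z -> ccont F z) ->
  exists2 z0, K z0 & forall z, K z -> cabs (F z) <= cabs (F z0).
Proof.
move=> K0 Kc FK.
have [|z0 Kz0 H] := @compact_EVT_max C R (fun z => cabs (F z)) K K0 Kc.
  apply: continuous_in_subspaceT => z /set_mem/FK Fz.
  move=> A /nbhs_ballP[e /= e0 eA]; have [d d0 dH] := Fz e e0.
  apply/nbhs_cabsP; exists d => // w /dH wd; apply: eA.
  rewrite -ball_normE /= distrC; exact: le_lt_trans (cabs_triangle _ _) wd.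
exists z0; first exact: set_mem.
by move=> z /mem_set/H.
Qed.

Lemma bounded_cluster (u : nat -> C) M : (forall n, cabs (u n) <= M) ->
  exists z, forall e N, 0 < e -> exists2 n, (N <= n)%N & cabs (u n - z) < e.
Proof.
move=> uM; pose K : set C := [set w | cabs (w - 0) <= M].
have uF : ProperFilter (u @ \oo) by exact: fmap_proper_filter.
have [|z [_ zc]] := @compact_disc 0 M (u @ \oo) uF.
  by exists 0 => // n _ /=; rewrite subr0.
exists z => e N e0.
have [||w [[n Nn <-] we]] := zc [set u n | n in [set n | (N <= n)%N]] [set w | cabs (w - z) < e].
- by exists N => // n Nn; exists n.
- by apply/nbhs_cabsP; exists e.
- by exists n.
Qed.

End Compactness.

(** * Mean value inequalities along paths with a real parameter *)

Section RealPaths.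
Context {R : realType}.
Local Notation C := (Cplx R).
Implicit Types (z w k : C) (a b t u : R) (g : R -> C).

Definition rdiff g t (l : C) := forall e : R, 0 < e ->
  exists2 d : R, 0 < d & forall u, `|u - t| < d ->
    cabs (g u - g t - rc (u - t) * l) <= e * `|u - t|.

Lemma real_is_derive_epsP (h : R -> R) t l : is_derive t 1 h l <->
  forall e : R, 0 < e -> exists2 d : R, 0 < d & forall u, `|u - t| < d ->
    `|h u - h t - (u - t) * l| <= e * `|u - t|.
Proof.
rewrite is_derive_epsP; split=> H e e0.
  have /nbhs_ballP[d /= d0 dH] := H e e0; exists d => // u ut; apply: dH.
  by rewrite -ball_normE /= distrC.
have [d d0 dH] := H e e0; apply/nbhs_ballP; exists d => // u.
by rewrite -ball_normE /= distrC => /dH.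
Qed.

(** The [+ 1] keeps the divisor positive when [k] is 0. *)
Lemma cabs_scale_le k (e x : R) : 0 < e -> 0 <= x ->
  cabs k * (e / (cabs k + 1) * x) <= e * x.
Proof.
move=> e0 x0; have k1 : 0 < cabs k + 1 by rewrite ltr_wpDl ?cabs_ge0.
rewrite mulrA ler_wpM2r // mulrA ler_pdivrMr // mulrC.
by rewrite ler_wpM2l ?lerDl // ltW.
Qed.

Lemma rdiff_Re k g t l : rdiff g t l -> is_derive t 1 (fun u => cRe (k * g u)) (cRe (k * l)).
Proof.
move=> H; apply/real_is_derive_epsP => e e0.
have k1 : 0 < cabs k + 1 by rewrite ltr_wpDl ?cabs_ge0.
have [d d0 dH] := H (e / (cabs k + 1)) (divr_gt0 e0 k1).
exists d => // u /dH ut.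
have -> : cRe (k * g u) - cRe (k * g t) - (u - t) * cRe (k * l) =
    cRe (k * (g u - g t - rc (u - t) * l)) by rewrite !cReImE; ring.
apply: le_trans (abs_Re_le _) _; rewrite cabsM.
apply: le_trans (ler_wpM2l (cabs_ge0 k) ut) _.
exact: cabs_scale_le.
Qed.

Lemma rdiff_path (P : C -> C) (a0 b0 : C) t l : cdiff P (a0 + rc t * b0) l ->
  rdiff (fun t => P (a0 + rc t * b0)) t (l * b0).
Proof.
move=> /cdiff_epsP H e e0.
have k1 : 0 < cabs b0 + 1 by rewrite ltr_wpDl ?cabs_ge0.
have [d d0 dH] := H (e / (cabs b0 + 1)) (divr_gt0 e0 k1).
exists (d / (cabs b0 + 1)); first exact: divr_gt0.
move=> u ut.
have E : a0 + rc u * b0 - (a0 + rc t * b0) = rc (u - t) * b0 by rewrite rcB; ring.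
have := dH (a0 + rc u * b0); rewrite E cabsM cabs_rc.
have -> : rc (u - t) * b0 * l = rc (u - t) * (l * b0) by ring.
move=> H1; apply: le_trans (H1 _) _.
  rewrite ltr_pdivlMr // in ut; apply: le_lt_trans ut.
  by rewrite ler_wpM2l // lerDl.
rewrite [X in X <= _](_ : _ = cabs b0 * (e / (cabs b0 + 1) * `|u - t|)); last by ring.
exact: cabs_scale_le.
Qed.

Lemma rdiff_cx (u v : R -> R) t a b : is_derive t 1 u a -> is_derive t 1 v b ->
  rdiff (fun s => cx (u s) (v s)) t (cx a b).
Proof.
move=> /real_is_derive_epsP Hu /real_is_derive_epsP Hv e e0.
have e2 : 0 < e / 2 by rewrite divr_gt0.
have [d d0 dH] := Hu _ e2; have [d' d'0 d'H] := Hv _ e2.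
exists (Num.min d d'); first by rewrite lt_min d0.
move=> s; rewrite lt_min => /andP[/dH h1 /d'H h2].
apply: le_trans (cabs_le_ReIm _) _; rewrite !cReImE.
rewrite !mul0r subr0 addr0; lra.
Qed.

Lemma rdiffD g h t l m : rdiff g t l -> rdiff h t m -> rdiff (fun u => g u + h u) t (l + m).
Proof.
move=> Hu Hv e e0.
have e2 : 0 < e / 2 by rewrite divr_gt0.
have [d d0 dH] := Hu _ e2; have [d' d'0 d'H] := Hv _ e2.
exists (Num.min d d'); first by rewrite lt_min d0.
move=> s; rewrite lt_min => /andP[/dH h1 /d'H h2].
have -> : g s + h s - (g t + h t) - rc (s - t) * (l + m) =
  (g s - g t - rc (s - t) * l) + (h s - h t - rc (s - t) * m) by ring.
by apply: le_trans (cabsD _ _) _; lra.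
Qed.

Lemma rdiffZ k g t l : rdiff g t l -> rdiff (fun u => k * g u) t (k * l).
Proof.
move=> H e e0.
have k1 : 0 < cabs k + 1 by rewrite ltr_wpDl ?cabs_ge0.
have [d d0 dH] := H (e / (cabs k + 1)) (divr_gt0 e0 k1).
exists d => // u /dH ut.
have -> : k * g u - k * g t - rc (u - t) * (k * l) = k * (g u - g t - rc (u - t) * l).
  by ring.
rewrite cabsM; apply: le_trans (ler_wpM2l (cabs_ge0 k) ut) _.
exact: cabs_scale_le.
Qed.

Lemma rdiff_eq g h t l m : g =1 h -> l = m -> rdiff g t l -> rdiff h t m.
Proof. by move=> /funext -> ->. Qed.

Lemma rdiffB g h t l m : rdiff g t l -> rdiff h t m -> rdiff (fun u => g u - h u) t (l - m).
Proof.
move=> H /(rdiffZ (-1)) H'.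
by apply: rdiff_eq (rdiffD H H') => [u|]; rewrite mulN1r.
Qed.

(** A path in the plane has no exact mean value theorem, but each of its real linear functionals
    [cRe (k * _)] does. *)
Lemma mean_value_Re g (l : R -> C) a b k m : a <= b ->
  (forall t, a <= t <= b -> rdiff g t (l t)) ->
  (forall t, a < t < b -> cRe (k * l t) <= m) ->
  cRe (k * (g b - g a)) <= m * (b - a).
Proof.
rewrite le_eqVlt => /predU1P[->|ab] H lm; first by rewrite !subrr mulr0 mulr0.
have [t||c cab E] := @MVT R (fun u => cRe (k * g u)) (fun u => cRe (k * l u)) a b ab.
- by rewrite in_itv /= => /andP[at1 tb]; apply: rdiff_Re; apply: H; rewrite !ltW.
- apply: derivable_within_continuous => t; rewrite in_itv /= => tab.
  by have [] := rdiff_Re k (H t tab).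
- rewrite mulrBr cReD cReN E ler_pM2r ?subr_gt0 //; apply: lm.
  by move: cab; rewrite in_itv.
Qed.

Lemma mean_value_le g (l : R -> C) a b M : a <= b ->
  (forall t, a <= t <= b -> rdiff g t (l t)) ->
  (forall t, a < t < b -> cabs (l t) <= M) ->
  cabs (g b - g a) <= M * (b - a).
Proof.
move=> ab H lM; set D := g b - g a.
have [->|D0] := eqVneq (cabs D) 0.
  move: ab; rewrite le_eqVlt => /predU1P[->|ab]; first by rewrite subrr mulr0.
  apply: mulr_ge0; last by rewrite subr_ge0 ltW.
  by apply: le_trans (cabs_ge0 _) (lM ((a + b) / 2) _); lra.
have D1 : 0 < cabs D by rewrite lt_neqAle eq_sym D0 cabs_ge0.
(* The conjugate of the increment [D]: the functional that it defines takes the value |D|^2 at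
   [D]. *)
pose k : C := cx (cRe D) (- cIm D).
have kD : cRe (k * D) = cabs D ^+ 2 by rewrite cabs_sqr !cReImE; ring.
have ck : cabs k = cabs D by rewrite !cabs_sqrt !cReImE sqrrN.
have := @mean_value_Re g l a b k (cabs D * M) ab H.
rewrite -/D kD expr2 -mulrA ler_pM2l //; apply=> t tab.
apply: le_trans (ler_norm _) _; apply: le_trans (abs_Re_le _) _.
by rewrite cabsM ck ler_wpM2l ?cabs_ge0 // lM.
Qed.

Lemma mean_value_segment (F : C -> C) (F' : C -> C) z w M :
  (forall t : R, 0 <= t <= 1 -> cdiff F (z + rc t * (w - z)) (F' (z + rc t * (w - z)))) ->
  (forall t : R, 0 <= t <= 1 -> cabs (F' (z + rc t * (w - z))) <= M) ->
  cabs (F w - F z) <= M * cabs (w - z).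
Proof.
move=> dF F'M.
have := @mean_value_le (fun t => F (z + rc t * (w - z)))
  (fun t => F' (z + rc t * (w - z)) * (w - z)) 0 1 (M * cabs (w - z)) ler01.
rewrite rc0 rc1 mul0r addr0 mul1r (addrC z) subrK subr0 mulr1; apply.
  by move=> t t01; apply: rdiff_path; exact: dF.
move=> t /andP[t0 t1]; rewrite cabsM ler_wpM2r ?cabs_ge0 // F'M //.
by rewrite !ltW.
Qed.

End RealPaths.

(** * Primitives of continuous paths, and nested intervals *)

Section RealPrimitives.
Context {R : realType}.
Local Notation C := (Cplx R).

(** The integral starts at [a], so it is a primitive only to the right of [a]; users place [a] to
    the left of the range that they need. *)
Lemma exists_real_primitive (h : R -> R) (a : R) : continuous h ->
  exists H : R -> R, forall x, a < x -> is_derive x 1 H (h x).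
Proof.
move=> hc; exists (fun x => Rintegral lebesgue_measure `[a, x] h) => x ax.
have [|dH H'] := @continuous_FTC1_closed R h a x (x + 1) (ltr_pwDr ltr01 (lexx _)) _ ax (hc x).
  apply: continuous_compact_integrable; first exact: segment_compact.
  exact: continuous_subspaceT.
by split; [exact: dH|rewrite -derive1E; exact: H'].
Qed.

Definition rcont (g : R -> C) t := forall e : R, 0 < e ->
  exists2 d : R, 0 < d & forall u, `|u - t| < d -> cabs (g u - g t) < e.

Lemma exists_primitive (g : R -> C) (a : R) : (forall t, rcont g t) ->
  exists G : R -> C, forall x, a < x -> rdiff G x (g x).
Proof.
move=> gc.
have [|U HU] := @exists_real_primitive (fun t => cRe (g t)) a.
  move=> t A /nbhs_ballP[e /= e0 eA]; have [d d0 dH] := gc t e e0.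
  apply/nbhs_ballP; exists d => // u; rewrite -ball_normE /= distrC => /dH ut.
  apply: eA; rewrite -ball_normE /= distrC -cReN -cReD.
  exact: le_lt_trans (abs_Re_le _) ut.
have [|V HV] := @exists_real_primitive (fun t => cIm (g t)) a.
  move=> t A /nbhs_ballP[e /= e0 eA]; have [d d0 dH] := gc t e e0.
  apply/nbhs_ballP; exists d => // u; rewrite -ball_normE /= distrC => /dH ut.
  apply: eA; rewrite -ball_normE /= distrC -cImN -cImD.
  exact: le_lt_trans (abs_Im_le _) ut.
exists (fun x => cx (U x) (V x)) => x ax.
by rewrite (cxE (g x)); apply: rdiff_cx; [exact: HU|exact: HV].
Qed.

Lemma mean_value_dist (g l : R -> C) (a b : R) M :
  (forall t, Num.min a b <= t <= Num.max a b -> rdiff g t (l t)) ->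
  (forall t, Num.min a b <= t <= Num.max a b -> cabs (l t) <= M) ->
  cabs (g b - g a) <= M * `|b - a|.
Proof.
move=> H lM; have [ab|/ltW ba] := leP a b.
  rewrite ger0_norm ?subr_ge0 //; apply: (@mean_value_le _ g l) => // t tab.
    by apply: H; rewrite min_l // max_r.
  by apply: lM; rewrite min_l // max_r //; move: tab => /andP[/ltW -> /ltW ->].
rewrite cabsB distrC ger0_norm ?subr_ge0 //; apply: (@mean_value_le _ g l) => // t tab.
  by apply: H; rewrite min_r // max_l.
by apply: lM; rewrite min_r // max_l //; move: tab => /andP[/ltW -> /ltW ->].
Qed.

(** The intervals [u n, u n + w / 2^n] are nested, because the left end moves by at most the
    half-width lost. *)
Lemma nested_reals (u : nat -> R) w : 0 <= w ->
  (forall n, u n <= u n.+1 <= u n + w / 2 ^+ n.+1) ->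
  exists x, forall n, u n <= x <= u n + w / 2 ^+ n.
Proof.
move=> w0 H.
have vS n : u n.+1 + w / 2 ^+ n.+1 <= u n + w / 2 ^+ n.
  have /andP[_ h] := H n; apply: le_trans (lerD h (lexx _)) _.
  rewrite -addrA lerD2l exprS invfM -mulrDr ler_wpM2l //.
  by set q := 2 ^- n; lra.
have uS n k : u n <= u (n + k)%N.
  elim: k => [|k IH]; first by rewrite addn0.
  by rewrite addnS; apply: le_trans IH _; have /andP[] := H (n + k)%N.
have vD n k : u (n + k)%N + w / 2 ^+ (n + k) <= u n + w / 2 ^+ n.
  elim: k => [|k IH]; first by rewrite addn0.
  by rewrite addnS; apply: le_trans (vS _) IH.
have q0 n : 0 <= w / 2 ^+ n by rewrite divr_ge0 // exprn_ge0.
have uv m n : u m <= u n + w / 2 ^+ n.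
  have := uS m n; have := vD n m; rewrite addnC; have := q0 (m + n)%N; lra.
have su : has_sup (range u).
  split; first by exists (u 0%N), 0%N.
  by exists (u 0%N + w / 2 ^+ 0) => _ [m _ <-].
exists (sup (range u)) => n; apply/andP; split.
  by apply: sup_upper_bound => //; exists n.
by apply: ge_sup; [case: su|move=> _ [m _ <-]].
Qed.

End RealPrimitives.

(** * Goursat's theorem: a primitive on a square *)

Section Goursat.
Context {R : realType}.
Local Notation C := (Cplx R).
Implicit Types (z w p l : C).

Definition square (c : C) (r : R) : set C :=
  [set z | `|cRe (z - c)| <= r /\ `|cIm (z - c)| <= r].

Context (f : C -> C) (c : C) (r : R) (r0 : 0 < r).
Context (df : forall z, square c r z -> exists l, cdiff f z l).

Let proj (x : R) : R := if x < - r then - r else if r < x then r else x.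
Let clamp z : C := cx (cRe c + proj (cRe z - cRe c)) (cIm c + proj (cIm z - cIm c)).
(* [F] extends the restriction of [f] to the square continuously to the plane,
   so that primitives along lines exist without boundary conditions. *)
Let F z : C := f (clamp z).

Let proj_in x : `|proj x| <= r.
Proof. by have rr := r0; rewrite ler_norml /proj; case: ltP => h1; last case: ltP => h2; lra. Qed.

Let proj_id x : `|x| <= r -> proj x = x.
Proof.
by rewrite ler_norml /proj => /andP[h1 h2]; rewrite !ltNge h1 h2.
Qed.

Let proj_lip x y : `|proj x - proj y| <= `|x - y|.
Proof.
wlog xy : x y / x <= y.
  move=> W; have [/W//|/ltW/W] := leP x y.
  by rewrite distrC [`|x - y|]distrC.
have -> : `|x - y| = y - x by rewrite distrC ger0_norm ?subr_ge0.
have := r0; rewrite ler_norml /proj => ?.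
by case: (ltP x) => ?; case: (ltP y) => ?; case: (ltP r x) => ?; case: (ltP r y) => ?; lra.
Qed.

Let clamp_in z : square c r (clamp z).
Proof. by split; rewrite !cReImE addrAC subrr add0r; exact: proj_in. Qed.

Let clamp_id z : square c r z -> clamp z = z.
Proof.
rewrite /square /= !cReImE => -[h1 h2]; rewrite /clamp !proj_id //.
by apply: c_ext; rewrite !cReImE; ring.
Qed.

Let FE z : square c r z -> F z = f z.
Proof. by move=> /clamp_id; rewrite /F => ->. Qed.

Let clamp_cont z : ccont clamp z.
Proof.
move=> e e0; exists (e / 2) => [|w wz]; first by rewrite divr_gt0.
apply: le_lt_trans (cabs_le_ReIm _) _; rewrite !cReImE.
have -> : cRe c + proj (cRe w - cRe c) - (cRe c + proj (cRe z - cRe c)) =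
  proj (cRe w - cRe c) - proj (cRe z - cRe c) by ring.
have -> : cIm c + proj (cIm w - cIm c) - (cIm c + proj (cIm z - cIm c)) =
  proj (cIm w - cIm c) - proj (cIm z - cIm c) by ring.
have := proj_lip (cRe w - cRe c) (cRe z - cRe c).
have := proj_lip (cIm w - cIm c) (cIm z - cIm c).
have := abs_Re_le (w - z); have := abs_Im_le (w - z); rewrite !cReImE.
rewrite !opprB !addrA !subrK; lra.
Qed.

Let F_cont z : ccont F z.
Proof.
have [l dl] := df (clamp_in z).
exact: (ccont_comp (@clamp_cont z) (cdiff_cont dl)).
Qed.

Let F_rcontx y t : rcont (fun x => F (cx x y)) t.
Proof.
move=> e e0; have [d d0 dH] := @F_cont (cx t y) e e0; exists d => // u ut.
apply: dH; have -> : cx u y - cx t y = rc (u - t) by apply: c_ext; rewrite !cReImE; ring.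
by rewrite cabs_rc.
Qed.

Let F_rconty x t : rcont (fun y => F (cx x y)) t.
Proof.
move=> e e0; have [d d0 dH] := @F_cont (cx x t) e e0; exists d => // u ut.
apply: dH; have -> : cx x u - cx x t = ci * rc (u - t).
  by apply: c_ext; rewrite !cReImE; ring.
by rewrite cabsM cabs_ci mul1r cabs_rc.
Qed.

Let hx_ex : {hx : R -> R -> C | forall y x, cRe c - r - 1 < x -> rdiff (hx y) x (F (cx x y))}.
Proof.
apply: cid.
have [hx H] := choice (fun y => exists_primitive (cRe c - r - 1) (F_rcontx y)).
by exists hx.
Qed.
Let hx := sval hx_ex.
Let hxP := svalP hx_ex.

Let vy_ex : {vy : R -> R -> C | forall x y, cIm c - r - 1 < y -> rdiff (vy x) y (F (cx x y))}.
Proof.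
apply: cid.
have [vy H] := choice (fun x => exists_primitive (cIm c - r - 1) (F_rconty x)).
by exists vy.
Qed.
Let vy := sval vy_ex.
Let vyP := svalP vy_ex.

(** The integral of f dz counterclockwise around a rectangle, each side being the increment of a
    primitive; on vertical sides dz = i dy gives the factor [ci]. *)
Let bdint x1 x2 y1 y2 : C :=
  (hx y1 x2 - hx y1 x1) + ci * (vy x2 y2 - vy x2 y1)
  - (hx y2 x2 - hx y2 x1) - ci * (vy x1 y2 - vy x1 y1).

Let inx x := `|x - cRe c| <= r.
Let iny y := `|y - cIm c| <= r.

(** Bounds an integral of f - k along a horizontal segment, without integrals: the mean value
    inequality for the difference of two primitives. *)
Let mean_hx y a b k M (A : R -> C) : iny y -> inx a -> inx b ->
  (forall t, inx t -> rdiff A t (k t)) ->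
  (forall t, Num.min a b <= t <= Num.max a b -> cabs (f (cx t y) - k t) <= M) ->
  cabs (hx y b - hx y a - (A b - A a)) <= M * `|b - a|.
Proof.
rewrite /inx => yi; rewrite !ler_norml => /andP[a1 a2] /andP[b1 b2] dA kM.
have -> : hx y b - hx y a - (A b - A a) = (hx y b - A b) - (hx y a - A a) by ring.
have inab t : Num.min a b <= t <= Num.max a b -> - r <= t - cRe c <= r.
  rewrite /Num.min /Num.max; case: ltP => ? /andP[]; lra.
apply: (@mean_value_dist _ (fun t => hx y t - A t) (fun t => F (cx t y) - k t)) => t tab.
  have tin := inab t tab.
  apply: rdiffB; last by apply: dA; rewrite ler_norml.
  by apply: hxP; have := r0; move: tin => /andP[]; lra.
rewrite FE; first exact: kM.
by split; rewrite !cReImE // ler_norml inab.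
Qed.

Let mean_vy x a b k M (A : R -> C) : inx x -> iny a -> iny b ->
  (forall t, iny t -> rdiff A t (k t)) ->
  (forall t, Num.min a b <= t <= Num.max a b -> cabs (f (cx x t) - k t) <= M) ->
  cabs (vy x b - vy x a - (A b - A a)) <= M * `|b - a|.
Proof.
rewrite /iny => xi; rewrite !ler_norml => /andP[a1 a2] /andP[b1 b2] dA kM.
have -> : vy x b - vy x a - (A b - A a) = (vy x b - A b) - (vy x a - A a) by ring.
have inab t : Num.min a b <= t <= Num.max a b -> - r <= t - cIm c <= r.
  rewrite /Num.min /Num.max; case: ltP => ? /andP[]; lra.
apply: (@mean_value_dist _ (fun t => vy x t - A t) (fun t => F (cx x t) - k t)) => t tab.
  have tin := inab t tab.
  apply: rdiffB; last by apply: dA; rewrite ler_norml.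
  by apply: vyP; have := r0; move: tin => /andP[]; lra.
rewrite FE; first exact: kM.
by split; rewrite !cReImE // ler_norml inab.
Qed.

(** The affine part of [f] at [p] has a primitive in the plane and so contributes nothing around the
    rectangle; the remainder is at most e (w + h) on a boundary of length 2 (w + h). *)
Let local_bound p : square c r p -> forall e : R, 0 < e -> exists2 d : R, 0 < d &
  forall x y w h : R, 0 <= w -> 0 <= h -> inx x -> inx (x + w) -> iny y -> iny (y + h) ->
  x <= cRe p <= x + w -> y <= cIm p <= y + h -> w + h < d ->
  cabs (bdint x (x + w) y (y + h)) <= 2 * e * (w + h) ^+ 2.
Proof.
move=> /df[l /cdiff_epsP H] e e0; have [d d0 dH] := H e e0; exists d => // x y w h w0 h0.
move=> x1 x2 y1 y2 /andP[px1 px2] /andP[py1 py2] whd.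
(* A primitive of the affine approximation f p + l (z - p). *)
pose A z : C := f p * z + l * (z - p) ^+ 2 / 2.
have dA z : cdiff A z (f p + l * (z - p)).
  have dzp := cdiffB (cdiff_id z) (cdiff_cst z p).
  apply: cdiff_eq (cdiffD (cdiffZ (f p) (cdiff_id z)) (cdiffZ (l / 2) (cdiffM dzp dzp))).
    by move=> v; rewrite /A expr2; field.
  by rewrite /=; field.
pose ax y t := A (cx t y); pose ay x t := A (cx x t).
have dax v t : rdiff (ax v) t (f p + l * (cx t v - p)).
  have E u : ci * rc v + rc u * 1 = cx u v by apply: c_ext; rewrite !cReImE; ring.
  apply: rdiff_eq (@rdiff_path _ A (ci * rc v) 1 t _ (dA _)) => [u|]; first by rewrite E.
  by rewrite mulr1 E.
have day v t : rdiff (ay v) t (ci * (f p + l * (cx v t - p))).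
  have E u : rc v + rc u * ci = cx v u by apply: c_ext; rewrite !cReImE; ring.
  apply: rdiff_eq (@rdiff_path _ A (rc v) ci t _ (dA _)) => [u|]; first by rewrite E.
  by rewrite mulrC E.
have near z : x <= cRe z <= x + w -> y <= cIm z <= y + h ->
    cabs (f z - (f p + l * (z - p))) <= e * (w + h).
  move=> /andP[zx1 zx2] /andP[zy1 zy2].
  have zp : cabs (z - p) <= w + h.
    apply: le_trans (cabs_le_ReIm _) _; rewrite !cReImE.
    by apply: lerD; rewrite ler_norml; apply/andP; split; lra.
  have := dH z (le_lt_trans zp whd).
  have -> : f z - f p - (z - p) * l = f z - (f p + l * (z - p)) by ring.
  by move=> h1; apply: le_trans h1 _; rewrite ler_wpM2l // ltW.
have ay2 v t : rdiff (fun u => - ci * ay v u) t (f p + l * (cx v t - p)).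
  apply: rdiff_eq (rdiffZ (- ci) (day v t)) => // .
  by apply: c_ext; rewrite !cReImE; ring.
have wx : Num.min x (x + w) = x by rewrite min_l // lerDl.
have wX : Num.max x (x + w) = x + w by rewrite max_r // lerDl.
have hy : Num.min y (y + h) = y by rewrite min_l // lerDl.
have hY : Num.max y (y + h) = y + h by rewrite max_r // lerDl.
have Hx v : v = y \/ v = y + h ->
    cabs (hx v (x + w) - hx v x - (ax v (x + w) - ax v x)) <= e * (w + h) * w.
  move=> vE; have -> : e * (w + h) * w = e * (w + h) * `|x + w - x|.
    by rewrite addrAC subrr add0r ger0_norm.
  apply: (mean_hx (k := fun t => f p + l * (cx t v - p))) => // [|t].
    by case: vE => ->.
  rewrite wx wX => tx; apply: near; first by [].
  by case: vE => ->; rewrite cIm_cx; lra.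
have Hy v : v = x \/ v = x + w ->
    cabs (vy v (y + h) - vy v y - (- ci * ay v (y + h) - - ci * ay v y)) <= e * (w + h) * h.
  move=> vE; have -> : e * (w + h) * h = e * (w + h) * `|y + h - y|.
    by rewrite addrAC subrr add0r ger0_norm.
  apply: (mean_vy (A := fun u => - ci * ay v u) (k := fun t => f p + l * (cx v t - p))) => // [|t].
    by case: vE => ->.
  rewrite hy hY => ty; apply: near; last by [].
  by case: vE => ->; rewrite cRe_cx; lra.
have -> : bdint x (x + w) y (y + h) =
  (hx y (x + w) - hx y x - (ax y (x + w) - ax y x))
  + ci * (vy (x + w) (y + h) - vy (x + w) y
         - (- ci * ay (x + w) (y + h) - - ci * ay (x + w) y))
  - (hx (y + h) (x + w) - hx (y + h) x - (ax (y + h) (x + w) - ax (y + h) x))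
  - ci * (vy x (y + h) - vy x y - (- ci * ay x (y + h) - - ci * ay x y)).
  rewrite /bdint /ax /ay.
  have i3 (u : C) : ci * (- ci * u) = u by apply: c_ext; rewrite !cReImE; ring.
  by rewrite !mulrBr !i3; ring.
have c1 u : cabs (ci * u) = cabs u by rewrite cabsM cabs_ci mul1r.
apply: le_trans (cabsD _ _) _; rewrite cabsN c1.
have := Hx _ (or_introl erefl); have := Hx _ (or_intror erefl).
have := Hy _ (or_introl erefl); have := Hy _ (or_intror erefl).
set a1 := hx y _ - _ - _; set a2 := vy (x + w) _ - _ - _.
set a3 := hx _ _ - _ - _; set a4 := vy _ _ - _ - _.
move=> h2 h4 h3 h1.
have := cabsD (a1 + ci * a2) (- a3); have := cabsD a1 (ci * a2); rewrite c1 cabsN.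
rewrite expr2; move: h1 h2 h3 h4; lra.
Qed.

Let bdint_split (x y a b : R) : bdint x (x + (a + a)) y (y + (b + b)) =
  bdint x (x + a) y (y + b) + bdint (x + a) (x + a + a) y (y + b)
  + bdint x (x + a) (y + b) (y + b + b) + bdint (x + a) (x + a + a) (y + b) (y + b + b).
Proof. by rewrite /bdint !addrA; ring. Qed.

Let good (w h M : R) n (p : R * R) :=
  [/\ M / 4 ^+ n <= cabs (bdint p.1 (p.1 + w / 2 ^+ n) p.2 (p.2 + h / 2 ^+ n)),
     inx p.1 /\ inx (p.1 + w / 2 ^+ n) & iny p.2 /\ iny (p.2 + h / 2 ^+ n)].

(** The integral over a rectangle is the sum of those over its four quarters, so one of these is at
    least a quarter of the total. *)
Let good_step (w h M : R) n (p : R * R) : 0 <= w -> 0 <= h -> good w h M n p ->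
  exists2 q, good w h M n.+1 q &
    p.1 <= q.1 <= p.1 + w / 2 ^+ n.+1 /\ p.2 <= q.2 <= p.2 + h / 2 ^+ n.+1.
Proof.
move: p => [x y] w0 h0 [/= B [x1 x2] [y1 y2]].
have q0 : 0 <= (2 ^+ n.+1)^-1 :> R by rewrite invr_ge0 exprn_ge0.
have e2 (u : R) : u / 2 ^+ n = u / 2 ^+ n.+1 + u / 2 ^+ n.+1.
  by rewrite exprS invfM; set t := (2 ^+ n)^-1; field.
have e4 : M / 4 ^+ n = 4 * (M / 4 ^+ n.+1).
  by rewrite exprS invfM; set t := (4 ^+ n)^-1; field.
set a := w / 2 ^+ n.+1 in e2 *; set b := h / 2 ^+ n.+1.
have a0 : 0 <= a by rewrite mulr_ge0.
have b0 : 0 <= b by rewrite mulr_ge0.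
have ew : w / 2 ^+ n = a + a by exact: e2.
have eh : h / 2 ^+ n = b + b by exact: e2.
move: B x2 y2; rewrite ew eh bdint_split e4.
set K := M / _; set B1 := bdint x _ y _; set B2 := bdint _ _ y _.
set B3 := bdint x _ _ _; set B4 := bdint _ _ _ _ => B x2 y2.
have x3 : inx (x + a).
  by move: x1 x2; rewrite /inx !ler_norml => /andP[? ?] /andP[? ?]; lra.
have y3 : iny (y + b).
  by move: y1 y2; rewrite /iny !ler_norml => /andP[? ?] /andP[? ?]; lra.
have x4 : inx (x + a + a) by rewrite -addrA.
have y4 : iny (y + b + b) by rewrite -addrA.
have tri : cabs (B1 + B2 + B3 + B4) <= cabs B1 + cabs B2 + cabs B3 + cabs B4.
  have := cabsD (B1 + B2 + B3) B4; have := cabsD (B1 + B2) B3; have := cabsD B1 B2.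
  lra.
have [|h1] := leP K (cabs B1).
  by move=> ?; exists (x, y); [split|split=> /=; lra].
have [|h2] := leP K (cabs B2).
  by move=> ?; exists (x + a, y); [split|split=> /=; lra].
have [|h3] := leP K (cabs B3).
  by move=> ?; exists (x, y + b); [split|split=> /=; lra].
have [|h4] := leP K (cabs B4).
  by move=> ?; exists (x + a, y + b); [split|split=> /=; lra].
exfalso; lra.
Qed.

(** Bisection: a nonzero integral of modulus M would leave at least M / 4^n on nested rectangles
    shrinking to a point, against the quadratic bound [local_bound] there. *)
Let bdint0 (x y w h : R) : 0 <= w -> 0 <= h ->
  inx x -> inx (x + w) -> iny y -> iny (y + h) -> bdint x (x + w) y (y + h) = 0.
Proof.
move=> w0 h0 x1 x2 y1 y2; apply/eqP; rewrite -cabs_eq0; apply/negPn/negP => B0.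
set M := cabs _ in B0.
have M0 : 0 < M by rewrite lt_neqAle eq_sym B0 cabs_ge0.
have /choice[nx nxP] (np : nat * (R * R)) : exists q, good w h M np.1 np.2 ->
    good w h M np.1.+1 q /\
    (np.2.1 <= q.1 <= np.2.1 + w / 2 ^+ np.1.+1 /\
     np.2.2 <= q.2 <= np.2.2 + h / 2 ^+ np.1.+1).
  have [g|ng] := pselect (good w h M np.1 np.2); last by exists (0, 0).
  by have [q q1 q2] := good_step w0 h0 g; exists q.
pose u n := iteri n (fun k (q : R * R) => nx (k, q)) (x, y).
have gu n : good w h M n (u n).
  elim: n => [|n IH]; first by rewrite /u /good /= !expr0 !divr1.
  by have [] := nxP (n, u n) IH.
have [a aP] := @nested_reals R (fun n => (u n).1) w w0 (fun n => (nxP (n, u n) (gu n)).2.1).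
have [b bP] := @nested_reals R (fun n => (u n).2) h h0 (fun n => (nxP (n, u n) (gu n)).2.2).
have sp : square c r (cx a b).
  have := aP 0%N; have := bP 0%N; rewrite /u /= !expr0 !divr1 => /andP[b1 b2] /andP[a1 a2].
  move: x1 x2 y1 y2; rewrite /inx /iny /square /= !cReImE !ler_norml.
  by move=> /andP[? ?] /andP[? ?] /andP[? ?] /andP[? ?]; split; lra.
(* This makes 2 e (w + h)^2 smaller than [M]; the [+ 1] covers degenerate rectangles. *)
pose e := M / (4 * (w + h + 1) ^+ 2).
have wh1 : 0 < (w + h + 1) ^+ 2 by rewrite exprn_gt0 //; lra.
have e0 : 0 < e by rewrite divr_gt0 // mulr_gt0.
have [d d0 dH] := local_bound sp e0.
have [n nd] : exists n, (w + h) / 2 ^+ n < d.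
  have nP := archi_boundP (divr_ge0 (addr_ge0 w0 h0) (ltW d0)).
  exists (Num.bound ((w + h) / d)); rewrite ltr_pdivrMr ?exprn_gt0 // mulrC -ltr_pdivrMr //.
  apply: lt_le_trans nP _; rewrite -natrX ler_nat; exact: ltnW (ltn_expl _ _).
have [g1 [g2 g3] [g4 g5]] := gu n.
have p2 : 0 <= (2 ^+ n)^-1 :> R by rewrite invr_ge0 exprn_ge0.
have := dH _ _ _ _ (mulr_ge0 w0 p2) (mulr_ge0 h0 p2) g2 g3 g4 g5 (aP n) (bP n).
rewrite -mulrDl => /(_ nd) /(le_trans g1).
have -> : 2 * e * ((w + h) / 2 ^+ n) ^+ 2 = 2 * e * (w + h) ^+ 2 / 4 ^+ n.
  have -> : 4 ^+ n = (2 ^+ n) ^+ 2 :> R.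
    by rewrite -exprM mulnC exprM; congr (_ ^+ n); ring.
  by rewrite expr_div_n mulrA.
rewrite ler_pM2r ?invr_gt0 ?exprn_gt0 // leNgt => /negP; apply.
have : (w + h) ^+ 2 <= (w + h + 1) ^+ 2 by rewrite ler_pXn2r ?nnegrE //; lra.
have -> : M = 4 * e * (w + h + 1) ^+ 2.
  by rewrite /e; field; lra.
move: wh1 e0; set W := (w + h + 1) ^+ 2; set V := (w + h) ^+ 2; nra.
Qed.

Let bdint0_sym x1 x2 y1 y2 : inx x1 -> inx x2 -> iny y1 -> iny y2 -> bdint x1 x2 y1 y2 = 0.
Proof.
wlog xx : x1 x2 / x1 <= x2.
  move=> W h1 h2 h3 h4; have [/W->//|/ltW/W H] := leP x1 x2.
  have -> : bdint x1 x2 y1 y2 = - bdint x2 x1 y1 y2 by rewrite /bdint; ring.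
  by rewrite H ?oppr0.
wlog yy : y1 y2 / y1 <= y2.
  move=> W h1 h2 h3 h4; have [/W->//|/ltW/W H] := leP y1 y2.
  have -> : bdint x1 x2 y1 y2 = - bdint x1 x2 y2 y1 by rewrite /bdint; ring.
  by rewrite H ?oppr0.
move=> h1 h2 h3 h4; have := @bdint0 x1 y1 (x2 - x1) (y2 - y1).
by rewrite !(addrC _ (_ - _)) !subrK !subr_ge0; apply.
Qed.

Lemma square_primitive : exists P : C -> C, forall z,
  `|cRe (z - c)| < r -> `|cIm (z - c)| < r -> cdiff P z (f z).
Proof.
have cx0 : inx (cRe c) by rewrite /inx subrr normr0 ltW.
have cy0 : iny (cIm c) by rewrite /iny subrr normr0 ltW.
(* Integration from [c] first horizontally, then vertically. *)
pose P z := hx (cIm c) (cRe z) - hx (cIm c) (cRe c) + ci * (vy (cRe z) (cIm z) - vy (cRe z) (cIm c)).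
exists P => z zx zy; apply/cdiff_epsP => e e0.
have zs : square c r z by split; exact: ltW.
have [l dl] := df zs; have fc := cdiff_cont dl.
have e2 : 0 < e / 2 by rewrite divr_gt0.
have [d d0 dH] := fc _ e2.
pose d' := Num.min (d / 2) (Num.min (r - `|cRe (z - c)|) (r - `|cIm (z - c)|)).
exists d'; first by rewrite !lt_min !subr_gt0 zx zy divr_gt0.
move=> w; rewrite !lt_min => /and3P[wd wx wy].
have := abs_Re_le (w - z); have := abs_Im_le (w - z).
rewrite cReD cReN cImD cImN => wzy wzx.
have xin t : Num.min (cRe z) (cRe w) <= t <= Num.max (cRe z) (cRe w) ->
    inx t /\ `|t - cRe z| <= `|cRe w - cRe z|.
  move=> tb; have tz : `|t - cRe z| <= `|cRe w - cRe z|.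
    move: tb; rewrite /Num.min /Num.max; case: ltP => h /andP[h1 h2].
      have h0 : 0 <= cRe w - cRe z by lra.
      by rewrite (ger0_norm h0) ler_norml; lra.
    have h0 : cRe w - cRe z <= 0 by lra.
    by rewrite (ler0_norm h0) ler_norml; lra.
  split=> //; rewrite /inx.
  have -> : t - cRe c = (t - cRe z) + cRe (z - c) by rewrite !cReImE; ring.
  by apply: le_trans (ler_normD _ _) _; lra.
have yin t : Num.min (cIm z) (cIm w) <= t <= Num.max (cIm z) (cIm w) ->
    iny t /\ `|t - cIm z| <= `|cIm w - cIm z|.
  move=> tb; have tz : `|t - cIm z| <= `|cIm w - cIm z|.
    move: tb; rewrite /Num.min /Num.max; case: ltP => h /andP[h1 h2].
      have h0 : 0 <= cIm w - cIm z by lra.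
      by rewrite (ger0_norm h0) ler_norml; lra.
    have h0 : cIm w - cIm z <= 0 by lra.
    by rewrite (ler0_norm h0) ler_norml; lra.
  split=> //; rewrite /iny.
  have -> : t - cIm c = (t - cIm z) + cIm (z - c) by rewrite !cReImE; ring.
  by apply: le_trans (ler_normD _ _) _; lra.
have zix : inx (cRe z) by apply: (xin _ _).1; rewrite ge_min lexx le_max lexx.
have wix : inx (cRe w) by apply: (xin _ _).1; rewrite ge_min lexx orbT le_max lexx orbT.
have ziy : iny (cIm z) by apply: (yin _ _).1; rewrite ge_min lexx le_max lexx.
have wiy : iny (cIm w) by apply: (yin _ _).1; rewrite ge_min lexx orbT le_max lexx orbT.
(* The vanishing integral around the rectangle with opposite corners (cRe z, cIm c) and (cRe w, cIm
   z) moves the horizontal leg from the height of [c] to that of [z]. *)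
have -> : P w - P z = (hx (cIm z) (cRe w) - hx (cIm z) (cRe z))
    + ci * (vy (cRe w) (cIm w) - vy (cRe w) (cIm z)).
  have := bdint0_sym zix wix cy0 ziy; rewrite /bdint => E.
  by rewrite -[RHS]addr0 -[in RHS]E /P; ring.
have daff (k : C) t : rdiff (fun u => rc u * k) t k.
  apply: rdiff_eq (@rdiff_path _ (fun v : C => v) 0 k t 1 (cdiff_id _)) => [u|].
    by rewrite add0r.
  by rewrite mul1r.
have Hx : cabs (hx (cIm z) (cRe w) - hx (cIm z) (cRe z) - (rc (cRe w) * f z - rc (cRe z) * f z))
    <= e / 2 * `|cRe w - cRe z|.
  apply: (mean_hx (A := fun u => rc u * f z) (k := fun=> f z)) => // t /xin[tin tz].
  rewrite ltW // dH //; apply: le_lt_trans (cabs_le_ReIm _) _; rewrite !cReImE subrr normr0.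
  by lra.
have Hy : cabs (vy (cRe w) (cIm w) - vy (cRe w) (cIm z) - (rc (cIm w) * f z - rc (cIm z) * f z))
    <= e / 2 * `|cIm w - cIm z|.
  apply: (mean_vy (A := fun u => rc u * f z) (k := fun=> f z)) => // t /yin[tin tz].
  by rewrite ltW // dH //; apply: le_lt_trans (cabs_le_ReIm _) _; rewrite !cReImE; lra.
have -> : (w - z) * f z = (rc (cRe w) * f z - rc (cRe z) * f z)
    + ci * (rc (cIm w) * f z - rc (cIm z) * f z).
  by rewrite -!mulrBl mulrA -mulrDl; congr (_ * _); apply: c_ext; rewrite !cReImE; ring.
set U := hx _ _ - _ in Hx *; set V := vy _ _ - _ in Hy *.
set U' := rc _ * _ - _ in Hx *; set V' := rc _ * _ - _ in Hy *.
have -> : U + ci * V - (U' + ci * V') = (U - U') + ci * (V - V') by ring.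
apply: le_trans (cabsD _ _) _; rewrite cabsM cabs_ci mul1r.
have : e / 2 * `|cRe w - cRe z| <= e / 2 * cabs (w - z) by rewrite ler_wpM2l // ltW.
have : e / 2 * `|cIm w - cIm z| <= e / 2 * cabs (w - z) by rewrite ler_wpM2l // ltW.
lra.
Qed.

End Goursat.

(** * The complex exponential and logarithms of points *)

Section ComplexExponential.
Context {R : realType}.
Local Notation C := (Cplx R).
Implicit Types (z w h : C) (x y t : R).

Definition cexp z : C := cx (expR (cRe z) * cos (cIm z)) (expR (cRe z) * sin (cIm z)).

Lemma cexpD z w : cexp (z + w) = cexp z * cexp w.
Proof.
by apply: c_ext; rewrite /cexp !cReImE expRD ?cosD ?sinD; ring.
Qed.

Lemma cexp0 : cexp 0 = 1.
Proof. by apply: c_ext; rewrite /cexp !cReImE expR0 ?cos0 ?sin0 mul1r. Qed.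

Lemma cabs_cexp z : cabs (cexp z) = expR (cRe z).
Proof.
rewrite cabs_sqrt !cReImE !exprMn -mulrDr cos2Dsin2 mulr1 sqrtr_sqr ger0_norm //.
Qed.

Lemma cexp_neq0 z : cexp z != 0.
Proof. by rewrite -cabs_gt0 cabs_cexp expR_gt0. Qed.

Lemma cexpN z : cexp (- z) = (cexp z)^-1.
Proof.
apply: (mulfI (cexp_neq0 z)); rewrite -cexpD subrr cexp0 divff //.
exact: cexp_neq0.
Qed.

Lemma cexpB z w : cexp (z - w) = cexp z / cexp w.
Proof. by rewrite cexpD cexpN. Qed.

Lemma cexpMn z n : cexp (n%:R * z) = cexp z ^+ n.
Proof.
elim: n => [|n IH]; first by rewrite mul0r cexp0.
by rewrite -natr1 mulrDl mul1r cexpD IH exprSr.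
Qed.

Lemma cexp_2pi_i : cexp (cx 0 (2 * pi)) = 1.
Proof.
have -> : 2 * pi = pi *+ 2 :> R by rewrite mulr_natl.
by apply: c_ext; rewrite /cexp !cReImE expR0 mul1r ?cos2pi ?sin2pi.
Qed.

Lemma rdiff_cexp h t : rdiff (fun u => cexp (rc u * h)) t (h * cexp (rc t * h)).
Proof.
have E u : cexp (rc u * h) = cx (expR (u * cRe h) * cos (u * cIm h)) (expR (u * cRe h) * sin (u * cIm h)).
  by rewrite /cexp !cReImE !mul0r subr0 addr0.
have D (k : R) : is_derive t 1 (fun u : R => u * k) k.
  apply/real_is_derive_epsP => e e0; exists 1 => // u _.
  by rewrite -mulrBl subrr normr0 mulr_ge0 // ltW.
have Dex := @is_derive1_comp R expR (fun u => u * cRe h) t _ _ (is_derive_expR (t * cRe h)) (D (cRe h)).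
have Dcos := @is_derive1_comp R cos (fun u => u * cIm h) t _ _ (is_derive_cos (t * cIm h)) (D (cIm h)).
have Dsin := @is_derive1_comp R sin (fun u => u * cIm h) t _ _ (is_derive_sin (t * cIm h)) (D (cIm h)).
apply: rdiff_eq (rdiff_cx (is_deriveM Dex Dcos) (is_deriveM Dex Dsin)) => [u|].
  by rewrite E.
rewrite E; apply: c_ext; rewrite !cReImE /GRing.scale /=; ring.
Qed.

Lemma cexp_sub1_le h : cabs h <= 1 -> cabs (cexp h - 1) <= expR 1 * cabs h.
Proof.
move=> h1.
have := @mean_value_le _ (fun u => cexp (rc u * h)) (fun t => h * cexp (rc t * h)) 0 1 (expR 1 * cabs h) ler01.
rewrite rc0 rc1 mul0r mul1r cexp0 subr0 mulr1; apply=> [t _|t /andP[t0 t1]].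
  exact: rdiff_cexp.
rewrite cabsM mulrC ler_wpM2r ?cabs_ge0 // cabs_cexp ler_expR.
apply: le_trans (ler_norm _) _; apply: le_trans (abs_Re_le _) _.
rewrite cabsM cabs_rc ger0_norm ?(ltW t0) //.
by apply: mulr_ile1 => //; rewrite ?cabs_ge0 ?ltW.
Qed.

(** The path exp (u h) - u h has derivative h (exp (u h) - 1), so the linear bound integrates to a
    quadratic one. *)
Lemma cexp_sub1_sub_le h : cabs h <= 1 -> cabs (cexp h - 1 - h) <= expR 1 * cabs h ^+ 2.
Proof.
move=> h1.
have := @mean_value_le _ (fun u => cexp (rc u * h) - rc u * h) (fun t => h * (cexp (rc t * h) - 1)) 0 1 (expR 1 * cabs h ^+ 2) ler01.
rewrite rc0 rc1 mul0r mul1r cexp0 !subr0 mulr1.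
have -> : cexp h - h - 1 = cexp h - 1 - h by ring.
apply=> [t _|t /andP[t0 t1]].
  have daff : rdiff (fun u => rc u * h) t h.
    apply: rdiff_eq (@rdiff_path _ (fun v : C => v) 0 h t 1 (cdiff_id _)) => [u|].
      by rewrite add0r.
    by rewrite mul1r.
  apply: rdiff_eq (rdiffB (rdiff_cexp h t) daff) => //.
  by rewrite mulrBr mulr1.
have th : cabs (rc t * h) <= cabs h.
  rewrite cabsM cabs_rc ger0_norm ?(ltW t0) // ler_piMl ?cabs_ge0 //; exact: ltW.
rewrite cabsM expr2 mulrCA ler_wpM2l ?cabs_ge0 //.
apply: le_trans (cexp_sub1_le (le_trans th h1)) _.
by rewrite ler_wpM2l ?expR_ge0.
Qed.

Lemma cdiff_cexp z : cdiff cexp z (cexp z).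
Proof.
apply/cdiff_epsP => e e0.
have K0 : 0 < expR (cRe z) * expR 1 :> R by rewrite mulr_gt0 ?expR_gt0.
exists (Num.min 1 (e / (expR (cRe z) * expR 1))); first by rewrite lt_min ltr01 divr_gt0.
move=> w; rewrite lt_min => /andP[/ltW w1 w2].
have -> : cexp w - cexp z - (w - z) * cexp z = cexp z * (cexp (w - z) - 1 - (w - z)).
  have E : cexp w = cexp z * cexp (w - z) by rewrite -cexpD addrC subrK.
  by rewrite E; ring.
rewrite cabsM cabs_cexp.
apply: le_trans (ler_wpM2l (expR_ge0 _) (cexp_sub1_sub_le w1)) _.
rewrite expr2 !mulrA ler_wpM2r ?cabs_ge0 // mulrC -ler_pdivlMr //; exact: ltW.
Qed.

Lemma ccont_cexp z : ccont cexp z.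
Proof. exact: cdiff_cont (cdiff_cexp z). Qed.

Lemma exists_clog z : z != 0 -> exists w, [/\ cexp w = z, cRe w = ln (cabs z) & `|cIm w| <= pi].
Proof.
move=> z0; have r0 : 0 < cabs z by rewrite cabs_gt0.
set r := cabs z in r0 *; pose a := cRe z / r; pose b := cIm z / r.
have ab : a ^+ 2 + b ^+ 2 = 1.
  rewrite !expr_div_n -mulrDl -cabs_sqr -/r divff //.
  by rewrite expf_neq0 // gt_eqF.
have a1 : -1 <= a <= 1.
  by rewrite -ler_norml -ler_sqr ?nnegrE // expr1n real_normK ?num_real // -ab lerDl sqr_ge0.
have sa : Num.sqrt (1 - a ^+ 2) = `|b| by rewrite -ab addrAC subrr add0r sqrtr_sqr.
pose t := if 0 <= b then acos a else - acos a.
have ct : cos t = a.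
  by rewrite /t; case: ifP => _; rewrite ?cosN acosK.
have st : sin t = b.
  rewrite /t; case: ifP => b0; rewrite ?sinN sin_acos // sa.
    by rewrite ger0_norm.
  by rewrite ltr0_norm ?opprK // ltNge b0.
exists (cx (ln r) t); split => //.
  apply: c_ext; rewrite /cexp !cReImE lnK ?posrE // ?ct ?st /a /b mulrC divfK //.
    by rewrite gt_eqF.
  by rewrite gt_eqF.
rewrite !cReImE /t; case: ifP => _; rewrite ?normrN ger0_norm ?acos_ge0 //; exact: acos_lepi.
Qed.

End ComplexExponential.

(** * The mean value inequality and the maximum principle *)

Section MaximumPrinciple.
Context {R : realType}.
Local Notation C := (Cplx R).
Implicit Types (z w : C) (x y t : R).

(* The mean value property, in the form of an inequality between linear functionals:
   after the substitution [z = c + cexp t], a primitive over one period does not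
   depend on the radius, and tends to [2 pi i f c] when the radius tends to 0. *)
Lemma circle_mean_le (f : C -> C) (c k : C) (r rho m : R) : 0 < rho < r ->
  ccont f c -> (forall z, 0 < cabs (z - c) < r -> exists l, cdiff f z l) ->
  (forall z, cabs (z - c) = rho -> cRe (k * f z) <= m) -> cRe (k * f c) <= m.
Proof.
move=> /andP[rho0 rhor] fc df fm.
rewrite leNgt; apply/negP => lt_m.
pose d := (cRe (k * f c) - m) / 2.
have d0 : 0 < d by rewrite divr_gt0 // subr_gt0.
have k1 : 0 < cabs k + 1 by rewrite ltr_wpDl ?cabs_ge0.
have [s s0 sH] := fc _ (divr_gt0 d0 k1).
(* Logarithms of two radii: the given one, and one so small that [f] is close to [f c] on its
   circle. *)
pose x2 := ln rho; pose x1 := ln (Num.min s rho / 2).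
have m0 : 0 < Num.min s rho / 2 by rewrite divr_gt0 // lt_min s0.
have x12 : x1 < x2.
  by rewrite ltr_ln ?posrE //; move: m0; rewrite /Num.min; case: (ltP s rho) => *; lra.
pose g (t : C) : C := f (c + cexp t).
pose L := (ln r - x1) + 2 * pi.
have xr : x2 < ln r by rewrite ltr_ln ?posrE // (lt_trans rho0).
have pi0 : 0 < pi :> R := pi_gt0 R.
have L0 : 0 < L by rewrite addr_gt0 ?mulr_gt0 // subr_gt0 (lt_trans x12).
(* The right edge of the square of half-side [L] about [q] lies midway between [x2] and [ln r], so
   [g] is differentiable on it; the square covers [x1, x2] times [0, 2 pi]. *)
pose q := (x2 + ln r) / 2 - L.
have [t [/= tx _]|P PH] := @square_primitive _ g (cx q 0) L L0.
  have tr : cRe t < ln r by move: tx; rewrite ler_norml !cReImE /q => /andP[_]; lra.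
  have [|l dl] := df (c + cexp t).
    rewrite addrAC subrr add0r cabs_cexp expR_gt0 /=.
    by rewrite -[X in _ < X](lnK (x := r)) ?ltr_expR // posrE (lt_trans rho0).
  exists (l * (0 + cexp t)).
  exact: (cdiff_comp (cdiffD (cdiff_cst t c) (cdiff_cexp t)) dl).
have Pin x y : x1 <= x <= x2 -> 0 <= y <= 2 * pi -> cdiff P (cx x y) (g (cx x y)).
  move=> /andP[xa xb] /andP[ya yb]; apply: PH; rewrite !cReImE ltr_norml /q; apply/andP; split;
    rewrite /L; lra.
pose K x := P (cx x (2 * pi)) - P (cx x 0).
have dPx x y : x1 <= x <= x2 -> 0 <= y <= 2 * pi ->
    rdiff (fun u => P (cx u y)) x (g (cx x y)).
  move=> hx hy; have E u : ci * rc y + rc u * 1 = cx u y by apply: c_ext; rewrite !cReImE; ring.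
  have := @rdiff_path _ P (ci * rc y) 1 x (g (cx x y)); rewrite E => /(_ (Pin _ _ hx hy)).
  by apply: rdiff_eq => [u|]; rewrite ?E ?mulr1.
have dPy x y : x1 <= x <= x2 -> 0 <= y <= 2 * pi ->
    rdiff (fun u => P (cx x u)) y (ci * g (cx x y)).
  move=> hx hy; have E u : rc x + rc u * ci = cx x u by apply: c_ext; rewrite !cReImE; ring.
  have := @rdiff_path _ P (rc x) ci y (g (cx x y)); rewrite E => /(_ (Pin _ _ hx hy)).
  by apply: rdiff_eq => [u|]; rewrite ?E 1?mulrC.
(* The derivative of [K] is the difference of [g] at the two ends of a period of exp, hence 0. *)
have KE : K x2 = K x1.
  apply/eqP; rewrite -subr_eq0 -cabs_eq0 eq_le cabs_ge0 andbT.
  rewrite -(mul0r (x2 - x1)).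
  apply: (@mean_value_le _ K (fun x => g (cx x (2 * pi)) - g (cx x 0))) (ltW x12) _ _ => x hx.
    by apply: rdiffB; apply: dPx => //; lra.
  have -> : cx x (2 * pi) = cx x 0 + cx 0 (2 * pi) by apply: c_ext; rewrite !cReImE; ring.
  by rewrite /g cexpD cexp_2pi_i mulr1 subrr cabs0.
have far x y : cabs (c + cexp (cx x y) - c) = expR x.
  by rewrite addrAC subrr add0r cabs_cexp.
have pi20 : 0 <= 2 * pi :> R by lra.
have H2 : cRe (- ci * k * K x2) <= m * (2 * pi - 0).
  apply: (@mean_value_Re _ (fun u => P (cx x2 u)) (fun u => ci * g (cx x2 u))) pi20 _ _ => y hy.
    by apply: dPy => //; rewrite lexx ltW.
  have -> : - ci * k * (ci * g (cx x2 y)) = k * g (cx x2 y).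
    by apply: c_ext; rewrite !cReImE; ring.
  by apply: fm; rewrite far lnK.
(* On the small circle [cRe (k * f z)] is at least m + d, since its value at the centre is m + 2 d;
   with [KE] this contradicts the bound on the large circle. *)
have H1 : cRe (ci * k * K x1) <= - (m + d) * (2 * pi - 0).
  apply: (@mean_value_Re _ (fun u => P (cx x1 u)) (fun u => ci * g (cx x1 u))) pi20 _ _ => y hy.
    by apply: dPy => //; rewrite lexx ltW.
  have -> : ci * k * (ci * g (cx x1 y)) = - (k * g (cx x1 y)).
    by apply: c_ext; rewrite !cReImE; ring.
  rewrite cReN lerN2.
  have gs : cabs (g (cx x1 y) - f c) < d / (cabs k + 1).
    apply: sH; rewrite far lnK // ltr_pdivrMr //.
    by move: m0; rewrite /Num.min; case: (ltP s rho) => *; lra.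
  have : `|cRe (k * (g (cx x1 y) - f c))| <= d.
    apply: le_trans (abs_Re_le _) _; rewrite cabsM.
    apply: le_trans (ler_wpM2l (cabs_ge0 _) (ltW gs)) _.
    by have := @cabs_scale_le _ k d 1 d0 ler01; rewrite !mulr1.
  rewrite mulrBr cReD cReN ler_norml => /andP[]; rewrite /d; lra.
have : cRe (ci * k * K x1) = - cRe (- ci * k * K x2) by rewrite KE !mulNr cReN opprK.
rewrite subr0 in H1 H2; move=> E; rewrite E in H1.
have : 0 < d * (2 * pi) by rewrite mulr_gt0 // mulr_gt0.
lra.
Qed.

Definition cconj z : C := cx (cRe z) (- cIm z).

Lemma mul_cconj z : z * cconj z = rc (cabs z ^+ 2).
Proof. by rewrite cabs_sqr; apply: c_ext; rewrite !cReImE; ring. Qed.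

Lemma cabs_cconj z : cabs (cconj z) = cabs z.
Proof. by rewrite !cabs_sqrt !cReImE sqrrN. Qed.

Lemma cconjB z w : cconj (z - w) = cconj z - cconj w.
Proof. by apply: c_ext; rewrite /cconj !cReImE //; ring. Qed.

Lemma ccont_cconj z : ccont cconj z.
Proof. by move=> e e0; exists e => // w; rewrite -cconjB cabs_cconj. Qed.

(* Maximising [|F z|^2 + eps |z|^2] instead of [|F z|] turns the maximum principle
   into a strict inequality at the maximum point, so that no connectedness is used. *)
Lemma max_modulus (F : C -> C) (K B : set C) (M b : R) : 0 <= M ->
  compact K -> (forall z, K z -> cabs z <= b) -> (forall z, K z -> ccont F z) ->
  (forall z, K z -> B z -> cabs (F z) <= M) ->
  (forall z, K z -> ~ B z -> exists2 r : R, 0 < r & forall w, 0 < cabs (w - z) < r ->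
     K w /\ exists l, cdiff F w l) ->
  forall z, K z -> cabs (F z) <= M.
Proof.
move=> M0 cK Kb Fc FB dF z1 Kz1; rewrite leNgt; apply/negP => Mz1.
have b0 : 0 <= b := le_trans (cabs_ge0 _) (Kb _ Kz1).
have b1 : 0 < b ^+ 2 + 1 by rewrite ltr_wpDl ?sqr_ge0.
(* Chosen so that |F z1|^2 = M^2 + e (b^2 + 1), more than |F|^2 + e |z|^2 can reach on [B]: the
   maximum is taken off [B]. *)
pose e := (cabs (F z1) ^+ 2 - M ^+ 2) / (b ^+ 2 + 1).
have e0 : 0 < e by rewrite divr_gt0 // subr_gt0 ltr_pXn2r ?nnegrE ?cabs_ge0.
pose h z := cabs (F z) ^+ 2 + e * cabs z ^+ 2.
pose H z : C := F z * cconj (F z) + rc e * (z * cconj z).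
have HE z : H z = rc (h z) by rewrite /H !mul_cconj /h rcD rcM.
have h0 z : 0 <= h z by rewrite addr_ge0 ?sqr_ge0 // mulr_ge0 ?sqr_ge0 // ltW.
have [||c Kc cmax] := @cabs_attains_max _ H K _ cK _.
- by exists z1.
- move=> z /Fc Fz; apply: ccontD.
    exact: ccontM Fz (ccont_comp Fz (@ccont_cconj _)).
  by apply: ccontM (ccont_cst _ _) _; exact: ccontM (ccont_id _) (@ccont_cconj _).
have hmax z : K z -> h z <= h c.
  by move=> /cmax; rewrite !HE !cabs_rc !ger0_norm.
have nBc : ~ B c.
  move=> Bc; have := hmax _ Kz1; rewrite leNgt => /negP; apply.
  have E : cabs (F z1) ^+ 2 = M ^+ 2 + e * (b ^+ 2 + 1).
    by rewrite /e; field; lra.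
  have h1 : cabs (F c) ^+ 2 <= M ^+ 2 by rewrite ler_pXn2r ?nnegrE ?cabs_ge0 //; exact: FB.
  have h2 : cabs c ^+ 2 <= b ^+ 2 by rewrite ler_pXn2r ?nnegrE ?cabs_ge0 //; exact: Kb.
  have h3 : e * cabs c ^+ 2 <= e * b ^+ 2 by rewrite ler_wpM2l // ltW.
  have h4 : 0 <= e * cabs z1 ^+ 2 by rewrite mulr_ge0 ?sqr_ge0 // ltW.
  rewrite /h E; lra.
have [r r0 rH] := dF _ Kc nBc.
(* A holomorphic function whose real part is |F c|^2 at [c]. On a circle of radius t about the
   maximum point, 2 Re (conj (F c) F z) is at most |F c|^2 + |F z|^2, and 2 Re (conj c (z - c)) =
   |z|^2 - |c|^2 - t^2; maximality then bounds the real part of [G] by |F c|^2 - e t^2 / 2. *)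
pose G w : C := cconj (F c) * F w + rc e * cconj c * (w - c).
have := @circle_mean_le G c 1 r (r / 2) (cabs (F c) ^+ 2 - e / 2 * (r / 2) ^+ 2).
have -> : cRe (1 * G c) = cabs (F c) ^+ 2.
  by rewrite mul1r /G subrr mulr0 addr0 mulrC mul_cconj.
have p0 : 0 < e / 2 * (r / 2) ^+ 2 by apply: mulr_gt0; [exact: divr_gt0|rewrite exprn_gt0 // divr_gt0].
move=> W; suff : cabs (F c) ^+ 2 <= cabs (F c) ^+ 2 - e / 2 * (r / 2) ^+ 2 by lra.
apply: W.
- by rewrite divr_gt0 //=; lra.
- apply: ccontD; first by apply: ccontM (ccont_cst _ _) _; exact: Fc.
  by apply: ccontM (ccont_cst _ _) _; exact: ccontB (ccont_id _) (ccont_cst _ _).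
- move=> w /rH[_ [l dl]]; exists (cconj (F c) * l + rc e * cconj c * (1 - 0)).
  apply: cdiffD; first exact: cdiffZ.
  by apply: cdiffZ; exact: cdiffB (cdiff_id _) (cdiff_cst _ _).
- move=> z zc; have zr : 0 < cabs (z - c) < r by rewrite zc; lra.
  have := hmax _ (rH _ zr).1; rewrite /h mul1r -zc /G !cabs_sqr !cReImE.
  set a := cRe (F c); set a' := cIm (F c); set u := cRe (F z); set u' := cIm (F z).
  set x := cRe z; set x' := cIm z; set y := cRe c; set y' := cIm c.
  have := sqr_ge0 (a - u); have := sqr_ge0 (a' - u'); nra.
Qed.

End MaximumPrinciple.

(** * Lipschitz and Cauchy estimates from the maximum principle *)

Section CauchyEstimates.
Context {R : realType}.
Local Notation C := (Cplx R).
Implicit Types (z w a c p l : C) (r M : R) (F : C -> C).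

Lemma bernoulli_le (q : R) n : 0 <= q -> 1 + n%:R * q <= (1 + q) ^+ n.
Proof.
move=> q0; elim: n => [|n IH]; first by rewrite mul0r addr0 expr0.
have h : 0 <= n%:R * q by rewrite mulr_ge0 // ler0n.
rewrite exprS; apply: le_trans (ler_wpM2l _ IH); last by lra.
by rewrite -natr1; nra.
Qed.

(** Taking roots of growing order makes the constants [d] and [b] disappear. *)
Lemma le_of_powers (x y d b : R) : 0 <= y -> 0 < d -> 0 <= b ->
  (forall n, x ^+ n.+1 * d <= y ^+ n.+1 * b) -> x <= y.
Proof.
move=> y0 d0 b0 H; rewrite leNgt; apply/negP => yx.
have x0 : 0 < x := le_lt_trans y0 yx.
have [y_eq0|yn0] := eqVneq y 0.
  have := H 0%N; rewrite y_eq0 expr1 expr1 mul0r leNgt => /negP; apply.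
  exact: mulr_gt0.
have y1 : 0 < y by rewrite lt_neqAle eq_sym yn0.
pose q := x / y - 1.
have q0 : 0 < q by rewrite subr_gt0 ltr_pdivlMr // mul1r.
have xE : x = y * (1 + q) by rewrite /q; field.
have nP := archi_boundP (divr_ge0 b0 (ltW (mulr_gt0 d0 q0))).
set n := Num.bound _ in nP.
have := H n; rewrite xE exprMn -mulrA ler_pM2l ?exprn_gt0 // leNgt => /negP; apply.
have h := bernoulli_le n.+1 (ltW q0).
apply: lt_le_trans (ler_wpM2r (ltW d0) h).
rewrite ltr_pdivrMr ?mulr_gt0 // in nP.
apply: (lt_trans nP); rewrite -natr1.
have : 0 < q * d by exact: mulr_gt0.
nra.
Qed.

Lemma punctured_disc_avoids z a p : exists2 d : R, 0 < d &
  forall w, 0 < cabs (w - z) < d -> w <> a /\ w <> p.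
Proof.
have one v : exists2 d : R, 0 < d & forall w, 0 < cabs (w - z) < d -> w <> v.
  have [->|vz] := eqVneq v z.
    by exists 1 => // w /andP[w0 _] wz; move: w0; rewrite wz subrr cabs0 ltxx.
  exists (cabs (v - z)); first by rewrite cabs_gt0 subr_eq0.
  by move=> w /andP[_ wd] wv; rewrite wv ltxx in wd.
have [d d0 dH] := one a; have [e e0 eH] := one p.
exists (Num.min d e); first by rewrite lt_min d0.
move=> w /andP[w0]; rewrite lt_min => /andP[wd we].
by split; [apply: dH|apply: eH]; rewrite w0.
Qed.

Lemma ccont_scaled_bounded F a B r : 0 < r ->
  (forall w, 0 < cabs (w - a) < r -> cabs (F w) <= B) -> ccont (fun w => F w * (w - a)) a.
Proof.
move=> r0 FB e e0.
have B0 : 0 <= B.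
  apply: le_trans (cabs_ge0 _) (FB (a + rc (r / 2)) _).
  by rewrite addrAC subrr add0r cabs_rc gtr0_norm ?divr_gt0 //; lra.
have B1 : 0 < B + 1 by lra.
exists (Num.min r (e / (B + 1))); first by rewrite lt_min r0 divr_gt0.
move=> w; rewrite lt_min => /andP[wr we]; rewrite subrr mulr0 subr0 cabsM.
have [->|wa] := eqVneq w a; first by rewrite subrr cabs0 mulr0.
have w0 : 0 < cabs (w - a) by rewrite cabs_gt0 subr_eq0.
have h : cabs (F w) <= B by apply: FB; rewrite w0.
rewrite ltr_pdivlMr // in we; nra.
Qed.

(* Bounded functions may be singular at [a]: apply [max_modulus] to
   [F ^ n * (z - a)] and let [n] tend to infinity. *)
Lemma max_modulus_disc F c r s a p M B : 0 < r -> r < s -> 0 <= M ->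
  (forall z, cabs (z - c) < s -> z <> a -> ccont F z) ->
  (forall z, cabs (z - c) < s -> z <> a -> z <> p -> exists l, cdiff F z l) ->
  (forall z, cabs (z - c) < s -> z <> a -> cabs (F z) <= B) ->
  (forall z, cabs (z - c) = r -> z <> a -> cabs (F z) <= M) ->
  forall z, cabs (z - c) <= r -> z <> a -> cabs (F z) <= M.
Proof.
move=> r0 rs M0 Fc dF FB FM z zc za.
have d0 : 0 < cabs (z - a) by rewrite cabs_gt0 subr_eq0; apply/eqP.
have b0 : 0 <= r + cabs (a - c) by rewrite addr_ge0 ?cabs_ge0 // ltW.
apply: (@le_of_powers _ _ _ _ M0 d0 b0) => n.
pose G w : C := F w ^+ n.+1 * (w - a).
have -> : cabs (F z) ^+ n.+1 * cabs (z - a) = cabs (G z) by rewrite cabsM cabsX.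
have cG w : cabs (w - c) <= r -> ccont G w.
  move=> wc; have [E|/eqP wa] := eqVneq w a; last first.
    apply: ccontM (ccontB (ccont_id _) (ccont_cst _ _)).
    by apply: ccontX; apply: Fc => //; exact: le_lt_trans rs.
  rewrite E in wc *.
  apply: (@ccont_scaled_bounded (fun w => F w ^+ n.+1) a (B ^+ n.+1) (s - cabs (a - c))).
    by rewrite subr_gt0 (le_lt_trans wc).
  move=> v /andP[w0 ws]; rewrite cabsX.
  have h : cabs (F v) <= B.
    apply: FB => [|va]; last by move: w0; rewrite va subrr cabs0 ltxx.
    by have := cabsD (v - a) (a - c); rewrite addrA subrK; lra.
  by rewrite lerXn2r ?nnegrE ?cabs_ge0 // (le_trans (cabs_ge0 _) h).
have MG : 0 <= M ^+ n.+1 * (r + cabs (a - c)) by rewrite mulr_ge0 ?exprn_ge0.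
apply: (@max_modulus _ G [set w | cabs (w - c) <= r] [set w | cabs (w - c) = r] _ (r + cabs c) MG) => //.
- exact: compact_disc.
- by move=> w /= wr; have := cabsD (w - c) c; rewrite subrK; lra.
- move=> w /= wr wr'; rewrite cabsM cabsX.
  have [->|/eqP wa] := eqVneq w a; first by rewrite subrr cabs0 mulr0.
  apply: ler_pM; rewrite ?exprn_ge0 ?cabs_ge0 //.
    by rewrite lerXn2r ?nnegrE ?cabs_ge0 // FM.
  by have := cabsD (w - c) (c - a); rewrite addrA subrK (cabsB c a); lra.
- move=> w /= wr /eqP wr'; have {}wr : cabs (w - c) < r by rewrite lt_neqAle wr'.
  have [d e0 dH] := punctured_disc_avoids w a p.
  exists (Num.min d (r - cabs (w - c))); first by rewrite lt_min e0 subr_gt0.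
  move=> v /andP[v0]; rewrite lt_min => /andP[vd vr].
  have vr' : cabs (v - c) < r by have := cabsD (v - w) (w - c); rewrite addrA subrK; lra.
  split; first exact: ltW.
  have [|va vp] := dH v; first by rewrite v0.
  have [l dl] := dF v (lt_trans vr' rs) va vp.
  exists (n.+1%:R * F v ^+ n * l * (v - a) + F v ^+ n.+1 * (1 - 0)).
  apply: cdiffM (cdiffB (cdiff_id _) (cdiff_cst _ _)).
  exact: (cdiff_comp dl (cdiffX _ _)).
Qed.

Lemma slope_diff F w l z : z <> w -> (exists m, cdiff F z m) -> exists m, cdiff (slope F w l) z m.
Proof.
move=> /eqP zw [m dm].
have d1 := cdiffB dm (cdiff_cst z (F w)); have d2 := cdiffB (cdiff_id z) (cdiff_cst z w).
have zw0 : z - w != 0 by rewrite subr_eq0.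
have := @cdiff_div _ (fun v => F v - F w) (fun v => v - w) z _ _ zw0 d1 d2; set k := _ / _ => dk; exists k.
apply: cdiff_near dk; apply/nbhs_cabsP; exists (cabs (z - w)); first by rewrite cabs_gt0.
move=> v vz; rewrite /slope; case: eqVneq => // vw.
by move: vz; rewrite vw cabsB ltxx.
Qed.

Lemma cabs_slope F w l z : z <> w -> cabs (slope F w l z) = cabs (F z - F w) / cabs (z - w).
Proof. by rewrite /slope => /eqP/negbTE ->; rewrite cabsM cabsV. Qed.

Lemma slope_bounded_near F w l : cdiff F w l ->
  exists2 d : R, 0 < d & forall z, cabs (z - w) < d -> cabs (slope F w l z) <= cabs l + 1.
Proof.
move=> /cdiff_slope sc; have [d d0 dH] := sc 1 ltr01; exists d => // z /dH.
rewrite slope_at => h; have := cabsD (slope F w l z - l) l; rewrite subrK; lra.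
Qed.

(** The maximum principle for the difference quotient at [w], at most 2 M / r on the circle of
    radius [r]. At [w] this quotient is so far only known to be continuous, hence the exceptional
    point [p] of [max_modulus_disc]; the excluded point [a] is a possible singularity of [F]. *)
Lemma lipschitz_center F w r s a M : 0 < r -> r < s -> w <> a -> 0 <= M ->
  (forall z, cabs (z - w) < s -> z <> a -> exists l, cdiff F z l) ->
  (forall z, cabs (z - w) < s -> z <> a -> cabs (F z) <= M) ->
  forall z, cabs (z - w) <= r -> z <> a -> cabs (F z - F w) <= 2 * M / r * cabs (z - w).
Proof.
move=> r0 rs wa M0 dF FM z zr za.
have ws : cabs (w - w) < s by rewrite subrr cabs0 (lt_trans r0).
have [l dl] := dF w ws wa.
have [d d0 dH] := slope_bounded_near dl.
have F2 v : cabs (v - w) < s -> v <> a -> cabs (F v - F w) <= 2 * M.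
  by move=> h1 h2; have := cabsD (F v) (- F w); rewrite cabsN; have := FM v h1 h2; have := FM w ws wa; lra.
have M1 : 0 <= 2 * M / r by rewrite divr_ge0 ?mulr_ge0 // ltW.
rewrite (slopeE F w l z) addrAC subrr add0r cabsM mulrC ler_wpM2r ?cabs_ge0 //.
apply: (@max_modulus_disc (slope F w l) w r s a w _ (cabs l + 1 + 2 * M / d)) => //.
- move=> v vs va; have [->|/eqP vw] := eqVneq v w; first exact/cdiff_slope.
  have [m dm] := slope_diff l vw (dF v vs va); exact: cdiff_cont dm.
- by move=> v vs va vw; apply: slope_diff => //; exact: dF.
- move=> v vs va; have l0 := cabs_ge0 l.
  have M2 : 0 <= 2 * M / d by rewrite divr_ge0 ?mulr_ge0 // ltW.
  have [/dH h|dv] := ltP (cabs (v - w)) d; first by lra.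
  have vw : v <> w by move=> E; move: dv; rewrite E subrr cabs0; lra.
  rewrite cabs_slope //.
  suff : cabs (F v - F w) / cabs (v - w) <= 2 * M / d by lra.
  apply: ler_pM; rewrite ?cabs_ge0 ?invr_ge0 ?cabs_ge0 //; first exact: F2.
  by rewrite lef_pV2 ?posrE // (lt_le_trans d0).
- move=> v vr va; have vw : v <> w by move=> E; move: vr r0; rewrite E subrr cabs0 => ->; rewrite ltxx.
  by rewrite cabs_slope // vr ler_wpM2r ?invr_ge0 ?(ltW r0) // F2 // vr.
Qed.

Lemma lipschitz_disc F w r s M : 0 < r -> r < s -> 0 <= M ->
  (forall z, cabs (z - w) < s -> exists l, cdiff F z l) ->
  (forall z, cabs (z - w) < s -> cabs (F z) <= M) ->
  forall z, cabs (z - w) <= r -> cabs (F z - F w) <= 2 * M / r * cabs (z - w).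
Proof.
move=> r0 rs M0 dF FM z zr.
(* The excluded point is put on the boundary circle, outside the open disc. *)
have na v : cabs (v - w) < s -> v <> w + rc s.
  move=> h E; move: h; rewrite E addrAC subrr add0r cabs_rc gtr0_norm ?ltxx //.
  exact: lt_trans rs.
apply: (@lipschitz_center F w r s (w + rc s)) => //.
- by apply: na; rewrite subrr cabs0 (lt_trans r0).
- by move=> v vs _; exact: dF.
- by move=> v vs _; exact: FM.
- by apply: na; exact: le_lt_trans rs.
Qed.

Lemma cdiff_lipschitz_le F w l (L d : R) : 0 < d ->
  (forall z, cabs (z - w) <= d -> cabs (F z - F w) <= L * cabs (z - w)) ->
  cdiff F w l -> cabs l <= L.
Proof.
move=> d0 FL /cdiff_epsP H; apply/ler_addgt0Pr => e e0.
have [t t0 tH] := H e e0; pose h := Num.min d (t / 2).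
have h0 : 0 < h by rewrite lt_min d0 divr_gt0.
have hd : h <= d by rewrite ge_min lexx.
have ht : h < t by apply: (@le_lt_trans _ _ (t / 2)); [rewrite ge_min lexx orbT|lra].
have E : w + rc h - w = rc h by rewrite addrAC subrr add0r.
have ch : cabs (rc h) = h by rewrite cabs_rc gtr0_norm.
have h1 := FL (w + rc h); have h2 := tH (w + rc h).
rewrite E ch in h1 h2; have {}h1 := h1 hd; have {}h2 := h2 ht.
have : cabs (rc h * l) <= (L + e) * h.
  have := cabsD (F (w + rc h) - F w) (- (F (w + rc h) - F w - rc h * l)).
  by rewrite cabsN opprB addrCA subrr addr0; lra.
by rewrite cabsM ch mulrC ler_pM2r.
Qed.

Lemma cauchy_derivative F w r s M l : 0 < r -> r < s -> 0 <= M ->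
  (forall z, cabs (z - w) < s -> exists l, cdiff F z l) ->
  (forall z, cabs (z - w) < s -> cabs (F z) <= M) -> cdiff F w l -> cabs l <= 2 * M / r.
Proof.
move=> r0 rs M0 dF FM; apply: (cdiff_lipschitz_le r0).
exact: (lipschitz_disc r0 rs M0 dF FM).
Qed.

End CauchyEstimates.

(** * Removable singularities and differentiability of the derivative *)

Section RemovableSingularities.
Context {R : realType}.
Local Notation C := (Cplx R).
Implicit Types (z w a c l v : C) (r M : R) (F : C -> C).

(** With [a] as excluded point, [lipschitz_center] gives one Lipschitz constant on the whole
    punctured disc; [v] is a cluster value of [F] along points tending to [a], and the Lipschitz
    bound passes to it. *)
Lemma bounded_punctured_lipschitz F a r B : 0 < r ->
  (forall z, 0 < cabs (z - a) < r -> exists l, cdiff F z l) ->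
  (forall z, 0 < cabs (z - a) < r -> cabs (F z) <= B) ->
  exists v, exists2 L : R, 0 <= L &
    forall z, 0 < cabs (z - a) < r / 4 -> cabs (F z - v) <= L * cabs (z - a).
Proof.
move=> r0 dF FB.
have ac (t : R) : cabs (a + rc t - a) = `|t| by rewrite addrAC subrr add0r cabs_rc.
have B0 : 0 <= B.
  apply: le_trans (cabs_ge0 _) (FB (a + rc (r / 2)) _).
  by rewrite ac gtr0_norm ?divr_gt0 //; lra.
pose L := 2 * B / (r / 2).
have L0 : 0 <= L by rewrite divr_ge0 ?mulr_ge0 //; lra.
have lip z w : 0 < cabs (z - a) < r / 4 -> 0 < cabs (w - a) < r / 4 ->
    cabs (F z - F w) <= L * cabs (z - w).
  move=> /andP[z0 z1] /andP[w0 w1].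
  have pos u : u <> a -> 0 < cabs (u - a) by move=> /eqP; rewrite cabs_gt0 subr_eq0.
  have npos u : 0 < cabs (u - a) -> u <> a by rewrite cabs_gt0 subr_eq0 => /eqP.
  have near u : cabs (u - w) < 3 * r / 4 -> cabs (u - a) < r.
    by have := cabsD (u - w) (w - a); rewrite addrA subrK; lra.
  have r2 : 0 < r / 2 by lra.
  have r3 : r / 2 < 3 * r / 4 by lra.
  apply: (@lipschitz_center _ F w (r / 2) (3 * r / 4) a B) => //.
  - exact: npos.
  - by move=> u us ua; apply: dF; rewrite pos //= near.
  - by move=> u us ua; apply: FB; rewrite pos //= near.
  - by have := cabsD (z - a) (a - w); rewrite addrA subrK (cabsB a w); lra.
  - exact: npos.
pose u n : C := a + rc (r / 8 / n.+1%:R).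
have u0 n : 0 < r / 8 / n.+1%:R by rewrite !divr_gt0.
have un n : cabs (u n - a) = r / 8 / n.+1%:R by rewrite ac gtr0_norm.
have ur n : 0 < cabs (u n - a) < r / 4.
  rewrite un u0 /=; apply: (@le_lt_trans _ _ (r / 8)); last by lra.
  by rewrite ler_pdivrMr // ler_peMr ?ler1n //; lra.
have [|v vP] := @bounded_cluster _ (fun n => F (u n)) B.
  by move=> n; apply: FB; have /andP[-> ] := ur n; lra.
exists v, L => // z zr; apply/ler_addgt0Pr => e e0.
have L1 : 0 < L + 1 by lra.
have Nb := archi_boundP (ltW (divr_gt0 (mulr_gt0 r0 L1) e0)).
set N := Num.bound _ in Nb.
have e2 : 0 < e / 2 by rewrite divr_gt0.
have [n nN nv] := vP _ N e2.
have h1 := lip z (u n) zr (ur n).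
have h2 : L * cabs (z - u n) <= L * cabs (z - a) + L * cabs (u n - a).
  rewrite -mulrDr ler_wpM2l //.
  by have := cabsD (z - a) (a - u n); rewrite addrA subrK (cabsB a).
have h3 : L * cabs (u n - a) <= e / 2.
  rewrite un; apply: (@le_trans _ _ ((L + 1) * r / 8 / n.+1%:R)).
    by rewrite !mulrA ler_wpM2r ?invr_ge0 // ler_wpM2r // ler_wpM2r ?(ltW r0) //; lra.
  rewrite ler_pdivrMr //; have : r * (L + 1) / e <= n.+1%:R.
    by apply: ltW; apply: lt_le_trans Nb _; rewrite ler_nat; exact: leqW.
  rewrite ler_pdivrMr //; have : 0 <= n.+1%:R * e by rewrite mulr_ge0 // ltW.
  lra.
have := cabsD (F z - F (u n)) (F (u n) - v); rewrite addrA subrK; lra.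
Qed.

(* Apply [bounded_punctured_lipschitz] first to [F], then to its difference
   quotient at [a]. *)
Lemma removable_bounded F a r B : 0 < r ->
  (forall z, 0 < cabs (z - a) < r -> exists l, cdiff F z l) ->
  (forall z, 0 < cabs (z - a) < r -> cabs (F z) <= B) ->
  exists v l, cdiff (fun z => if z == a then v else F z) a l.
Proof.
move=> r0 dF FB.
have [v [L L0 vP]] := bounded_punctured_lipschitz r0 dF FB.
pose G z := if z == a then v else F z.
have Ga : G a = v by rewrite /G eqxx.
have GE z : z <> a -> G z = F z by rewrite /G; case: eqVneq.
have npos u : 0 < cabs (u - a) -> u <> a by rewrite cabs_gt0 subr_eq0 => /eqP.
have r4 : 0 < r / 4 by rewrite divr_gt0.
have [z zr|z zr|l [L' L'0 lP]] := @bounded_punctured_lipschitz (slope G a 0) a (r / 4) L r4.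
- have /andP[/npos za zr4] := zr.
  apply: slope_diff => //; have [|m dm] := dF z.
    by move: zr => /andP[->] /=; lra.
  exists m; apply: cdiff_near dm; apply/nbhs_cabsP.
  exists (cabs (z - a)); first by case/andP: zr.
  move=> w wz; rewrite GE // => wa; move: wz; rewrite wa cabsB ltxx //.
- have /andP[z0 _] := zr; have /npos za := z0.
  rewrite cabs_slope // Ga GE // ler_pdivrMr //; exact: vP.
exists v, l; apply/cdiff_epsP => e e0.
have L1 : 0 < L' + 1 by lra.
exists (Num.min (r / 4 / 4) (e / (L' + 1))); first by rewrite lt_min !divr_gt0.
move=> w; rewrite lt_min => /andP[w1 w2].
change (cabs (G w - G a - (w - a) * l) <= e * cabs (w - a)).
have [->|/eqP wa] := eqVneq w a; first by rewrite !subrr mul0r subrr cabs0 mulr0.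
rewrite (slopeE G a 0 w).
have -> : G a + (w - a) * slope G a 0 w - G a - (w - a) * l = (w - a) * (slope G a 0 w - l) by ring.
rewrite cabsM mulrC ler_wpM2r ?cabs_ge0 //.
have w0 : 0 < cabs (w - a) by rewrite cabs_gt0 subr_eq0; apply/eqP.
have := lP w; rewrite w0 w1 => /(_ isT) h; apply: le_trans h _.
rewrite ltr_pdivlMr // in w2; nra.
Qed.

Lemma ccont_agree F G a : ccont F a -> ccont G a -> (forall z, z <> a -> F z = G z) -> F a = G a.
Proof.
move=> Fc Gc FG; apply/eqP; rewrite -subr_eq0 -cabs_eq0 eq_le cabs_ge0 andbT.
apply/ler_addgt0Pr => e e0; rewrite add0r.
have e2 : 0 < e / 2 by rewrite divr_gt0.
have [d d0 dH] := Fc _ e2; have [d' d'0 d'H] := Gc _ e2.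
pose t := Num.min d d' / 2.
have m0 : 0 < Num.min d d' by rewrite lt_min d0.
have t0 : 0 < t by rewrite divr_gt0.
have tE : cabs (a + rc t - a) = t by rewrite addrAC subrr add0r cabs_rc gtr0_norm.
have tm : t < Num.min d d' by rewrite /t; lra.
have := dH (a + rc t); have := d'H (a + rc t); rewrite tE.
move: tm; rewrite lt_min => /andP[-> ->] /(_ isT) h1 /(_ isT) h2.
have E : F (a + rc t) = G (a + rc t).
  by apply: FG => E; move: tE; rewrite E subrr cabs0 => /eqP; rewrite lt_eqF.
have := cabsD (F a - F (a + rc t)) (G (a + rc t) - G a); rewrite -E addrA subrK.
rewrite (cabsB (F a)) E; rewrite E in h2; lra.
Qed.

(** The difference quotient is bounded near [a], hence extends differentiably; by continuity the
    extension takes the value [l] there. *)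
Lemma slope_diff_center F a r l : 0 < r ->
  (forall z, cabs (z - a) < r -> exists l, cdiff F z l) -> cdiff F a l ->
  exists m, cdiff (slope F a l) a m.
Proof.
move=> r0 dF dl; have [d d0 dH] := slope_bounded_near dl.
have npos u : 0 < cabs (u - a) -> u <> a by rewrite cabs_gt0 subr_eq0 => /eqP.
have m0 : 0 < Num.min d r by rewrite lt_min d0.
have [z /andP[/npos za]|z /andP[_]|v [m dm]] :=
    @removable_bounded (slope F a l) a (Num.min d r) (cabs l + 1) m0.
- by rewrite lt_min => /andP[_ zr]; apply: slope_diff => //; exact: dF.
- by rewrite lt_min => /andP[zd _]; exact: dH.
exists m; suff E : v = l.
  apply: cdiff_eq dm => // z; case: eqVneq => // ->.
  by rewrite slope_at.
have /cdiff_slope sc := dl.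
have := @ccont_agree _ _ a (cdiff_cont dm) sc; rewrite eqxx slope_at; apply=> z /eqP/negbTE -> //.
Qed.

Section Derivative.
Context (f : C -> C).

Lemma derivative_slopeE f' S' a z : cdiff f a (f' a) -> cdiff f z (f' z) ->
  cdiff (slope f a (f' a)) z S' -> f' z = slope f a (f' a) z + (z - a) * S'.
Proof.
move=> da dz dS; apply: cdiff_uniq dz _.
have := cdiffD (cdiff_cst z (f a)) (cdiffM (cdiffB (cdiff_id z) (cdiff_cst z a)) dS).
by apply: cdiff_eq => [w|]; [rewrite -slopeE|rewrite subr0 add0r mul1r].
Qed.

End Derivative.

(** With [S] the slope of [f] at [a], f' z = S z + (z - a) S' z; [S] is continuous at [a], and a
    Cauchy estimate bounds S' near [a]. *)
Lemma ccont_derivative (f f' : C -> C) a r : 0 < r ->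
  (forall z, cabs (z - a) < r -> cdiff f z (f' z)) -> ccont f' a.
Proof.
move=> r0 df; have aa : cabs (a - a) < r by rewrite subrr cabs0.
pose S := slope f a (f' a).
have dS z : cabs (z - a) < r -> exists m, cdiff S z m.
  move=> zr; have [->|/eqP za] := eqVneq z a.
    apply: (@slope_diff_center _ _ r) => // [w wr|]; last exact: df.
    by exists (f' w); exact: df.
  by apply: slope_diff => //; exists (f' z); exact: df.
have Sc : ccont S a by apply/cdiff_slope; exact: df.
have [d d0 dH] := slope_bounded_near (df a aa).
pose q := Num.min d r / 4.
have q0 : 0 < q by rewrite divr_gt0 // lt_min d0.
have qd : 4 * q <= d by rewrite /q mulrC divfK // ge_min lexx.
have qr : 4 * q <= r by rewrite /q mulrC divfK // ge_min lexx orbT.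
pose M := 2 * (cabs (f' a) + 1) / q.
have M1 : 0 <= cabs (f' a) + 1 by rewrite addr_ge0 ?cabs_ge0.
have M0 : 0 <= M by rewrite divr_ge0 ?(ltW q0) // mulr_ge0.
move=> e e0; have e2 : 0 < e / 2 by rewrite divr_gt0.
have [s s0 sH] := Sc _ e2.
exists (Num.min s (Num.min q (e / 2 / (M + 1)))).
  by rewrite !lt_min s0 q0 !divr_gt0 //; lra.
move=> z; rewrite !lt_min => /and3P[/sH zs zq ze].
have zr : cabs (z - a) < r by lra.
have [m dm] := dS z zr.
rewrite (derivative_slopeE (df a aa) (df z zr) dm) -/S.
have tri u : cabs (u - z) < 2 * q -> cabs (u - a) < 3 * q.
  by have := cabsD (u - z) (z - a); rewrite addrA subrK; lra.
have mM : cabs m <= M.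
  apply: (@cauchy_derivative _ S z q (2 * q)) dm => // [|u /tri uq|u /tri uq].
  - by lra.
  - by apply: dS; lra.
  - by apply: dH; lra.
rewrite [S a]slope_at in zs.
have h : cabs ((z - a) * m) <= e / 2.
  rewrite cabsM; rewrite ltr_pdivlMr in ze; last by lra.
  by have := cabs_ge0 (z - a); nra.
have := cabsD (S z - f' a) ((z - a) * m).
have -> : S z - f' a + (z - a) * m = S z + (z - a) * m - f' a by ring.
lra.
Qed.

Lemma derivative_cdiff (f f' : C -> C) a r : 0 < r ->
  (forall z, cabs (z - a) < r -> cdiff f z (f' z)) -> exists m, cdiff f' a m.
Proof.
move=> r0 df; have aa : cabs (a - a) < r by rewrite subrr cabs0.
pose S := slope f a (f' a).
have dS z : exists m, cabs (z - a) < r -> cdiff S z m.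
  have [zr|] := pselect (cabs (z - a) < r); last by exists 0.
  have [->|/eqP za] := eqVneq z a.
    have [|m dm] := @slope_diff_center f a r (f' a) r0 _ (df a aa); last by exists m.
    by move=> w wr; exists (f' w); exact: df.
  have [|m dm] := @slope_diff _ f a (f' a) z za; last by exists m.
  by exists (f' z); exact: df.
have [S' S'P] := choice dS.
have S'c : ccont S' a by exact: (@ccont_derivative S S' a r).
exists (S' a + S' a).
(* The same formula as in [ccont_derivative], now with S' known to be continuous, in slope form: the
   bracket is continuous at [a]. *)
have H : cdiff (fun z => f' a + (z - a) * (slope S a (S' a) z + S' z)) a (S' a + S' a).
  exists (fun z => slope S a (S' a) z + S' z); split.
  - by move=> w; rewrite subrr mul0r addr0.
  - by rewrite slope_at.
  - by apply: ccontD => //; apply/cdiff_slope; exact: S'P.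
apply: cdiff_near H; apply/nbhs_cabsP; exists r => // w wr.
rewrite (derivative_slopeE (df a aa) (df w wr) (S'P w wr)) -/S (slopeE S a (S' a) w).
by rewrite [S a]slope_at; ring.
Qed.

End RemovableSingularities.

(** * Holomorphic logarithms and Bloch's theorem *)

Section BlochSchottky.
Context {R : realType}.
Local Notation C := (Cplx R).
Implicit Types (z w a c l v : C) (r s M : R) (F G : C -> C).

Lemma segment_in_disc c z s (t : R) : cabs (z - c) < s -> 0 <= t <= 1 ->
  cabs (c + rc t * (z - c) - c) < s.
Proof.
move=> zs /andP[t0 t1]; rewrite addrAC subrr add0r cabsM cabs_rc ger0_norm //.
by apply: le_lt_trans zs; rewrite ler_piMl ?cabs_ge0.
Qed.

Lemma mean_value_disc F F' c s M : (forall z, cabs (z - c) < s -> cdiff F z (F' z)) ->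
  (forall z, cabs (z - c) < s -> cabs (F' z) <= M) ->
  forall z, cabs (z - c) < s -> cabs (F z - F c) <= M * cabs (z - c).
Proof.
move=> dF FM z zs; apply: (@mean_value_segment _ F F' c z M) => t t01.
  by apply: dF; exact: segment_in_disc.
by apply: FM; exact: segment_in_disc.
Qed.

Lemma holomorphic_derivative F (U : set C) : (forall z, U z -> exists l, cdiff F z l) ->
  exists F', forall z, U z -> cdiff F z (F' z).
Proof.
move=> dF; have [z|F' H] := @choice _ _ (fun z l => U z -> cdiff F z l); last by exists F'.
by have [/dF[l]|] := pselect (U z); [exists l|exists 0].
Qed.

Lemma disc_in_disc z c w s r : cabs (z - c) < s -> cabs (w - z) < s - cabs (z - c) ->
  cabs (w - c) < s.
Proof. by have := cabsD (w - z) (z - c); rewrite addrA subrK; lra. Qed.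

(* A primitive [P] of [F'/F] makes [F * cexp (- P)] constant. *)
Lemma holomorphic_log F c s w : 0 < s ->
  (forall z, cabs (z - c) < s -> exists l, cdiff F z l) ->
  (forall z, cabs (z - c) < s -> F z != 0) -> cexp w = F c ->
  exists2 L, L c = w & forall z, cabs (z - c) < s / 2 ->
    (exists l, cdiff L z l) /\ cexp (L z) = F z.
Proof.
move=> s0 dF F0 wc; have [F' dF'] := holomorphic_derivative dF.
have s2 : 0 < s / 2 by lra.
have [z [zx zy]|P dP] := @square_primitive _ (fun z => F' z / F z) c (s / 2) s2.
  (* The square of half-side s / 2 lies in the disc, its half-diagonal being s / sqrt 2. *)
  have zc : cabs (z - c) < s.
    rewrite -(ltr_pXn2r (n := 2)) ?nnegrE ?cabs_ge0 ?(ltW s0) // cabs_sqr.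
    rewrite -[X in X + _]real_normK ?num_real // -[X in _ + X < _]real_normK ?num_real //.
    have h (x : R) : 0 <= x -> x <= s / 2 -> x ^+ 2 <= s ^+ 2 / 4 by move=> *; nra.
    have := h _ (normr_ge0 _) zx; have := h _ (normr_ge0 _) zy.
    have : 0 < s ^+ 2 by rewrite exprn_gt0.
    lra.
  have d0 : 0 < s - cabs (z - c) by rewrite subr_gt0.
  have [u uz|m dm] := @derivative_cdiff _ F F' z _ d0.
    by apply: dF'; exact: disc_in_disc uz.
  by exists ((m * F z - F' z * F' z) / F z ^+ 2); apply: cdiff_div; [exact: F0|exact: dm|exact: dF'].
have {}dP z : cabs (z - c) < s / 2 -> cdiff P z (F' z / F z).
  by move=> zc; apply: dP; apply: le_lt_trans zc; [exact: abs_Re_le|exact: abs_Im_le].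
pose E z := F z * cexp (- P z).
have dE z : cabs (z - c) < s / 2 -> cdiff E z 0.
  move=> zc; have zs : cabs (z - c) < s by lra.
  have dcP := @cdiff_comp _ (fun v => - P v) cexp z _ _ (cdiffN (dP z zc)) (cdiff_cexp _).
  apply: cdiff_eq (cdiffM (dF' z zs) dcP) => //; have := F0 z zs => Fz.
  by field.
have cc : cabs (c - c) < s / 2 by rewrite subrr cabs0.
exists (fun z => P z - P c + w) => [|z zc]; first by rewrite subrr add0r.
have zs : cabs (z - c) < s by lra.
split.
  exists (F' z / F z - 0 + 0).
  exact: cdiffD (cdiffB (dP z zc) (cdiff_cst _ _)) (cdiff_cst _ _).
have := @mean_value_disc E (fun=> 0) c (s / 2) 0 dE _ z zc.
rewrite mul0r => /(_ _)/wrap[v _|H]; first by rewrite cabs0.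
have EE : E z = E c.
  by apply/eqP; rewrite -subr_eq0 -cabs_eq0 eq_le cabs_ge0 andbT.
rewrite cexpD cexpB wc; move: EE; rewrite /E !cexpN => EE.
have p1 := cexp_neq0 (P z); have p2 := cexp_neq0 (P c).
apply: (mulIf (invr_neq0 p1)); rewrite EE; field.
by rewrite p1 p2.
Qed.

Lemma max_modulus_circle F c r s M : 0 < r -> r < s -> 0 <= M ->
  (forall z, cabs (z - c) < s -> exists l, cdiff F z l) ->
  (forall z, cabs (z - c) = r -> cabs (F z) <= M) ->
  forall z, cabs (z - c) <= r -> cabs (F z) <= M.
Proof.
move=> r0 rs M0 dF FM z zr.
apply: (@max_modulus _ F [set w | cabs (w - c) <= r] [set w | cabs (w - c) = r] _ (r + cabs c) M0) => //.
- exact: compact_disc.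
- by move=> w /= wr; have := cabsD (w - c) c; rewrite subrK; lra.
- by move=> w /= wr; have [|l dl] := dF w; [exact: le_lt_trans rs|exact: cdiff_cont dl].
- by move=> w /= _; exact: FM.
- move=> w /= wr /eqP wr'; have {}wr : cabs (w - c) < r by rewrite lt_neqAle wr'.
  exists (r - cabs (w - c)); first by rewrite subr_gt0.
  move=> v /andP[_ vw]; have vr := disc_in_disc r wr vw.
  by split; [exact: ltW|apply: dF; exact: lt_trans rs].
Qed.

(** The hypothesis of Bloch's theorem in contrapositive form: the image contains no closed disc of
    radius [rho]. *)
Definition omits_net (U : set C) G (rho : R) :=
  forall w, exists2 v, cabs (v - w) <= rho & forall z, U z -> G z <> v.

(* Bloch's theorem, after Landau and Estermann: at a maximum point [a] of
   [(r - |z - c|) |G' z|] the derivative is at most doubled on a disc around [a]. *)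
Lemma bloch_derivative G G' c r s (rho : R) : 0 < r -> r < s -> 0 < rho ->
  (forall z, cabs (z - c) < s -> cdiff G z (G' z)) ->
  omits_net [set z | cabs (z - c) < s] G rho -> r * cabs (G' c) <= 128 * rho.
Proof.
move=> r0 rs rho0 dG omit.
have G'c z : cabs (z - c) < s -> ccont G' z.
  move=> zs; apply: (@ccont_derivative _ G G' z (s - cabs (z - c))); first by rewrite subr_gt0.
  by move=> w wz; apply: dG; exact: disc_in_disc wz.
pose H z : C := rc (r - cabs (z - c)) * G' z.
have [||a /= ar amax] := @cabs_attains_max _ H [set z | cabs (z - c) <= r] _ (@compact_disc _ c r) _.
- by exists c; rewrite /= subrr cabs0 ltW.
- move=> z /= zr; apply: ccontM; last by apply: G'c; exact: le_lt_trans rs.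
  move=> e e0; exists e => // w wz; rewrite -rcB cabs_rc.
  have -> : r - cabs (w - c) - (r - cabs (z - c)) = - (cabs (w - c) - cabs (z - c)) by ring.
  rewrite normrN; apply: le_lt_trans (cabs_triangle _ _) _.
  by have -> : w - c - (z - c) = w - z by ring.
have muE z : cabs (z - c) <= r -> cabs (H z) = (r - cabs (z - c)) * cabs (G' z).
  by move=> zr; rewrite cabsM cabs_rc ger0_norm // subr_ge0.
have cr : cabs (c - c) <= r by rewrite subrr cabs0 ltW.
have := amax c cr; rewrite !muE // subrr cabs0 subr0.
set d := cabs (G' a) => mc.
have [d0|d0] := eqVneq d 0; first by rewrite d0 mulr0 in mc; lra.
have {}d0 : 0 < d by rewrite lt_neqAle eq_sym d0 cabs_ge0.
apply: le_trans mc _.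
have [->|ar'] := eqVneq (cabs (a - c)) r; first by rewrite subrr mul0r; lra.
have {}ar : cabs (a - c) < r by rewrite lt_neqAle ar'.
pose s1 := (r - cabs (a - c)) / 2.
have s10 : 0 < s1 by rewrite divr_gt0 // subr_gt0.
have in_r z : cabs (z - a) < s1 -> r - cabs (z - c) >= s1.
  by have := cabsD (z - a) (a - c); rewrite addrA subrK /s1; lra.
have in_s z : cabs (z - a) < s1 -> cabs (z - c) < s by move=> /in_r; lra.
have G'2d z : cabs (z - a) < s1 -> cabs (G' z) <= 2 * d.
  move=> /in_r zr; have zr' : cabs (z - c) <= r by lra.
  have := amax z zr'; rewrite !muE ?(ltW ar) // -/d.
  have -> : r - cabs (a - c) = 2 * s1 by rewrite /s1; field.
  have := cabs_ge0 (G' z); nra.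
have aa : cabs (a - a) < s1 by rewrite subrr cabs0.
have da := dG a (in_s _ aa).
pose S := slope G a (G' a).
have dS z : cabs (z - a) < s1 -> exists m, cdiff S z m.
  move=> zr; have [->|/eqP za] := eqVneq z a.
    apply: (@slope_diff_center _ _ _ s1) => // w wr.
    by exists (G' w); apply: dG; exact: in_s.
  by apply: slope_diff => //; exists (G' z); apply: dG; exact: in_s.
have S2d z : cabs (z - a) < s1 -> cabs (S z) <= 2 * d.
  move=> zr; have [->|/eqP za] := eqVneq z a; first by rewrite /S slope_at -/d; lra.
  rewrite cabs_slope // ler_pdivrMr ?cabs_gt0 ?subr_eq0; last exact/eqP.
  apply: (@mean_value_disc G G' a s1 (2 * d)) => // w wr.
  by apply: dG; exact: in_s.
have s12 : 0 < s1 / 2 by lra.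
have s12' : s1 / 2 < s1 by lra.
have d20 : 0 <= 2 * d by lra.
have lipS := lipschitz_disc s12 s12' d20 dS S2d.
(* On the circle of this radius the slope is within d / 2 of [G' a], so |G - G a| >= t d / 2. If t d
   / 4 > rho, an omitted value v within [rho] of [G a] would make 1 / (G - v) larger at the centre
   than on the circle. *)
pose t := s1 / 16.
have t0 : 0 < t by rewrite divr_gt0.
have far z : cabs (z - a) = t -> t * d / 2 <= cabs (G z - G a).
  move=> zt; have := lipS z; rewrite zt [S a]slope_at => /(_ _)/wrap[|h].
    by rewrite /t; lra.
  rewrite (slopeE G a (G' a) z) addrAC subrr add0r cabsM zt -/S -mulrA ler_pM2l //.
  have E : 2 * (2 * d) / (s1 / 2) * t = d / 2 by rewrite /t; field; lra.
  rewrite E in h; have := cabsD (G' a - S z) (S z).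
  by rewrite subrK (cabsB (G' a)) -/d; lra.
suff key : t * d / 4 <= rho.
  have -> : r - cabs (a - c) = 32 * t by rewrite /t /s1; field.
  lra.
rewrite leNgt; apply/negP => small.
have [v vG vom] := omit (G a).
have Gv z : cabs (z - a) < s1 -> G z - v != 0.
  by move=> /in_s zs; rewrite subr_eq0; apply/eqP; exact: vom.
have td : 0 < t * d by rewrite mulr_gt0.
have M0 : 0 <= (t * d / 4)^-1 by rewrite invr_ge0; lra.
have ts : t < s1 by rewrite /t; lra.
have := @max_modulus_circle (fun z => (G z - v)^-1) a t s1 _ t0 ts M0.
move=> /(_ _ _ a)/wrap[z zr|z zt|].
- have dz := cdiffB (dG z (in_s _ zr)) (cdiff_cst z v).
  by exists (- (G' z - 0) / (G z - v) ^+ 2); exact: (@cdiffV _ (fun u => G u - v) z _ (Gv z zr) dz).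
- rewrite cabsV lef_pV2 ?posrE; first last.
  + by lra.
  + by rewrite cabs_gt0; apply: Gv; rewrite zt.
  have := far z zt; have := cabsD (G z - v) (v - G a); rewrite addrA subrK; lra.
rewrite subrr cabs0 => /(_ (ltW t0)); rewrite cabsV lef_pV2 ?posrE.
- by rewrite cabsB; lra.
- by rewrite cabs_gt0; exact: Gv.
- by lra.
Qed.

(** Discs of radius s / 2 about points of the inner disc give |G'| <= 256 rho / s there; over a
    distance s / 4 this amounts to 64 rho. *)
Lemma bloch_oscillation G c s (rho : R) : 0 < s -> 0 < rho ->
  (forall z, cabs (z - c) < s -> exists l, cdiff G z l) ->
  omits_net [set z | cabs (z - c) < s] G rho ->
  forall z, cabs (z - c) < s / 4 -> cabs (G z - G c) <= 64 * rho.
Proof.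
move=> s0 rho0 dG omit z zc; have [G' dG'] := holomorphic_derivative dG.
have bd u : cabs (u - c) < s / 4 -> cabs (G' u) <= 256 * rho / s.
  move=> uc; rewrite ler_pdivlMr //.
  have sub v : cabs (v - u) < 3 * s / 4 -> cabs (v - c) < s.
    by have := cabsD (v - u) (u - c); rewrite addrA subrK; lra.
  have := @bloch_derivative G G' u (s / 2) (3 * s / 4) rho.
  have -> : s / 2 * cabs (G' u) = cabs (G' u) * s / 2 by field.
  move=> H; suff : cabs (G' u) * s / 2 <= 128 * rho by lra.
  apply: H; [lra|lra|by []|by move=> v /sub/dG'|].
  by move=> w; have [v vw vG] := omit w; exists v => // y /sub; exact: vG.
have s4 : 0 < s / 4 by lra.
have := @mean_value_disc G G' c (s / 4) _ _ bd z zc.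
move=> /(_ _)/wrap[u uc|H]; first by apply: dG'; lra.
apply: le_trans H _.
have -> : 64 * rho = 256 * rho / s * (s / 4) by field; lra.
have h0 : 0 <= 256 * rho / s by apply: divr_ge0; lra.
exact: ler_wpM2l h0 _ _ (ltW zc).
Qed.

End BlochSchottky.

(** * Schottky's theorem *)

Section Schottky.
Context {R : realType}.
Local Notation C := (Cplx R).
Implicit Types (z w c v : C).

Lemma cexp_2pi_int (k : int) : cexp (cx 0 (2 * pi * k%:~R) : C) = 1.
Proof.
have E n : cexp (cx 0 (2 * pi * n%:R) : C) = 1.
  have -> : cx 0 (2 * pi * n%:R) = n%:R * cx 0 (2 * pi) :> C.
    by rewrite -rc_nat; apply: c_ext; rewrite !cReImE; ring.
  by rewrite cexpMn cexp_2pi_i expr1n.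
case: k => n; first exact: E.
have -> : cx 0 (2 * pi * (Negz n)%:~R) = - cx 0 (2 * pi * n.+1%:R) :> C.
  by apply: c_ext; rewrite !cReImE ?oppr0 // NegzE mulrNz pmulrn; ring.
by rewrite cexpN E invr1.
Qed.

Lemma exists_int_near (y p : R) : 0 < p -> exists k : int, `|p * k%:~R - y| <= p.
Proof.
move=> p0; exists (Num.floor (y / p)).
have := floor_itv (y / p); set k := Num.floor _.
rewrite ler_pdivlMr // ltr_pdivrMr // rmorphD /= mulrDl mul1r => /andP[h1 h2].
by rewrite ler_norml; apply/andP; split; lra.
Qed.

(* The points where [cosh] is an odd positive integer: [arccosh (2 m + 1)] grows
   logarithmically, so consecutive ones are at bounded distance. *)
Lemma cosh_odd_net w : exists2 v, cabs (v - w) <= ln 3 + 2 * pi &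
  exists m : nat, cexp v + cexp (- v) = 2 * (2 * m + 1)%N%:R.
Proof.
have ln3 : 0 <= ln 3 :> R by rewrite ln_ge0 //; lra.
have pos (x : R) : 0 <= x -> exists u, `|u - x| <= ln 3 /\
    exists m : nat, expR u + expR (- u) = 2 * (2 * m + 1)%N%:R :> R.
  move=> x0; have E1 : 1 <= expR x by rewrite -(expR0 R) ler_expR.
  have h0 : 0 <= (expR x - 1) / 2 by lra.
  pose m := Num.truncn ((expR x - 1) / 2).
  have := truncn_itv h0; rewrite -/m -[m.+1%:R]natr1 => /andP[m1 m2].
  pose n : R := 2 * m%:R + 1.
  have nE : (2 * m + 1)%N%:R = n :> R by rewrite natrD natrM.
  have m0 : 0 <= m%:R :> R by [].
  have n1 : 1 <= n by rewrite /n; lra.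
  (* Thus ln (n + q) is arccosh n. Since n <= exp x < n + 2 and n <= n + q <= 2 n with n >= 1, it
     lies within ln 3 of [x]. *)
  pose q := Num.sqrt (n ^+ 2 - 1).
  have n2 : 0 <= n ^+ 2 - 1 by nra.
  have q2 : q ^+ 2 = n ^+ 2 - 1 by rewrite sqr_sqrtr.
  have q0 : 0 <= q by rewrite sqrtr_ge0.
  have qn : q <= n by rewrite -(ler_pXn2r (n := 2)) ?nnegrE ?q2 //; lra.
  have b0 : 0 < n + q by lra.
  exists (ln (n + q)); split.
    have xl : x = ln (expR x) by rewrite expRK.
    have t0 : (0 : R) < 3 by [].
    rewrite ler_norml {1 2}xl; apply/andP; split.
      rewrite lerBrDl -[X in _ <= X]addr0 -(subrr (ln 3)) addrA lerD2r addrC.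
      rewrite -lnM ?posrE // ler_ln ?posrE ?expR_gt0 ?mulr_gt0 //.
      by move: m2; rewrite /n; lra.
    rewrite lerBlDl -lnM ?posrE ?expR_gt0 // ler_ln ?posrE ?mulr_gt0 ?expR_gt0 //.
    by rewrite /n in qn *; lra.
  exists m; rewrite nE expRN lnK ?posrE //.
  have -> : (n + q)^-1 = n - q.
    apply: (mulfI (lt0r_neq0 b0)); rewrite divff ?lt0r_neq0 //.
    by rewrite mulrDl !mulrBr [q * n]mulrC -!expr2 q2; ring.
  ring.
(* Evenness of cosh reduces negative real parts to positive ones; its period 2 pi i then adjusts the
   imaginary part. *)
have [u [ux [m um]]] : exists u, `|u - cRe w| <= ln 3 /\
    exists m : nat, expR u + expR (- u) = 2 * (2 * m + 1)%N%:R :> R.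
  have [/pos//|x0] := leP 0 (cRe w).
  have [|u [ux [m um]]] := pos (- cRe w); first by lra.
  exists (- u); split; last by exists m; rewrite opprK addrC.
  by rewrite -opprD normrN addrC -[cRe w]opprK addrC.
have p0 : 0 < 2 * pi :> R by rewrite mulr_gt0 // pi_gt0.
have [k kP] := exists_int_near (cIm w) p0.
pose v := rc u + cx 0 (2 * pi * k%:~R) : C.
have vE : v = cx u (2 * pi * k%:~R) by apply: c_ext; rewrite /v !cReImE; ring.
have e1 : cexp v = rc (expR u).
  rewrite /v cexpD cexp_2pi_int mulr1; apply: c_ext; rewrite /cexp !cReImE ?cos0 ?sin0; ring.
exists v.
  apply: le_trans (cabs_le_ReIm _) _; rewrite vE !cReImE.
  exact: lerD.
exists m; rewrite cexpN e1 -rcV -expRN -rcD um rcM !rc_nat //.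
Qed.

(** Here ln 3 + 2 pi is the radius of the net of [cosh_odd_net], 5 bounds |exp H| and |exp (- H)| at
    the centre, and the exponential inside is their possible growth by Bloch's theorem; pi (|chi| +
    1) then bounds log |phi|. *)
Definition schottky_const : R :=
  expR (pi * (5 * expR (64 * (ln 3 + 2 * pi)) + 1)).

(* [phi = exp (pi i (1 + cosh H))], where [H] omits the net [cosh_odd_net]
   because [phi] omits [1]. *)
Lemma schottky (phi : C -> C) c (s : R) : 0 < s ->
  (forall z, cabs (z - c) < s -> exists l, cdiff phi z l) ->
  (forall z, cabs (z - c) < s -> phi z != 0) ->
  (forall z, cabs (z - c) < s -> phi z != 1) -> cabs (phi c) = 1 ->
  forall z, cabs (z - c) < s / 32 -> cabs (phi z) <= schottky_const.
Proof.
move=> s0 dphi phi0 phi1 phic.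
have ss (t : R) z : 1 <= t -> cabs (z - c) < s / t -> cabs (z - c) < s.
  move=> t1 h; apply: lt_le_trans h _; rewrite ler_pdivrMr; last by lra.
  by rewrite ler_peMr // ltW.
have cc (t : R) : 0 < t -> cabs (c - c) < t by move=> ?; rewrite subrr cabs0.
have [w0 [w0c w0r w0i]] := exists_clog (phi0 c (cc _ s0)).
have [L Lc dL] := holomorphic_log s0 dphi phi0 w0c.
have s2 : 0 < s / 2 by lra.
have pi0 : 0 < pi :> R := pi_gt0 R.
(* The inverse of pi i, so that phi = exp (pi i (chi + 1)) and [chi] omits odd integers because
   [phi] omits 1. *)
pose k : C := cx 0 (- pi^-1).
have kP : k * cx 0 pi = 1.
  by apply: c_ext; rewrite /k !cReImE; field; lra.
pose chi z := k * L z - 1.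
have LE z : L z = cx 0 pi * (chi z + 1).
  by rewrite /chi subrK mulrA [_ * k]mulrC kP mul1r.
have odd_omit z (m : nat) : cabs (z - c) < s / 2 -> chi z + 1 <> 2 * m%:R.
  move=> zs E; have := phi1 z; have [_ <-] := dL z zs.
  rewrite LE E; have -> : cx 0 pi * (2 * m%:R) = m%:R * cx 0 (2 * pi) :> C.
    by rewrite -!rc_nat; apply: c_ext; rewrite !cReImE; ring.
  by rewrite cexpMn cexp_2pi_i expr1n eqxx => /(_ _)/wrap[|//]; apply: ss zs; lra.
have dchi z : cabs (z - c) < s / 2 -> exists l, cdiff chi z l.
  move=> /dL[[l dl] _]; exists (k * l - 0).
  exact: cdiffB (cdiffZ _ dl) (cdiff_cst _ _).
(* As [chi] omits 1 and -1, this has no zeros and so has a square root [q]; chi + q has inverse chi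
   - q, so writing it as exp H makes chi = cosh H. *)
pose g z := chi z * chi z - 1.
have dg z : cabs (z - c) < s / 2 -> exists l, cdiff g z l.
  move=> /dchi[l dl]; exists (l * chi z + chi z * l - 0).
  exact: cdiffB (cdiffM dl dl) (cdiff_cst _ _).
have g0 z : cabs (z - c) < s / 2 -> g z != 0.
  move=> zs; have -> : g z = (chi z + 1 - 2 * 1%:R) * (chi z + 1 - 2 * 0%:R).
    by rewrite /g; ring.
  by rewrite mulf_neq0 // subr_eq0; apply/eqP; exact: odd_omit.
have [w1 [w1c _ _]] := exists_clog (g0 c (cc _ s2)).
have [Q _ dQ] := holomorphic_log s2 dg g0 w1c.
pose q z := cexp (Q z / 2).
have s4 : 0 < s / 2 / 2 by lra.
have q2 z : cabs (z - c) < s / 2 / 2 -> q z * q z = g z.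
  by move=> /dQ[_ <-]; rewrite /q -cexpD; congr cexp; field.
pose h z := chi z + q z.
have dh z : cabs (z - c) < s / 2 / 2 -> exists l, cdiff h z l.
  move=> zs; have [[l dl] _] := dQ z zs.
  have [m dm] : exists m, cdiff chi z m by apply: dchi; lra.
  have dl2 : cdiff (fun v => Q v / 2) z (l / 2).
    by apply: cdiff_eq (cdiffZ 2^-1 dl) => [v|]; rewrite mulrC.
  by exists (m + cexp (Q z / 2) * (l / 2)); exact: cdiffD dm (cdiff_comp dl2 (cdiff_cexp _)).
have hV z : cabs (z - c) < s / 2 / 2 -> h z * (chi z - q z) = 1.
  move=> zs; have -> : h z * (chi z - q z) = chi z * chi z - q z * q z by rewrite /h; ring.
  by rewrite q2 // /g; ring.
have h0 z : cabs (z - c) < s / 2 / 2 -> h z != 0.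
  by move=> /hV; apply: contra_eqN => /eqP ->; rewrite mul0r eq_sym oner_eq0.
have [w2 [w2c w2r _]] := exists_clog (h0 c (cc _ s4)).
have [H Hc dH] := holomorphic_log s4 dh h0 w2c.
have s8 : 0 < s / 2 / 2 / 2 by lra.
have HN z : cabs (z - c) < s / 2 / 2 / 2 -> cexp (- H z) = chi z - q z.
  move=> zs; rewrite cexpN (dH z zs).2.
  have zs' : cabs (z - c) < s / 2 / 2 by lra.
  by apply: (mulfI (h0 z zs')); rewrite divff ?h0 // hV.
have chiE z : cabs (z - c) < s / 2 / 2 / 2 -> cexp (H z) + cexp (- H z) = 2 * chi z.
  by move=> zs; rewrite HN // (dH z zs).2 /h; ring.
pose rho : R := ln 3 + 2 * pi.
have rho0 : 0 < rho.
  have : 0 <= ln 3 :> R by rewrite ln_ge0 //; lra.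
  by rewrite /rho; lra.
have omitH : omits_net [set z | cabs (z - c) < s / 2 / 2 / 2] H rho.
  move=> w; have [v vw [m vm]] := cosh_odd_net w; exists v => // z /= zs Hv.
  have := chiE z zs; rewrite Hv vm => /(mulfI _)/wrap[|E]; first by rewrite pnatr_eq0.
  apply: (@odd_omit z m.+1); first by lra.
  by rewrite -E natrD natrM -natr1; ring.
have osc := bloch_oscillation s8 rho0 (fun z zs => (dH z zs).1) omitH.
(* Since |phi c| = 1, its chosen logarithm is imaginary of modulus at most pi; this starts the
   bounds at the centre. *)
have chic : cabs (chi c) <= 2.
  have Lpi : cabs (L c) <= pi.
    rewrite Lc; apply: le_trans (cabs_le_ReIm _) _.
    by rewrite w0r phic ln1 normr0 add0r.
  have := cabsD (k * L c) (- 1); rewrite cabsN cabs1 cabsM -/(chi c).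
  have -> : cabs k = pi^-1.
    rewrite cabs_sqrt !cReImE expr0n add0r sqrrN sqrtr_sqr gtr0_norm ?invr_gt0 //.
  have : pi^-1 * cabs (L c) <= 1 by rewrite mulrC ler_pdivrMr // mul1r.
  lra.
have qc : cabs (q c) <= 3.
  rewrite -(ler_pXn2r (n := 2)) ?nnegrE ?cabs_ge0 // expr2 -cabsM q2 ?cc //.
  have := cabsD (chi c * chi c) (- 1); rewrite cabsN cabs1 cabsM -/(g c).
  by have := cabs_ge0 (chi c); nra.
have hc1 : cabs (cexp (H c)) <= 5.
  by rewrite (dH c (cc _ s8)).2; have := cabsD (chi c) (q c); rewrite -/(h c); lra.
have hc2 : cabs (cexp (- H c)) <= 5.
  by rewrite HN ?cc //; have := cabsD (chi c) (- q c); rewrite cabsN; lra.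
move=> z zs; have zs8 : cabs (z - c) < s / 2 / 2 / 2 by lra.
have zs2 : cabs (z - c) < s / 2 by lra.
(* Three logarithms have each halved the radius, and Bloch's theorem divides it by 4: hence s /
   32. *)
have := osc z; rewrite (_ : s / 2 / 2 / 2 / 4 = s / 32); last by field.
move=> /(_ zs) Hz.
have hz1 : cabs (cexp (H z)) <= 5 * expR (64 * rho).
  have -> : H z = H c + (H z - H c) by ring.
  rewrite cexpD cabsM ler_pM ?cabs_ge0 // cabs_cexp ler_expR.
  by apply: le_trans (ler_norm _) _; exact: le_trans (abs_Re_le _) Hz.
have hz2 : cabs (cexp (- H z)) <= 5 * expR (64 * rho).
  have -> : - H z = - H c + (H c - H z) by ring.
  rewrite cexpD cabsM ler_pM ?cabs_ge0 // cabs_cexp ler_expR.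
  by apply: le_trans (ler_norm _) _; apply: le_trans (abs_Re_le _) _; rewrite cabsB.
have chiz : cabs (chi z) <= 5 * expR (64 * rho).
  have : cabs (2 * chi z) <= 2 * (5 * expR (64 * rho)).
    by rewrite -chiE //; apply: le_trans (cabsD _ _) _; lra.
  by rewrite cabsM -rc_nat cabs_rc gtr0_norm // ler_pM2l.
have [_ <-] := dL z zs2; rewrite cabs_cexp ler_expR.
apply: le_trans (ler_norm _) _; apply: le_trans (abs_Re_le _) _.
rewrite LE cabsM.
have -> : cabs (cx 0 pi : C) = pi.
  by rewrite cabs_sqrt !cReImE expr0n add0r sqrtr_sqr gtr0_norm.
rewrite ler_wpM2l ?(ltW pi0) //; have := cabsD (chi z) 1; rewrite cabs1 -/rho; lra.
Qed.

End Schottky.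

(** * Growth near an essential singularity *)

Section EssentialSingularities.
Context {R : realType}.
Local Notation C := (Cplx R).
Implicit Types (z w : C) (g u h : C -> C).

Lemma near_puncturedP (a : C) (P : C -> Prop) (r : R) : 0 < r ->
  (forall z, 0 < cabs (z - a) < r -> P z) -> \forall z \near a^', P z.
Proof.
move=> r0 H; rewrite near_withinE /=; apply/nbhs_cabsP; exists r => // z zr za.
by apply: H; rewrite zr andbT cabs_gt0 subr_eq0.
Qed.

Lemma removable_of_eq g h (r : R) : 0 < r ->
  (forall z, cabs z < r -> exists l, cdiff h z l) ->
  (forall z, 0 < cabs z < r -> g z = h z) -> removable_singularity g 0.
Proof.
move=> r0 dh gh; exists h; split.
  by apply/nbhs_cabsP; exists r => // z; rewrite subr0 => /dh/derivable_cdiff.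
by apply: (near_puncturedP r0) => z; rewrite subr0 => /gh.
Qed.

(** Neighbourhoods of infinity in the one-point compactification are given by complements of compact
    sets, which are bounded. *)
Lemma pole_of_unbounded g : (forall M : R, exists2 d : R, 0 < d &
  forall z, 0 < cabs z < d -> M < cabs (g z)) -> pole g 0.
Proof.
move=> H A [K [cK _] KA].
have [M KM] : exists M : R, forall z, K z -> cabs z <= M.
  have [[z0 Kz0]|K0] := pselect (K !=set0); last first.
    by exists 0 => z Kz; case: K0; exists z.
  have [|z1 _ z1P] := @cabs_attains_max _ (fun z => z) K (ex_intro _ z0 Kz0) cK.
    by move=> z _; exact: ccont_id.
  by exists (cabs z1).
have [d d0 dM] := H M.
apply: (@near_puncturedP 0 (fun z => A (to_sphere (g z))) d d0) => z; rewrite subr0 => /dM zM.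
apply: KA; left; exists (g z) => // /KM; rewrite leNgt zM //.
Qed.

(* If [|u|] is polynomially bounded on arbitrarily small circles, then
   [z ^ N * u] extends holomorphically; its zero at 0 has finite order. *)
Lemma moderate_form u (N : nat) :
  (forall z, z != 0 -> u z != 0) -> (forall z, z != 0 -> exists l, cdiff u z l) ->
  (forall d : R, 0 < d -> exists2 rho : R, 0 < rho < d &
     forall z, cabs z = rho -> cabs (z ^+ N * u z) <= 1) ->
  exists m h (r : R), [/\ 0 < r, forall z, cabs z < r -> exists l, cdiff h z l,
    h 0 != 0 & forall z, 0 < cabs z < r -> u z * z ^+ N = h z * z ^+ m].
Proof.
move=> u0 du small; pose v z := z ^+ N * u z.
have dv z : z != 0 -> exists l, cdiff v z l.
  move=> /du[l dl]; exists (N%:R * z ^+ N.-1 * u z + z ^+ N * l).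
  exact: cdiffM (cdiffX _ _) dl.
have v0 z : z != 0 -> v z != 0 by move=> z0; rewrite mulf_neq0 ?expf_neq0 // u0.
pose annulus (a b : R) : set C := [set z | a <= cabs z <= b].
have cA a b : compact (annulus a b).
  apply: (@compact_bounded _ _ b) => [z /andP[]//|z H]; apply/andP; split.
    rewrite leNgt; apply/negP => za; have [|w /andP[wa _] wz] := H (a - cabs z).
      by rewrite subr_gt0.
    by have := cabsD (w - z) z; rewrite subrK; lra.
  rewrite leNgt; apply/negP => za; have [|w /andP[_ wb] wz] := H (cabs z - b).
    by rewrite subr_gt0.
  by have := cabsD (z - w) w; rewrite subrK cabsB; lra.
have nz z (a : R) : 0 < a -> a <= cabs z -> z != 0.
  by move=> a0 az; rewrite -cabs_gt0 (lt_le_trans a0).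
have [||z1 _ z1P] := @cabs_attains_max _ v (annulus 1 1) _ (cA 1 1) _.
- by exists 1; rewrite /annulus /= cabs1 lexx.
- by move=> z /andP[z1 _]; have [|l dl] := dv z; [exact: nz ltr01 z1|exact: cdiff_cont dl].
pose B := Num.max 1 (cabs (v z1)).
have B1 : 1 <= B by rewrite le_max lexx.
(* The maximum principle on an annulus between a small circle where |v| <= 1, inside |z|, and the
   unit circle. *)
have vB z : 0 < cabs z <= 1 -> cabs (v z) <= B.
  move=> /andP[z0 zl1]; have [rho /andP[rho0 rhoz] rhoP] := small _ z0.
  apply: (@max_modulus _ v (annulus rho 1) [set w | cabs w = rho \/ cabs w = 1] B 1) => //.
  - by lra.
  - by move=> w /andP[].
  - by move=> w /andP[/(nz _ _ rho0)/dv[l dl] _]; exact: cdiff_cont dl.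
  - move=> w _ [/rhoP|w1]; first by move=> h; exact: le_trans h B1.
    by rewrite le_max z1P ?orbT // /annulus /= w1 lexx.
  - move=> w /andP[w1 w2] nB.
    have {}w1 : rho < cabs w by rewrite lt_neqAle w1 andbT; apply/eqP => E; case: nB; left.
    have {}w2 : cabs w < 1 by rewrite lt_neqAle w2 andbT; apply/eqP => E; case: nB; right.
    exists (Num.min (cabs w - rho) (1 - cabs w)); first by rewrite lt_min !subr_gt0 w1.
    move=> y /andP[_]; rewrite lt_min => /andP[y1 y2].
    have h1 := cabsD (y - w) w; have h2 := cabsD (w - y) y.
    rewrite !subrK (cabsB w y) in h1 h2.
    have yin : rho <= cabs y <= 1 by apply/andP; split; lra.
    by split => //; apply: dv; apply: (nz _ rho) => //; case/andP: yin.
  - by rewrite /annulus /= zl1 ltW.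
have [z|z|v1 [l1 dv1]] := @removable_bounded _ v 0 1 B ltr01.
- by rewrite subr0 => /andP[z0 _]; apply: dv; rewrite -cabs_gt0.
- by rewrite subr0 => /andP[z0 z1']; apply: vB; rewrite z0 ltW.
pose V z := if z == 0 then v1 else v z.
have VE z : z != 0 -> V z = v z by rewrite /V => /negbTE ->.
have dV z : cabs z < 1 -> exists l, cdiff V z l.
  move=> _; have [->|z0] := eqVneq z 0; first by exists l1.
  have [l dl] := dv z z0; exists l; apply: cdiff_near dl; apply/nbhs_cabsP.
  exists (cabs z); first by rewrite cabs_gt0.
  move=> w wz; rewrite VE //; apply/negP => /eqP w0.
  by move: wz; rewrite w0 sub0r cabsN ltxx.
pose P m h := (forall z, cabs z < 1 -> exists l, cdiff h z l) /\
  forall z, cabs z < 1 -> V z = h z * z ^+ m.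
have P0 : P 0%N V by split=> // z _; rewrite expr0 mulr1.
have PS m h : P m h -> h 0 = 0 -> exists h', P m.+1 h'.
  move=> [dh hE] h0; have [l dl] := dh 0 (eq_rect_r (fun x => x < 1) ltr01 cabs0).
  exists (slope h 0 l); split=> z z1'.
    have [->|/eqP z0] := eqVneq z 0.
      by apply: (@slope_diff_center _ _ _ 1) => // w; rewrite subr0 => /dh.
    by apply: slope_diff => //; exact: dh.
  by rewrite hE // {1}(slopeE h 0 l z) h0 add0r subr0 exprS; ring.
have [[m [h [[dh hE] h0]]]|none] := pselect (exists m h, P m h /\ h 0 != 0).
  exists m, h, 1; split=> // z /andP[z0 z1']; rewrite -hE // VE ?(mulrC (u z)) //.
  by rewrite -cabs_gt0.
have all_P m : exists h, P m h.
  elim: m => [|m [h Ph]]; first by exists V.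
  have [h0|h0] := eqVneq (h 0) 0; first exact: PS Ph h0.
  by case: none; exists m, h.
(* Were the zero of infinite order, V = h z^n with |h| <= B 2^n on |z| <= 1 / 2 would give |V z0| <=
   B / 2^n for every n >= 1, although [V z0] is not 0. *)
pose z0 : C := rc (1 / 4).
have cz0 : cabs z0 = 1 / 4 by rewrite cabs_rc gtr0_norm // divr_gt0.
have z00 : z0 != 0 by rewrite -cabs_gt0 cz0 divr_gt0.
have half0 : 0 < 1 / 2 :> R by rewrite divr_gt0.
have half1 : 1 / 2 < 1 :> R by rewrite ltr_pdivrMr // mul1r ltr1n.
have Vz0 : 0 < cabs (V z0) by rewrite cabs_gt0 VE ?v0.
have B0 : 0 <= B by lra.
have : 2 <= 1 :> R; last by lra.
apply: (@le_of_powers _ _ _ _ _ ler01 Vz0 B0) => n; rewrite expr1n mul1r.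
have [h [dh hE]] := all_P n.+1.
have c0 w : cabs (w - 0) = cabs w by rewrite subr0.
have BM : 0 <= B * 2 ^+ n.+1 by rewrite mulr_ge0 // exprn_ge0.
have hz0 : cabs (h z0) <= B * 2 ^+ n.+1.
  apply: (@max_modulus_circle _ h 0 (1 / 2) 1 _ half0 half1 BM) => [z|z|].
  - by rewrite c0 => /dh.
  - rewrite c0 => zr; have z1' : cabs z < 1 by rewrite zr.
    have := @vB z; rewrite -VE; last by rewrite -cabs_gt0 zr.
    rewrite hE // cabsM cabsX zr half0 (ltW half1) => /(_ isT) hB.
    rewrite -(ler_pM2r (x := (1 / 2) ^+ n.+1)) ?exprn_gt0 // -mulrA -exprMn.
    by rewrite (_ : 2 * (1 / 2) = 1) ?expr1n ?mulr1 //; field.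
  - by rewrite c0 cz0 ler_pdivlMr //; lra.
rewrite hE ?cz0 ?ltr_pdivrMr // ?mul1r ?ltr1n // cabsM cabsX cz0.
rewrite mulrCA -exprMn (_ : 2 * (1 / 4) = 1 / 2); last by field.
apply: le_trans (ler_wpM2r _ hz0) _; first by rewrite exprn_ge0 // ltW.
by rewrite -mulrA -exprMn (_ : 2 * (1 / 2) = 1) ?expr1n ?mulr1 //; field.
Qed.

(** Near 0, u = h z^(m - N) with h 0 nonzero: the sign of m - N decides. *)
Lemma removable_or_pole_of_form u h (N m : nat) (r : R) : 0 < r ->
  (forall z, cabs z < r -> exists l, cdiff h z l) -> h 0 != 0 ->
  (forall z, 0 < cabs z < r -> u z * z ^+ N = h z * z ^+ m) ->
  removable_singularity u 0 \/ pole u 0.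
Proof.
move=> r0 dh h0 uE.
have nz z : 0 < cabs z -> z != 0 by rewrite cabs_gt0.
have [Nm|mN] := leqP N m.
  left; apply: (@removable_of_eq u (fun z => h z * z ^+ (m - N)) r r0) => z.
    by move=> /dh[l dl]; eexists; exact: cdiffM dl (cdiffX _ _).
  move=> zr; have /andP[/nz z0 _] := zr; apply: (mulIf (expf_neq0 N z0)).
  by rewrite uE // -mulrA -exprD subnK.
right; apply: pole_of_unbounded => M.
have [l dl] := dh 0 (eq_rect_r (fun x => x < r) r0 cabs0).
pose a := cabs (h 0); have a0 : 0 < a by rewrite cabs_gt0.
have a2 : 0 < a / 2 by rewrite divr_gt0.
have [d d0 dH] := cdiff_cont dl a2.
pose M1 := `|M| + 1; have M0 : 0 < M1 by rewrite ltr_wpDl.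
exists (Num.min (Num.min r d) (Num.min 1 (a / 2 / M1))).
  by rewrite !lt_min r0 d0 ltr01 divr_gt0.
move=> z /andP[z0]; rewrite !lt_min => /andP[/andP[zr zd] /andP[z1 za]].
have hz : a / 2 < cabs (h z).
  have := dH z; rewrite subr0 => /(_ zd) h1.
  by have := cabsD (h 0 - h z) (h z); rewrite subrK (cabsB (h 0)) -/a; lra.
have uz : cabs (u z) * cabs z ^+ (N - m) = cabs (h z).
  have := uE z; rewrite z0 zr => /(_ isT) E.
  rewrite -cabsX -cabsM; congr cabs; apply: (mulIf (expf_neq0 m (nz z z0))).
  by rewrite -E -mulrA -exprD subnK // ltnW.
have zk : cabs z ^+ (N - m) <= cabs z.
  have : (0 < N - m)%N by rewrite subn_gt0.
  case: (N - m)%N => // k _; rewrite exprS ler_piMr ?(ltW z0) //.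
  by rewrite exprn_ile1 ?(ltW z0) ?(ltW z1).
have : M1 * cabs z < cabs (u z) * cabs z.
  rewrite ltr_pdivlMr // in za; rewrite mulrC; apply: lt_le_trans za _.
  apply: le_trans (ltW hz) _; rewrite -uz ler_wpM2l ?cabs_ge0 //.
rewrite ltr_pM2r // => h1; apply: le_lt_trans h1; apply: le_trans (ler_norm _) _.
by rewrite /M1 lerDl.
Qed.

(** Otherwise [moderate_form] applies to [u] and makes [g] have a removable singularity or a pole.
    Taking u = 1 / g produces points where [g] is small. *)
Lemma essential_growth g u (N : nat) :
  (forall z, z != 0 -> g z != 0) -> (forall z, z != 0 -> exists l, cdiff g z l) ->
  essential_singularity g 0 -> (u = g \/ u = (fun z => (g z)^-1)) ->
  exists2 d : R, 0 < d & forall rho, 0 < rho < d ->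
    exists2 z, cabs z = rho & 1 < cabs (z ^+ N * u z).
Proof.
move=> g0 dg [nrem npole] ug.
have u0 z : z != 0 -> u z != 0 by move=> /g0; case: ug => ->; rewrite ?invr_eq0.
have du z : z != 0 -> exists l, cdiff u z l.
  move=> z0; have [l dl] := dg z z0.
  case: ug => ->; first by exists l.
  by eexists; exact: cdiffV (g0 z z0) dl.
apply: contrapT => H.
have [|m [h [r [r0 dh h0 uE]]]] := @moderate_form u N u0 du.
  move=> d d0; apply: contrapT => H'; apply: H; exists d => // rho rhod.
  apply: contrapT => H2; apply: H'; exists rho => // z zr.
  by rewrite leNgt; apply/negP => h1; apply: H2; exists z.
have [d d0 dH] : exists2 d : R, 0 < d & forall z, cabs z < d -> h z != 0.
  have [l dl] := dh 0 (eq_rect_r (fun x => x < r) r0 cabs0).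
  have a0 : 0 < cabs (h 0) by rewrite cabs_gt0.
  have [d d0 dH] := cdiff_cont dl a0; exists d => // z zd.
  apply/negP => /eqP hz; have := dH z; rewrite subr0 hz sub0r cabsN ltxx.
  by move=> /(_ zd).
case: ug => ugE.
  by have := @removable_or_pole_of_form u h N m r r0 dh h0 uE; rewrite ugE => -[/nrem|/npole].
have q0 : 0 < Num.min d r by rewrite lt_min d0.
(* Inverting z^N / g = h z^m exchanges [N] and [m] and replaces [h] by its inverse. *)
have := @removable_or_pole_of_form g (fun z => (h z)^-1) m N (Num.min d r) q0.
move=> /(_ _ _ _)/wrap[z|||[/nrem|/npole]] //.
- rewrite lt_min => /andP[/dH hz /dh[l dl]].
  by eexists; exact: cdiffV hz dl.
- by rewrite invr_eq0.
- move=> z; rewrite lt_min => /andP[z0 /andP[/dH hz zr]].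
  have z0' : z != 0 by rewrite -cabs_gt0.
  have := uE z; rewrite z0 zr ugE => /(_ isT) E.
  apply: (mulfI hz); rewrite [RHS]mulrA (divff hz) mul1r mulrCA -E mulrA divff ?mul1r //.
  exact: g0.
Qed.

End EssentialSingularities.

(** * The escaping set in terms of moduli *)

Section EscapingSets.
Context {R : realType}.
Local Notation C := (Cplx R).
Implicit Types (z w : C) (f : C -> C).

Definition escapes f z := forall M : R, 0 < M ->
  exists N : nat, forall n, (N <= n)%N ->
    cabs (iter n f z) < M^-1 \/ M < cabs (iter n f z).

(** An orbit returning infinitely often to a compact annulus about 0 has a cluster point there,
    which is neither 0 nor infinity; conversely such a limit point has a neighbourhood inside an
    annulus that the orbit finally leaves. *)
Lemma escaping_setP f z : escaping_set f z <-> Cstar z /\ escapes f z.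
Proof.
split=> [[z0 om]|[z0 esc]]; split=> //.
  move=> M M0; apply: contrapT => H.
  have near n : exists k, (n <= k)%N /\ M^-1 <= cabs (iter k f z) <= M.
    apply: contrapT => H2; apply: H; exists n => k nk.
    have [h1|h1] := ltP (cabs (iter k f z)) M^-1; first by left.
    have [h2|h2] := ltP M (cabs (iter k f z)); first by right.
    by case: H2; exists k; rewrite h1.
  have [k kP] := choice near.
  have [|w wP] := @bounded_cluster _ (fun n => iter (k n) f z) M.
    by move=> n; have [_ /andP[]] := kP n.
  have : zero_infty (to_sphere w).
    apply: om => n _ B /nbhs_cabsP [e e0 eB].
    have [j nj jw] := wP e n e0.
    exists (to_sphere (iter (k j) f z)); split; last exact: eB.
    by exists (k j) => //=; apply: leq_trans nj (kP j).1.
  case=> [[w0]|//].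
  have Mi : 0 < M^-1 by rewrite invr_gt0.
  have [j _] := wP M^-1 0%N Mi; rewrite w0 subr0.
  by have [_ /andP[h _]] := kP j; rewrite ltNge h.
move=> [w|] omw; last by right.
left; congr to_sphere; apply/eqP/negPn/negP => w0.
have cw : 0 < cabs w by rewrite cabs_gt0.
(* The annulus [1 / M, M] then contains the disc of radius |w| / 2 about [w]. *)
pose M := 2 * cabs w + 2 / cabs w.
have M1 : 0 < 2 / cabs w by rewrite divr_gt0.
have M0 : 0 < M by rewrite /M; lra.
have [N NP] := esc M M0.
have e0 : 0 < cabs w / 2 by rewrite divr_gt0.
have [||p [[k /= Nk <-] kw]] := omw N.+1 _ (fun p => if p is Some v then cabs (v - w) < cabs w / 2 else True).
- by [].
- by apply/nbhs_cabsP; exists (cabs w / 2).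
- have := cabs_triangle (iter k f z) w; move: kw => /= kw h.
  have {h} /ltr_normlP [h1 h2] := le_lt_trans h kw.
  have [h|h] := NP k (ltnW Nk); last by rewrite /M in h; lra.
  have : M^-1 <= cabs w / 2.
    rewrite -[X in _ <= X]invrK lef_pV2 ?posrE ?invr_gt0 //.
    by rewrite invf_div /M; lra.
  lra.
Qed.

End EscapingSets.

(** * Covering of annuli and Picard's theorem *)

Section Covering.
Context {R : realType}.
Local Notation C := (Cplx R).
Implicit Types (z w t : C) (x y rho : R).
Context (f : C -> C).
Context (f0 : forall z, z != 0 -> f z != 0).
Context (df : forall z, z != 0 -> exists l, cdiff f z l).

Lemma exists_log_on_circle z x : cabs z = expR x ->
  exists2 y, `|y| <= pi & z = cexp (cx x y).
Proof.
move=> zx; have z0 : z != 0 by rewrite -cabs_gt0 zx expR_gt0.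
have [w [wz wr wi]] := exists_clog z0; exists (cIm w) => //.
by rewrite -wz; congr cexp; rewrite {1}(cxE w) wr zx expRK.
Qed.

Lemma ccont_modulus_path (F : C -> C) x : (forall y, ccont F (cx x y)) ->
  continuous (fun y => cabs (F (cx x y))).
Proof.
move=> Fc y A /nbhs_ballP[e /= e0 eA]; have [d d0 dH] := Fc y e e0.
apply/nbhs_ballP; exists d => // u; rewrite -ball_normE /= distrC => uy.
apply: eA; rewrite -ball_normE /= distrC.
apply: le_lt_trans (cabs_triangle _ _) (dH _ _).
have -> : cx x u - cx x y = ci * rc (u - y) by apply: c_ext; rewrite !cReImE; ring.
by rewrite cabsM cabs_ci mul1r cabs_rc.
Qed.

Lemma fcexp_diff t : exists l, cdiff (fun u => f (cexp u)) t l.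
Proof.
have [l dl] := df (cexp_neq0 t).
by exists (l * cexp t); exact: cdiff_comp (cdiff_cexp t) dl.
Qed.

Lemma schottky_const_ge1 : 1 <= schottky_const :> R.
Proof.
rewrite -expR0 ler_expR mulr_ge0 ?pi_ge0 // addr_ge0 // mulr_ge0 // expR_ge0.
Qed.

(* If [f] omitted [w] on the annulus, [f (cexp t) / w] would be bounded on the
   circle by Schottky's theorem, centred at a point where its modulus is 1. *)
Lemma annulus_cover x w : w != 0 ->
  (exists2 z, cabs z = expR x & schottky_const * cabs w < cabs (f z)) ->
  (exists2 z, cabs z = expR x & cabs (f z) <= cabs w) ->
  exists2 z, expR (x - 96 * pi) <= cabs z <= expR (x + 96 * pi) & f z = w.
Proof.
move=> w0 [z1 z1x fz1] [z2 z2x fz2]; apply: contrapT => H.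
have cw : 0 < cabs w by rewrite cabs_gt0.
have pi0 : 0 < pi :> R := pi_gt0 R.
have [y1 y1pi z1E] := exists_log_on_circle z1x.
have [y2 y2pi z2E] := exists_log_on_circle z2x.
pose F t := f (cexp t).
have Fc y : ccont F (cx x y) by have [l dl] := fcexp_diff (cx x y); exact: cdiff_cont dl.
pose h y := cabs (F (cx x y)).
have hc : continuous h := ccont_modulus_path Fc.
have h1 : cabs w < h y1.
  rewrite /h /F -z1E; apply: le_lt_trans fz1.
  exact: ler_peMl (ltW cw) schottky_const_ge1.
have h2 : h y2 <= cabs w by rewrite /h /F -z2E.
(* The intermediate value theorem provides the centre, where |f| = |w|. *)
have [y0 y0pi hy0] : exists2 y0, `|y0| <= pi & h y0 = cabs w.
  have [y12|/ltW y12] := leP y1 y2.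
    have [||y0] := @IVT R h y1 y2 (cabs w) y12.
    - exact: continuous_subspaceT.
    - by rewrite ge_min le_max h2 (ltW h1) orbT.
    rewrite in_itv /= => /andP[a b] E; exists y0 => //.
    by move: y1pi y2pi; rewrite !ler_norml => /andP[? ?] /andP[? ?]; lra.
  have [||y0] := @IVT R h y2 y1 (cabs w) y12.
  - exact: continuous_subspaceT.
  - by rewrite ge_min le_max h2 (ltW h1) orbT.
  rewrite in_itv /= => /andP[a b] E; exists y0 => //.
  by move: y1pi y2pi; rewrite !ler_norml => /andP[? ?] /andP[? ?]; lra.
pose t0 : C := cx x y0.
have s0 : 0 < 96 * pi :> R by rewrite mulr_gt0.
(* The two arguments differ by at most 2 pi, less than 96 pi / 32. *)
have t1 : cabs (cx x y1 - t0) < 96 * pi / 32.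
  have -> : cx x y1 - t0 = ci * rc (y1 - y0) by apply: c_ext; rewrite !cReImE; ring.
  rewrite cabsM cabs_ci mul1r cabs_rc ltr_norml.
  by move: y1pi y0pi; rewrite !ler_norml => /andP[? ?] /andP[? ?]; lra.
have := @schottky R (fun t => F t / w) t0 (96 * pi) s0.
move=> /(_ _ _ _ _ _ t1)/wrap[t _|t _|t tt||].
- have [l dl] := fcexp_diff t; exists (w^-1 * l).
  by apply: cdiff_eq (cdiffZ w^-1 dl) => // v; rewrite mulrC.
- by rewrite mulf_neq0 ?invr_eq0 // f0 // cexp_neq0.
- apply/negP => /eqP E; apply: H; exists (cexp t).
    rewrite cabs_cexp !ler_expR; have := le_lt_trans (abs_Re_le _) tt.
    by rewrite !cReImE ltr_norml => /andP[? ?]; lra.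
  by rewrite -[LHS](divfK w0) -/(F t) E mul1r.
- by rewrite cabsM cabsV -/(h y0) hy0 divff // gt_eqF.
rewrite cabsM cabsV ler_pdivrMr // leNgt => /negP; apply.
by rewrite /F -z1E.
Qed.

Context (ess0 : essential_singularity f 0) (essinf : essential_singularity_infty f).

(** Four uses of [essential_growth]: at 0 and at infinity, for the map and for its reciprocal. The
    exponent 2 makes the bounds exp (2 |x|) beat exp (|x| + D) for every constant D. *)
Lemma growth : exists X : R, forall x, X <= `|x| ->
  (exists2 z, cabs z = expR x & expR (2 * `|x|) < cabs (f z)) /\
  (exists2 z, cabs z = expR x & cabs (f z) < expR (- (2 * `|x|))).
Proof.
pose g z := f z^-1.
have g0 z : z != 0 -> g z != 0 by move=> z0; rewrite f0 // invr_eq0.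
have dg z : z != 0 -> exists l, cdiff g z l.
  move=> z0; have [|l dl] := df (z := z^-1); first by rewrite invr_eq0.
  by eexists; exact: cdiff_comp (cdiffV z0 (cdiff_id z)) dl.
have [d1 d10 H1] := essential_growth 2 f0 df ess0 (or_introl erefl).
have [d2 d20 H2] := essential_growth 2 f0 df ess0 (or_intror erefl).
have [d3 d30 H3] := essential_growth 2 g0 dg essinf (or_introl erefl).
have [d4 d40 H4] := essential_growth 2 g0 dg essinf (or_intror erefl).
pose d := Num.min (Num.min d1 d2) (Num.min d3 d4).
have d0 : 0 < d by rewrite !lt_min d10 d20 d30 d40.
exists (1 - ln d) => x xX.
have rd : expR (- `|x|) < d.
  by rewrite -[X in _ < X](lnK (x := d)) ?posrE // ltr_expR; lra.
have e2 (a : R) : expR (- a) ^+ 2 = expR (- (2 * a)).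
  by rewrite expr2 -expRD; congr expR; ring.
have up (u : C -> C) z : cabs z = expR (- `|x|) -> 1 < cabs (z ^+ 2 * u z) -> expR (2 * `|x|) < cabs (u z).
  move=> zx; rewrite cabsM cabsX zx e2 expRN -ltr_pdivrMl ?invr_gt0 ?expR_gt0 //.
  by rewrite invrK mulr1.
have down (a : C) : 0 < cabs a -> expR (2 * `|x|) < cabs a^-1 -> cabs a < expR (- (2 * `|x|)).
  move=> a0; rewrite cabsV expRN => h.
  by rewrite -[X in X < _]invrK ltf_pV2 ?posrE ?invr_gt0 ?expR_gt0.
have rin : 0 < expR (- `|x|) < d by rewrite expR_gt0.
have [x0|x0] := leP 0 x.
  have nx : `|x| = x by rewrite ger0_norm.
  have r3 : 0 < expR (- `|x|) < d3 by move: rin; rewrite !lt_min => /andP[-> /andP[_ /andP[-> _]]].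
  have r4 : 0 < expR (- `|x|) < d4 by move: rin; rewrite !lt_min => /andP[-> /andP[_ /andP[_ ->]]].
  have [z zr zg] := H3 _ r3; have [z' zr' zg'] := H4 _ r4.
  split.
    exists z^-1; first by rewrite cabsV zr expRN invrK nx.
    exact: (up g).
  exists z'^-1; first by rewrite cabsV zr' expRN invrK nx.
  apply: down; last exact: (up (fun z => (g z)^-1)).
  by rewrite cabs_gt0 f0 // invr_eq0 -cabs_gt0 zr' expR_gt0.
have nx : - `|x| = x by rewrite ltr0_norm ?opprK.
have r1 : 0 < expR (- `|x|) < d1 by move: rin; rewrite !lt_min => /andP[-> /andP[/andP[-> _] _]].
have r2 : 0 < expR (- `|x|) < d2 by move: rin; rewrite !lt_min => /andP[-> /andP[/andP[_ ->] _]].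
have [z zr zg] := H1 _ r1; have [z' zr' zg'] := H2 _ r2.
split.
  by exists z; [rewrite zr nx|exact: (up f)].
exists z'; first by rewrite zr' nx.
apply: down; last exact: (up (fun z => (f z)^-1)).
by rewrite cabs_gt0 f0 // -cabs_gt0 zr' expR_gt0.
Qed.

Lemma far_annulus_cover (D : R) : exists X : R, forall x, X <= `|x| -> forall w,
  expR (- (`|x| + D)) <= cabs w <= expR (`|x| + D) ->
  exists2 z, expR (x - 96 * pi) <= cabs z <= expR (x + 96 * pi) & f z = w.
Proof.
have [X XP] := growth.
exists (Num.max X (D + ln schottky_const)) => x; rewrite ge_max => /andP[/XP[up down] xD].
move=> w /andP[w1 w2].
have k0 : 0 < schottky_const :> R := lt_le_trans ltr01 schottky_const_ge1.
have w0 : w != 0 by rewrite -cabs_gt0 (lt_le_trans _ w1) ?expR_gt0.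
have lk : 0 <= ln (schottky_const : R) by rewrite ln_ge0 // schottky_const_ge1.
apply: annulus_cover => //.
  have [z zx zf] := up; exists z => //; apply: le_lt_trans zf.
  rewrite -[X in X * _]lnK ?posrE //.
  apply: le_trans (ler_wpM2l (expR_ge0 _) w2) _.
  by rewrite -expRD ler_expR; lra.
have [z zx zf] := down; exists z => //; apply: le_trans (ltW zf) (le_trans _ w1).
by rewrite ler_expR; lra.
Qed.

(** A far annulus is covered onto every [w] with |ln |w|| at most |x|; large positive x puts the
    preimage near infinity, and large negative x, in [picard0], near 0. *)
Lemma picard w : w != 0 -> forall M : R, exists z, [/\ z != 0, M < cabs z & f z = w].
Proof.
move=> w0 M; have cw : 0 < cabs w by rewrite cabs_gt0.
have pi0 : 0 < pi :> R := pi_gt0 R.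
have [X XP] := far_annulus_cover 0.
pose x := `|X| + `|ln (cabs w)| + `|M| + 96 * pi.
have xx : `|x| = x by rewrite ger0_norm // !addr_ge0 // mulr_ge0 // ltW.
have [||z /andP[z1 _] zw] := XP x _ w _.
- rewrite xx; apply: le_trans (ler_norm _) _; rewrite /x -!addrA lerDl !addr_ge0 //.
  by rewrite mulr_ge0 // ltW.
- have lw : `|ln (cabs w)| <= x.
    by rewrite /x; have := normr_ge0 X; have := normr_ge0 M; lra.
  rewrite xx addr0; move: lw; rewrite ler_norml => /andP[l1 l2].
  by rewrite -[cabs w]lnK ?posrE // !ler_expR l1.
have : M < cabs z.
  apply: lt_le_trans z1; apply: (@lt_le_trans _ _ (1 + (x - 96 * pi))); last exact: expR_ge1Dx.
  by have := ler_norm M; have := normr_ge0 X; have := normr_ge0 (ln (cabs w)); rewrite /x; lra.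
exists z; split => //; rewrite -cabs_gt0; apply: lt_le_trans z1; exact: expR_gt0.
Qed.

Lemma picard0 w : w != 0 -> forall e : R, 0 < e -> exists z, [/\ z != 0, cabs z < e & f z = w].
Proof.
move=> w0 e e0; have cw : 0 < cabs w by rewrite cabs_gt0.
have pi0 : 0 < pi :> R := pi_gt0 R.
have [X XP] := far_annulus_cover 0.
pose x := `|X| + `|ln (cabs w)| + `|ln e| + 1 + 96 * pi.
have x0 : 0 <= x by rewrite !addr_ge0 // mulr_ge0 // ltW.
have xx : `|- x| = x by rewrite normrN ger0_norm.
have [||z /andP[z1 z2] zw] := XP (- x) _ w _.
- rewrite xx; apply: le_trans (ler_norm _) _; rewrite /x -!addrA lerDl !addr_ge0 //.
  by rewrite mulr_ge0 // ltW.
- have lw : `|ln (cabs w)| <= x.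
    by rewrite /x; have := normr_ge0 X; have := normr_ge0 (ln e); lra.
  rewrite xx addr0; move: lw; rewrite ler_norml => /andP[l1 l2].
  by rewrite -[cabs w]lnK ?posrE // !ler_expR l1.
exists z; split => //; first by rewrite -cabs_gt0; apply: lt_le_trans z1; exact: expR_gt0.
apply: le_lt_trans z2 _; rewrite -[X in _ < X]lnK ?posrE // ltr_expR.
have := lerNnormlW (lexx `|ln e|).
by have := normr_ge0 X; have := normr_ge0 (ln (cabs w)); rewrite /x; lra.
Qed.

End Covering.

(** * Finite sets and connected components *)

(** The orbit of [y] stays in the finite set and so repeats; injectivity strips the common initial
    part, which exhibits [y] as an iterate of itself. *)
Lemma finite_injective_onto (T : Type) (D : set T) (g : T -> T) : finite_set D ->
  (forall x, D x -> D (g x)) -> (forall x y, D x -> D y -> g x = g y -> x = y) ->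
  forall y, D y -> exists2 x, D x & g x = y.
Proof.
move=> Dfin gD ginj y Dy.
have Dn n : D (iter n g y) by elim: n => [//|n IH]; exact: gD.
have [m [k E]] : exists m k, iter m g y = iter (m + k.+1) g y.
  apply: contrapT => H; apply: infinite_nat.
  have -> : [set: nat] = (fun n => iter n g y) @^-1` D.
    by apply/seteqP; split => // n _; exact: Dn.
  apply: finite_preimage => // m n _ _ E.
  case: (ltngtP m n) => // mn; case: H.
    by exists m, (n - m.+1)%N; rewrite addnS -addSn subnKC.
  by exists n, (m - n.+1)%N; rewrite addnS -addSn subnKC.
elim: m E => [|m IH] E; first by exists (iter k g y).
by apply: IH; apply: ginj.
Qed.

Lemma connected_adjoin (T : topologicalType) (B : set T) (z : T) : connected B ->
  closure B z -> connected (B `|` [set z]).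
Proof.
move=> Bc zB; apply/connectedP => X [X0 XE sX].
have side b : B `<=` X b -> separated (X b) (X (~~ b)) -> False.
  move=> BX [s1 _]; have [w Xw] := X0 (~~ b).
  have dis v : X b v -> X (~~ b) v -> False.
    move=> h1 h2; have : (closure (X b) `&` X (~~ b)) v by split => //; exact: subset_closure.
    by rewrite s1.
  have : (B `|` [set z]) w by rewrite XE; case: b {BX s1 dis} Xw => /= Xw; [left|right].
  case=> [/BX Xbw|wz]; first exact: dis Xbw Xw.
  have : (closure (X b) `&` X (~~ b)) w by split => //; rewrite wz; exact: closureS zB.
  by rewrite s1.
have BX : B `<=` X false `|` X true by rewrite -XE => v Bv; left.
have [h|h] := connected_subset sX BX Bc; first exact: (side false).
by apply: (side true h); rewrite separatedC.
Qed.

Section ConnectedComponents.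
Context {R : realType}.
Local Notation C := (Cplx R).
Implicit Types (z w : C) (A B E : set C).

(** Components are relatively closed: adjoining a point of the closure keeps a connected set
    connected. *)
Lemma component_not_closure E z w : E z -> closure (connected_component E w) z ->
  connected_component E w = connected_component E z.
Proof.
move=> Ez zc; apply: same_connected_component.
have [Ew|Ew] := pselect (E w); last first.
  by move: zc; rewrite connected_component_out // closure0.
apply: (@connected_component_max _ E (connected_component E w `|` [set z])).
- by left; exact: connected_component_refl.
- by move=> v [/connected_component_sub//|->].
- by apply: connected_adjoin => //; exact: component_connected.
- by right.
Qed.

(** The closures of the finitely many other components have a closed union, which misses [z];
    components are thus relatively open. *)
Lemma finite_components_isolated E z : finite_set (components E) -> E z ->
  exists2 e : R, 0 < e & forall w, cabs (w - z) < e -> E w ->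
    connected_component E w = connected_component E z.
Proof.
move=> Efin Ez.
pose D := components E `\ connected_component E z.
have cD : closed (\bigcup_(A in D) closure A).
  apply: closed_bigcup => [|A _]; last exact: closed_closure.
  exact: finite_setD.
have : nbhs z (~` \bigcup_(A in D) closure A).
  apply: open_nbhs_nbhs; split; first exact: closed_openC.
  move=> [A [[w Ew <-] nA] zA]; apply: nA; exact: component_not_closure.
move=> /nbhs_cabsP[e e0 eD]; exists e => // w /eD wD Ew.
apply: contrapT => H; apply: wD; exists (connected_component E w); last first.
  by apply: subset_closure; exact: connected_component_refl.
by split => //; exists w.
Qed.

Lemma connected_meets_circle B (r : R) : connected B ->
  (exists2 z, B z & cabs z <= r) -> (exists2 z, B z & r <= cabs z) ->
  exists2 z, B z & cabs z = r.
Proof.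
move=> Bc [z1 Bz1 z1r] [z2 Bz2 z2r].
have : connected (@cabs R @` B).
  apply: connected_continuous_connected => //.
  apply: continuous_in_subspaceT => z _ A /nbhs_ballP[e /= e0 eA].
  apply/nbhs_cabsP; exists e => // w wz; apply: eA; rewrite -ball_normE /= distrC.
  exact: le_lt_trans (cabs_triangle _ _) wz.
move=> /connected_intervalP H.
have h1 : (@cabs R @` B) (cabs z1) by exists z1.
have h2 : (@cabs R @` B) (cabs z2) by exists z2.
have [|z Bz zr] := H _ _ h1 h2 r; first by rewrite z1r.
by exists z.
Qed.

Lemma connected_image (f : C -> C) B : connected B -> (forall z, B z -> ccont f z) ->
  connected (f @` B).
Proof.
move=> Bc fB; apply: connected_continuous_connected => //.
by apply: continuous_in_subspaceT => z /set_mem/fB/ccontP.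
Qed.

End ConnectedComponents.

(** * Prescribed itineraries, and invariant sets with finitely many components *)

Section Dynamics.
Context {R : realType}.
Local Notation C := (Cplx R).
Implicit Types (z w c t u : C).
Context (f : C -> C).
Context (f0 : forall z, z != 0 -> f z != 0).
Context (df : forall z, z != 0 -> exists l, cdiff f z l).

Lemma iter_neq0 n z : z != 0 -> iter n f z != 0.
Proof. by move=> z0; elim: n => //= n; exact: f0. Qed.

Lemma iter_cexp_diff n u : exists l, cdiff (fun v => iter n f (cexp v)) u l.
Proof.
elim: n => [|n [l dl]]; first by exists (cexp u); exact: cdiff_cexp.
have [m dm] := df (iter_neq0 n (cexp_neq0 u)).
by exists (m * l); exact: cdiff_comp dl dm.
Qed.

Context (ess0 : essential_singularity f 0) (essinf : essential_singularity_infty f).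

(* Pull back from [J] along the annuli around [|z| = expR (s n)], using that [J] is
   backward invariant and that each annulus covers the next one. Closedness of [J]
   in the punctured plane is stated in logarithmic coordinates. *)
Lemma itinerary_point (J : set C) (sigma : nat -> bool) :
  (forall z, z != 0 -> J (f z) -> J z) ->
  (forall u, (forall e : R, 0 < e -> exists2 v, cabs (v - u) < e & J (cexp v)) -> J (cexp u)) ->
  (forall x : R, exists2 z, cabs z = expR x & J z) ->
  exists z, [/\ z != 0, J z, escapes f z & forall n, (1 < cabs (iter n f z)) = sigma n].
Proof.
move=> Jback Jclosed Jcircle.
pose A : R := 96 * pi.
have A0 : 0 <= A by rewrite mulr_ge0 // pi_ge0.
(* From one centre [s n] to the next the modulus of the logarithm grows by 1, and an annulus extends
   by [A] beyond its centre. *)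
have [X XP] := far_annulus_cover f0 df ess0 essinf (1 + A).
(* The bound A + 1 keeps annulus n at logarithmic distance at least 1 + n from the unit circle, on
   the side that [sigma n] requires. *)
pose X1 := Num.max X (A + 1).
have X1A : A + 1 <= X1 by rewrite le_max lexx orbT.
have X1X : X <= X1 by rewrite le_max lexx.
pose s n : R := if sigma n then X1 + n%:R else - (X1 + n%:R).
have n0 n : 0 <= n%:R :> R by [].
have sE n : `|s n| = X1 + n%:R.
  have h : 0 <= X1 + n%:R by have := n0 n; lra.
  by rewrite /s; case: ifP => _; rewrite ?normrN ger0_norm.
pose annulus n z := expR (s n - A) <= cabs z <= expR (s n + A).
(* Points follow the itinerary only for finitely many steps, being pulled back from a point of [J]
   on the last circle; compactness then supplies an infinite orbit. *)
have chain m : forall n, exists2 z, J z & forall k, (k <= m)%N -> annulus (n + k)%N (iter k f z).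
  elim: m => [|m IH] n.
    have [z zn Jz] := Jcircle (s n); exists z => // k; rewrite leqn0 => /eqP ->.
    by rewrite addn0 /annulus /= zn !ler_expR; lra.
  have [w Jw wR] := IH n.+1.
  have := wR 0%N (leq0n _); rewrite addn0 /= => /andP[w1 w2].
  have := lexx `|s n.+1|; rewrite {1}ler_norml sE -natr1 => /andP[sl su].
  have sn := sE n.
  have [||z zR fz] := XP (s n) _ w _.
  - by rewrite sn; have := n0 n; lra.
  - rewrite sn; apply/andP; split.
      by apply: le_trans w1; rewrite ler_expR; lra.
    by apply: (le_trans w2); rewrite ler_expR; lra.
  have z0 : z != 0.
    by have /andP[h _] := zR; rewrite -cabs_gt0; apply: lt_le_trans h; exact: expR_gt0.
  exists z; first by apply: Jback => //; rewrite fz.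
  case=> [_|k km]; first by rewrite addn0.
  by rewrite iterSr fz addnS -addSn; exact: wR.
(* Logarithms with bounded imaginary part put the points in a bounded set, and the exponential of a
   cluster point cannot be 0. *)
have zm m : exists u, [/\ J (cexp u), cabs u <= `|s 0%N| + A + pi &
    forall k, (k <= m)%N -> annulus k (iter k f (cexp u))].
  have [z Jz zR] := chain m 0%N; have := zR 0%N (leq0n _); rewrite addn0 /= => /andP[z1 z2].
  have cz : 0 < cabs z by apply: lt_le_trans z1; exact: expR_gt0.
  have [|u [uz ur ui]] := @exists_clog _ z; first by rewrite -cabs_gt0.
  exists u; rewrite uz; split => //.
  apply: le_trans (cabs_le_ReIm _) _; rewrite lerD // ur ler_norml.
  have := lexx `|s 0%N|; rewrite {1}ler_norml => /andP[s1 s2].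
  by rewrite -ler_expR -(ler_expR (ln _)) lnK ?posrE // (le_trans _ z1) ?(le_trans z2) // ler_expR; lra.
have [v vP] := choice zm.
have [|u uP] := @bounded_cluster _ v (`|s 0%N| + A + pi); first by move=> n; have [] := vP n.
have uR k : annulus k (iter k f (cexp u)).
  have [l dl] := iter_cexp_diff k u; have Fc := cdiff_cont dl.
  have key (e : R) : 0 < e -> exists2 w, annulus k w & cabs (w - iter k f (cexp u)) < e.
    move=> e0; have [d d0 dH] := Fc e e0; have [m km mu] := uP d k d0.
    by exists (iter k f (cexp (v m))); [have [_ _] := vP m; apply|exact: dH].
  apply/andP; split; apply/ler_addgt0Pr => e e0; have [w /andP[w1 w2] we] := key e e0.
    by have := cabs_triangle w (iter k f (cexp u)); rewrite ler_norml => /andP[? ?]; lra.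
  by have := cabs_triangle w (iter k f (cexp u)); rewrite ler_norml => /andP[? ?]; lra.
have big n : sigma n -> expR (1 + n%:R) <= cabs (iter n f (cexp u)).
  move=> sn; have /andP[h _] := uR n; apply: le_trans h; rewrite ler_expR /s sn; lra.
have small n : ~~ sigma n -> cabs (iter n f (cexp u)) <= expR (- (1 + n%:R)).
  move=> /negbTE sn; have /andP[_ h] := uR n; apply: (le_trans h); rewrite ler_expR /s sn; lra.
have grow n : 1 + (1 + n%:R) <= expR (1 + n%:R) :> R := expR_ge1Dx _.
exists (cexp u); split.
- exact: cexp_neq0.
- apply: Jclosed => e e0; have [m _ mu] := uP e 0%N e0.
  by exists (v m) => //; have [] := vP m.
- move=> M M0; exists (Num.bound M) => n nM.
  have Mn : M < expR (1 + n%:R).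
    apply: lt_le_trans (archi_boundP (ltW M0)) _; apply: le_trans (grow n).
    have : (Num.bound M)%:R <= n%:R :> R by rewrite ler_nat.
    lra.
  have [/big h|/small h] := boolP (sigma n); [right|left].
    exact: lt_le_trans h.
  apply: (le_lt_trans h); rewrite expRN ltf_pV2 ?posrE ?expR_gt0 //.
- move=> n; have [sn|sn] := boolP (sigma n).
    by apply: lt_le_trans (big n sn); have := grow n; have := n0 n; lra.
  apply/negbTE; rewrite -leNgt; apply: le_trans (small n sn) _.
  by rewrite -[X in _ <= X]expR0 ler_expR; have := n0 n; lra.
Qed.

Section InvariantSet.
Context (E : set C).
Context (E1 : forall z, E z -> z != 0).
Context (E2 : forall z, z != 0 -> E z <-> E (f z)).
Context (E3 : forall c t (K : R), E c -> t != 0 ->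
  (forall n, cabs (iter n f t) <= K * cabs (iter n f c) /\
             cabs (iter n f c) <= K * cabs (iter n f t)) -> E t).
Context (Efin : finite_set (components E)).

Let comp := connected_component E.

Let E_iter n z : z != 0 -> E z <-> E (iter n f z).
Proof.
move=> z0; elim: n => //= n IH.
exact: iff_trans IH (E2 (iter_neq0 n z0)).
Qed.

Lemma component_step z w : E z -> comp z w -> comp (f z) (f w).
Proof.
move=> Ez zw.
apply: (@connected_component_max _ E (f @` comp z)); last by exists w.
- by exists z => //; exact: connected_component_refl.
- by move=> _ [v /connected_component_sub Ev <-]; exact/(E2 (E1 Ev)).
- apply: connected_image; first exact: component_connected.
  by move=> v /connected_component_sub/E1/df[l dl]; exact: cdiff_cont dl.
Qed.

Lemma component_iter n z w : E z -> comp z w -> comp (iter n f z) (iter n f w).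
Proof.
move=> Ez zw; elim: n => //= n IH; apply: component_step => //.
exact/(E_iter n (E1 Ez)).
Qed.

(* By Picard's theorem every component has a preimage component meeting [P]; this
   defines an injection of the finite set of components into itself. *)
Lemma component_meets (P : C -> Prop) :
  (forall w, w != 0 -> exists z, [/\ z != 0, P z & f z = w]) ->
  forall z, E z -> exists2 w, comp z w & P w.
Proof.
move=> pic.
have pre (B : set C) : exists B' : set C, components E B -> exists w,
    [/\ B = comp (f w), B' = comp w, E w & P w].
  have [[w Ew <-]|] := pselect (components E B); last by exists set0.
  have [z [z0 Pz fz]] := pic w (E1 Ew).
  by exists (comp z) => _; exists z; split => //; [rewrite fz|apply/E2; rewrite ?fz].
have [g gP] := choice pre.
have gD B : components E B -> components E (g B).
  by move=> /gP[w [_ -> Ew _]]; exists w.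
have ginj B B' : components E B -> components E B' -> g B = g B' -> B = B'.
  move=> /gP[w [-> -> Ew _]] /gP[w' [-> -> Ew' _]] ww.
  apply: same_connected_component; apply: component_step => //.
  by rewrite ww; exact: connected_component_refl.
move=> z Ez; have [|B /gP[w [_ -> Ew Pw]] wz] := finite_injective_onto Efin gD ginj (y := comp z).
  by exists z.
by exists w => //; rewrite -wz; exact: connected_component_refl.
Qed.

Lemma component_meets_circle z (rho : R) : E z -> 0 < rho -> exists2 w, comp z w & cabs w = rho.
Proof.
move=> Ez rho0; apply: connected_meets_circle; first exact: component_connected.
- have [w w0|w zw h] := @component_meets (fun v => cabs v < rho) _ z Ez.
    exact: (picard0 f0 df ess0 essinf w0 rho0).
  by exists w => //; exact: ltW.
- have [w w0|w zw h] := @component_meets (fun v => rho < cabs v) _ z Ez.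
    exact: (picard f0 df ess0 essinf w0 rho).
  by exists w => //; exact: ltW.
Qed.

Context (a b : C) (Ea : E a) (Eb : E b) (ab : comp a <> comp b).

Let other_component z : exists2 w, E w & comp w <> comp z.
Proof.
have [za|za] := pselect (comp z = comp a); last by exists a => // /esym.
by exists b => //; rewrite za => /esym.
Qed.

(* Near a point of [E] all the iterates omit a component of [E]; as it meets every
   circle, the logarithms of the iterates omit a net and Bloch's theorem bounds
   their oscillation. *)
Lemma invariant_set_open u : E (cexp u) ->
  exists2 e : R, 0 < e & forall v, cabs (v - u) < e -> E (cexp v).
Proof.
move=> Eu; have [e e0 eE] := finite_components_isolated Efin Eu.
have [d d0 dH] := @ccont_cexp _ u e e0.
have pi0 : 0 < pi :> R := pi_gt0 R.
have p2 : 0 < 2 * pi :> R by rewrite mulr_gt0.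
have d2 : 0 < d / 2 by rewrite divr_gt0.
(* The logarithm of an iterate halves the radius, and Bloch's theorem divides it by 4. *)
exists (d / 2 / 4); first by rewrite !divr_gt0.
move=> v vu.
have bound n : exists2 g, `|g| <= 64 * (2 * pi) & cabs (iter n f (cexp v)) = expR g * cabs (iter n f (cexp u)).
  have En : E (iter n f (cexp u)) by exact/(E_iter n (cexp_neq0 u)).
  have [w1 [w1E _ _]] := exists_clog (iter_neq0 n (cexp_neq0 u)).
  have [G _ GP] := @holomorphic_log _ (fun t => iter n f (cexp t)) u d w1 d0
    (fun t _ => iter_cexp_diff n t) (fun t _ => iter_neq0 n (cexp_neq0 t)) w1E.
  (* The omitted value near [w] is a logarithm of a point [q] of another component with |q| = exp
     (Re w), shifted by a multiple of 2 pi i towards [w]. *)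
  have omit : omits_net [set t | cabs (t - u) < d / 2] G (2 * pi).
    move=> w; have [p Ep pu] := other_component (iter n f (cexp u)).
    have [q pq qw] := component_meets_circle Ep (expR_gt0 (cRe w)).
    have [y _ qE] := exists_log_on_circle qw.
    have [k kP] := exists_int_near (cIm w - y) p2.
    exists (cx (cRe w) y + cx 0 (2 * pi * k%:~R)).
      apply: le_trans (cabs_le_ReIm _) _; rewrite !cReImE addr0 subrr normr0 add0r.
      by rewrite -[X in `|X|](_ : 2 * pi * k%:~R - (cIm w - y) = _) //; ring.
    move=> t /= tu Gt; have tud : cabs (t - u) < d by lra.
    have := (GP t tu).2; rewrite Gt cexpD cexp_2pi_int mulr1 -qE => qt.
    (* If an iterate of exp t hit [q], then exp t would be in [E] by backward invariance, hence in
       the component of exp u, whose image does not meet that of [q]. *)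
    have Et : E (cexp t).
      apply/(E_iter n (cexp_neq0 t)); rewrite -qt; exact: connected_component_sub pq.
    have ut : comp (cexp u) (cexp t).
      by rewrite /comp -(eE _ (dH t tud) Et); exact: connected_component_refl.
    have := component_iter n Eu ut; rewrite -qt => uq; apply: pu.
    apply: eq_trans (same_connected_component pq) _; apply/esym.
    exact: same_connected_component uq.
  have osc := bloch_oscillation d2 p2 (fun t tu => (GP t tu).1) omit vu.
  exists (cRe (G v - G u)); first exact: le_trans (abs_Re_le _) osc.
  rewrite -cabs_cexp -cabsM.
  have vd : cabs (v - u) < d / 2 by lra.
  have ud : cabs (u - u) < d / 2 by rewrite subrr cabs0.
  by rewrite -(GP v vd).2 -(GP u ud).2 -cexpD subrK.
apply: (E3 (K := expR (64 * (2 * pi))) Eu (cexp_neq0 v)) => n.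
have [g gb ->] := bound n; move: gb; rewrite ler_norml => /andP[g1 g2].
split; first by rewrite ler_wpM2r ?cabs_ge0 // ler_expR.
by rewrite mulrA -expRD ler_peMl ?cabs_ge0 // -[X in X <= _]expR0 ler_expR; lra.
Qed.

(** On a circle inside [E] the indicator of the component of [a] would be continuous, as components
    are relatively open, yet take both values, since the components of [a] and [b] both meet the
    circle. *)
Lemma complement_meets_circle (x : R) : exists2 z, cabs z = expR x & ~ E z.
Proof.
apply: contrapT => H.
have EC y : E (cexp (cx x y)).
  apply: contrapT => nE; apply: H; exists (cexp (cx x y)) => //.
  by rewrite cabs_cexp.
pose h (y : R) : R := if `[< comp (cexp (cx x y)) = comp a >] then 1 else 0.
have hc : continuous h.
  move=> y U hU; have [e e0 eE] := finite_components_isolated Efin (EC y).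
  have [d d0 dH] := @ccont_cexp _ (cx x y) e e0.
  apply/nbhs_ballP; exists d => // t; rewrite -ball_normE /= distrC => ty.
  suff -> : h t = h y by exact: nbhs_singleton.
  rewrite /h /comp (eE (cexp (cx x t))) //; apply: dH.
  have -> : cx x t - cx x y = ci * rc (t - y) by apply: c_ext; rewrite !cReImE; ring.
  by rewrite cabsM cabs_ci mul1r cabs_rc.
have [p ap pw] := component_meets_circle Ea (expR_gt0 x).
have [q bq qw] := component_meets_circle Eb (expR_gt0 x).
have [y1 _ pE] := exists_log_on_circle pw.
have [y2 _ qE] := exists_log_on_circle qw.
have h1 : h y1 = 1.
  by rewrite /h asboolT // -pE; apply/esym; exact: same_connected_component.
have h2 : h y2 = 0.
  rewrite /h asboolF // -qE => qa; apply: ab; rewrite -qa.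
  by apply/esym; exact: same_connected_component.
have half y : h y <> 1 / 2.
  by rewrite /h; case: ifP => _ E12; move: E12; lra.
have [y12|/ltW y12] := leP y1 y2.
  have [||y _ /half//] := @IVT R h y1 y2 (1 / 2) y12.
    exact: continuous_subspaceT.
  by rewrite h1 h2 ge_min le_max; apply/andP; split; apply/orP; [right|left]; lra.
have [||y _ /half//] := @IVT R h y2 y1 (1 / 2) y12.
  exact: continuous_subspaceT.
by rewrite h1 h2 ge_min le_max; apply/andP; split; apply/orP; [left|right]; lra.
Qed.

Lemma complement_itinerary_point (sigma : nat -> bool) :
  exists z, [/\ z != 0, ~ E z, escapes f z & forall n, (1 < cabs (iter n f z)) = sigma n].
Proof.
apply: (@itinerary_point (fun z => ~ E z) sigma).
- by move=> z z0 nE Ez; apply: nE; apply/(E2 z0).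
- move=> u H Eu; have [e e0 eE] := invariant_set_open Eu.
  by have [v /eE] := H e e0.
- exact: complement_meets_circle.
Qed.

End InvariantSet.

(** One itinerary [sigma] all of whose escaping points lie in [E] suffices to contradict
    [complement_itinerary_point]. *)
Theorem invariant_set_connected_or_infinite (E : set C) :
  (forall z, E z -> z != 0) -> (forall z, z != 0 -> E z <-> E (f z)) ->
  (forall c t (K : R), E c -> t != 0 ->
    (forall n, cabs (iter n f t) <= K * cabs (iter n f c) /\
               cabs (iter n f c) <= K * cabs (iter n f t)) -> E t) ->
  (exists sigma : nat -> bool, forall z, z != 0 -> escapes f z ->
    (forall n, (1 < cabs (iter n f z)) = sigma n) -> E z) ->
  connected E \/ infinite_set (components E).
Proof.
move=> E1 E2 E3 [sigma E4].
have [Efin|] := pselect (finite_set (components E)); last by right.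
left; apply: contrapT => nconn.
have [a Ea] : E !=set0.
  by apply/set0P/eqP => E0; apply: nconn; rewrite E0; exact: connected0.
have [b [Eb ab]] : exists b, E b /\ connected_component E a <> connected_component E b.
  apply: contrapT => H; apply: nconn.
  suff -> : E = connected_component E a by exact: component_connected.
  apply/seteqP; split=> [b Eb|b /connected_component_sub//].
  have [->|nab] := pselect (connected_component E a = connected_component E b).
    exact: connected_component_refl.
  by case: H; exists b.
have [z [z0 nEz esc it]] := complement_itinerary_point E1 E2 E3 Efin Ea Eb ab sigma.
exact: nEz (E4 z z0 esc it).
Qed.

End Dynamics.

(** * The escaping sets as invariant sets *)

Section EscapingSetsInvariance.
Context {R : realType}.
Local Notation C := (Cplx R).
Implicit Types (f : C -> C) (z c t : C).

Lemma escapes_step f z : escapes f z <-> escapes f (f z).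
Proof.
split=> esc M M0; have [N NP] := esc M M0.
  by exists N => n nN; rewrite -iterSr; apply: NP; exact: leqW.
by exists N.+1 => -[//|n] nN; rewrite iterSr; exact: NP.
Qed.

(** Leaving the annulus of ratio L M along the orbit of [c] forces that of [t] out of the annulus of
    ratio M on the same side. The case M = 1 gives the eventual agreement that itineraries need. *)
Lemma escapes_bounded_ratio f c t (K : R) : escapes f c ->
  (forall n, cabs (iter n f t) <= K * cabs (iter n f c) /\
             cabs (iter n f c) <= K * cabs (iter n f t)) ->
  escapes f t /\ exists N, forall n, (N <= n)%N ->
    (1 < cabs (iter n f t)) = (1 < cabs (iter n f c)).
Proof.
move=> esc ratio; pose L := `|K| + 1.
have L1 : 1 <= L by rewrite lerDr.
have ratioL n : cabs (iter n f t) <= L * cabs (iter n f c) /\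
    cabs (iter n f c) <= L * cabs (iter n f t).
  have [h1 h2] := ratio n; have KL : K <= L.
    by apply: le_trans (ler_norm K) _; rewrite lerDl.
  split; [apply: le_trans h1 _|apply: le_trans h2 _]; by rewrite ler_wpM2r ?cabs_ge0.
have far (M : R) : 0 < M -> exists N, forall n, (N <= n)%N ->
    (cabs (iter n f c) < M^-1 /\ cabs (iter n f t) < M^-1) \/
    (M < cabs (iter n f c) /\ M < cabs (iter n f t)).
  move=> M0; have LM : 0 < L * M by rewrite mulr_gt0 // (lt_le_trans ltr01).
  have [N NP] := esc _ LM; exists N => n /NP h; have [r1 r2] := ratioL n.
  have L0 : 0 < L := lt_le_trans ltr01 L1.
  case: h => h; [left|right].
    have h' : cabs (iter n f c) * L < M^-1.
      by rewrite -ltr_pdivlMr // -invfM mulrC.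
    have := cabs_ge0 (iter n f c); split; nra.
  have : L * M < L * cabs (iter n f t) by exact: lt_le_trans r2.
  by rewrite ltr_pM2l // => h2; split => //; apply: le_lt_trans h; rewrite ler_peMl // ltW.
split=> [M /far[N NP]|].
  by exists N => n /NP[[_ h]|[_ h]]; [left|right].
have [N NP] := far 1 ltr01; exists N => n /NP; rewrite invr1 => -[] [h1 h2].
  by rewrite ltNge (ltW h2) ltNge (ltW h1).
by rewrite h1 h2.
Qed.

Lemma modulus_gt1 z : (1 < `|z|) = (1 < cabs z).
Proof. by rewrite cabsE -rc1 ltcR. Qed.

End EscapingSetsInvariance.

Theorem theorem1p1 (R : realType) (f : Cplx R -> Cplx R)
    (hf : transcendental_self_map f) :
  (connected (escaping_set f) \/ infinite_set (components (escaping_set f))) /\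
  (forall e : nat -> Csphere R, (forall n : nat, zero_infty (e n)) ->
     connected (little_escaping_set f e) \/
     infinite_set (components (little_escaping_set f e))).
Proof.
case: hf => fstar hol ess0 essinf.
have f0 z : z != 0 -> f z != 0 by exact: fstar.
have df z : z != 0 -> exists l, cdiff f z l by move=> /hol/derivable_cdiff.
have invariant := invariant_set_connected_or_infinite f0 df ess0 essinf.
have esc_step z : z != 0 -> escaping_set f z <-> escaping_set f (f z).
  move=> z0; rewrite !escaping_setP escapes_step.
  by split=> -[_ h]; split => //; exact: f0.
have esc_ratio c t (K : R) : escaping_set f c -> t != 0 ->
    (forall n, cabs (iter n f t) <= K * cabs (iter n f c) /\
               cabs (iter n f c) <= K * cabs (iter n f t)) ->
    escaping_set f t /\ exists N, forall n, (N <= n)%N ->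
      (1 < cabs (iter n f t)) = (1 < cabs (iter n f c)).
  move=> /escaping_setP[_ esc] t0 /(escapes_bounded_ratio esc)[esct N].
  by split => //; apply/escaping_setP.
split=> [|e _]; apply: invariant.
- by move=> z /escaping_setP[].
- exact: esc_step.
- by move=> c t K Ec t0 /(esc_ratio _ _ _ Ec t0)[].
(* Any itinerary would do here, since all escaping points belong to the set. *)
- by exists (fun=> true) => z z0 esc _; apply/escaping_setP.
- by move=> z [/escaping_setP[]].
- move=> z z0; split=> -[Ez [l [k itin]]]; split; try exact/(esc_step z z0).
    (* The orbit of f z lacks the first point of that of z, so the itinerary is read one place
       later. *)
    exists l, k.+1 => n; rewrite -iterSr -addSn addnS -addSn; exact: itin.
  by exists l.+1, k => n; rewrite addnS iterSr; exact: itin.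
- move=> c t K [Ec [l [k itin]]] t0 /(esc_ratio _ _ _ Ec t0)[Et [N NP]]; split=> //.
  (* Both shifts skip the first [N] steps, where the two orbits may lie on different sides of the
     unit circle. *)
  exists (l + N)%N, (k + N)%N => n.
  rewrite modulus_gt1 NP; last by rewrite addnA leq_addl.
  by rewrite -modulus_gt1 [(l + N)%N]addnC [(k + N)%N]addnC !addnA; exact: itin.
(* The prescribed itinerary is [e] itself, followed from the start with both shifts 0. *)
- exists (fun n => `[< e n = Cinf >]) => z z0 esc itin; split; first exact/escaping_setP.
  exists 0%N, 0%N => n; rewrite !addn0 modulus_gt1 itin.
  by split=> [/asboolP|h]; last exact/asboolP.
Qed.
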